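(* Let $U\colon\mathbb{T}\to\mathbb{R}$ be real analytic. Then the one-parameter family of Gibbs measures $(\rho_{\beta\cdot U})_{\beta>0}$ converges in the weak* topology, as $\beta\to+\infty$, to a measure $\rho_\infty$ described as follows. If $U$ is constant, then $\rho_\infty=\bigotimes_{\mathbb{Z}}\mathrm{Leb}$. If $U$ is nonconstant, put $U_{\max}=\sup_{\mathbb{T}}U$, and for each $c$ in the finite set $U^{-1}(U_{\max})$ let $\ell(c)$ be the least integer $\ell\ge1$ such that $D^\ell U(c)\ne0$ (which is even), let $$\omega(c)=-\frac{D^{\ell(c)}U(c)}{\ell(c)!}>0,$$ and put $\ell_{\max}=\max\{\ell(c):c\in U^{-1}(U_{\max})\}$. Then $\rho_\infty$ is the unique measure on $\mathbb{T}^{\mathbb{Z}}$ that is symmetric and whose image under the difference map $(\theta_n)_{n\in\mathbb{Z}}\mapsto(\theta_n-\theta_{n+1})_{n\in\mathbb{Z}}$ is the product measure $\bigotimes_{\mathbb{Z}}\pi_*\rho_\infty$, where $$\pi_*\rho_\infty=\frac{\sum_{c\in U^{-1}(U_{\max}),\,\ell(c)=\ell_{\max}}\omega(c)^{-1/\ell_{\max}}\,\delta_c}{\sum_{c\in U^{-1}(U_{\max}),\,\ell(c)=\ell_{\max}}\omega(c)^{-1/\ell_{\max}}}.$$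
   Context: $\mathbb{T} = \mathbb{R}/\mathbb{Z}$ with Lebesgue probability measure $\mathrm{Leb}$; $\pi\colon\mathbb{T}^{\mathbb{Z}}\to\mathbb{T}$ is $\pi((\theta_n)_{n\in\mathbb{Z}})=\theta_0-\theta_1$. $D^\ell U$ is the $\ell$-th derivative of $U$. A measure on $\mathbb{T}^{\mathbb{Z}}$ is symmetric if for every $\theta\in\mathbb{T}$ it is invariant under $(\theta_n)_n\mapsto(\theta_n+\theta)_n$. For a function $U \colon \mathbb{T} \to \mathbb{R}$, $\Phi_U$ is the nearest-neighbor interaction on $\mathbb{T}^{\mathbb{Z}}$ given by $\Phi_U(\{k,k+1\})((\theta_n)_{n\in\mathbb{Z}}) = -U(\theta_k - \theta_{k+1})$ for $k \in \mathbb{Z}$, and $\Phi_U(X)=0$ for all other finite $X \subset \mathbb{Z}$. A Gibbs measure for $\Phi_U$ is a Borel probability measure on $\mathbb{T}^{\mathbb{Z}}$ satisfying the DLR equations with a priori measure $\mathrm{Leb}$: for every finite $\Lambda \subset \mathbb{Z}$, conditionally on the configuration $\underline{\theta}'$ outside $\Lambda$, the configuration $\underline{\theta}$ in $\Lambda$ has density $Z_\Lambda(\underline{\theta}')^{-1}\exp(-H_\Lambda(\underline{\theta}|\underline{\theta}'))$ with respect to $\bigotimes_\Lambda \mathrm{Leb}$, where $H_\Lambda(\underline{\theta}|\underline{\theta}') = \sum_{X \text{ finite},\, X\cap\Lambda\neq\emptyset}\Phi_U(X)(\underline{\theta}\times\underline{\theta}')$ and $Z_\Lambda(\underline{\theta}')$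 is the normalizing constant. When $U$ is continuous there is a unique Gibbs measure for $\Phi_U$, denoted $\rho_U$. *)

(* Defs.v *)
From HB Require Import structures.
From mathcomp Require Import all_boot all_order all_algebra finmap.
From mathcomp Require Import all_classical all_reals all_analysis.
From mathcomp Require Import measurable_realfun.

Set Implicit Arguments.
Unset Strict Implicit.
Unset Printing Implicit Defensive.
Import Order.TTheory GRing.Theory Num.Theory.
Import numFieldNormedType.Exports.

Local Open Scope classical_set_scope.
Local Open Scope ring_scope.
Local Open Scope quotient_scope.

Definition int_subgroup (R : realType) : zmodClosed R :=
  [the zmodClosed R of Num.int_num_subdef : {pred R}].

(* The group R/Z, with the quotient topology and its Borel sets. *)
Definition circle (R : realType) : Type :=
  quotient_topology (ring_quotient.Quotient.quot (int_subgroup R)).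

HB.instance Definition _ (R : realType) := Topological.on (circle R).
HB.instance Definition _ (R : realType) :=
  isPointed.Build (circle R) (\pi_(circle R) 0).
HB.instance Definition _ (R : realType) := Quotient.on (circle R).
HB.instance Definition _ (R : realType) := GRing.isZmodule.Build (circle R)
  (@ring_quotient.Quotient.addqA _ (int_subgroup R))
  (@ring_quotient.Quotient.addqC _ (int_subgroup R))
  (@ring_quotient.Quotient.add0q _ (int_subgroup R))
  (@ring_quotient.Quotient.addNq _ (int_subgroup R)).
HB.instance Definition _ (R : realType) :=
  @isMeasurable.Build (sigma_display (@open (circle R))) (circle R)
    <<s @open (circle R) >> (@sigma_algebra0 _ setT _) (@sigma_algebraC _ _)
    (@sigma_algebra_bigcup _ setT _).

Definition circle_proj (R : realType) : R -> circle R := \pi_(circle R).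

Lemma circle_projD (R : realType) :
  {morph @circle_proj R : x y / x + y >-> x + y}.
Proof. exact: ring_quotient.Quotient.pi_add. Qed.

Lemma circle_proj_eq (R : realType) (x y : R) :
  circle_proj x = circle_proj y <-> x - y \is a Num.int.
Proof.
have E := ring_quotient.Quotient.idealrBE (int_subgroup R) x y.
split=> [xy|]; first by suff: x - y \in int_subgroup R by []; rewrite E; exact/eqP.
by rewrite [X in is_true X -> _]E => /eqP.
Qed.

Lemma circle_proj_continuous (R : realType) : continuous (@circle_proj R).
Proof. exact: pi_continuous. Qed.

Lemma measurable_circle_proj (R : realType) :
  @measurable_fun _ _ (measurableTypeR R) (circle R) setT (@circle_proj R).
Proof.
apply: (@measurability _ _ _ _ _ _ (@open (circle R))) => // _ [B oB <-].
rewrite setTI; apply: open_measurable.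
by move/continuousP: (@circle_proj_continuous R); apply.
Qed.

(* [R] and [measurableTypeR R] carry measurable structures with different
   displays; [uniform_prob] lives on the latter. *)
Definition circle_rv (R : realType) : measurableTypeR R -> circle R :=
  @circle_proj R.

HB.instance Definition _ (R : realType) :=
  @isMeasurableFun.Build _ _ (measurableTypeR R) (circle R) (@circle_rv R)
    (@measurable_circle_proj R).

(* Lebesgue probability measure on R/Z: the law of a uniform variable on [0,1]
   reduced mod 1. *)
Definition leb (R : realType) : probability (circle R) R :=
  distribution (uniform_prob (@ltr01 R)) (@circle_rv R).

Section tuple_product.
Context d (T : measurableType d) (R : realType).

Definition tuple_cons n (u : T * n.-tuple T) : n.+1.-tuple T :=
  [tuple of u.1 :: u.2].

Lemma measurable_tuple_cons n : measurable_fun setT (@tuple_cons n).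
Proof. exact: measurable_cons. Qed.

HB.instance Definition _ n :=
  isMeasurableFun.Build _ _ _ _ (@tuple_cons n) (@measurable_tuple_cons n).

Section pair.
Variables (P : probability T R) (n : nat) (Q : probability (n.-tuple T) R).

Definition pair_prob : set (T * n.-tuple T) -> \bar R := (P \x Q)%E.

HB.instance Definition _ := Measure.on pair_prob.

Lemma pair_prob_setT : pair_prob setT = 1%E.
Proof.
rewrite /pair_prob -setXTT product_measure1E//.
rewrite [X in (X * _)%E](probability_setT P).
by rewrite [X in (_ * X)%E](probability_setT Q) mule1.
Qed.

HB.instance Definition _ :=
  Measure_isProbability.Build _ _ _ pair_prob pair_prob_setT.
End pair.

(* The product of n copies of P. *)
Fixpoint tuple_prob (P : probability T R) n : probability (n.-tuple T) R :=
  if n is m.+1 then distribution (pair_prob P (tuple_prob P m)) (@tuple_cons m)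
  else \d_[tuple].

End tuple_product.

(* Bi-infinite configurations, with the product topology and its Borel sets. *)
Definition config (R : realType) : Type := int -> circle R.

HB.instance Definition _ (R : realType) :=
  Topological.copy (config R) {ptws int -> circle R}.
HB.instance Definition _ (R : realType) :=
  isPointed.Build (config R) (fun=> point).
HB.instance Definition _ (R : realType) :=
  @isMeasurable.Build (sigma_display (@open (config R))) (config R)
    <<s @open (config R) >> (@sigma_algebra0 _ setT _) (@sigma_algebraC _ _)
    (@sigma_algebra_bigcup _ setT _).

Section gibbs.
Context {R : realType}.
Implicit Types (L X : {fset int}) (x : config R).

Definition interaction := {fset int} -> config R -> R.

Definition nn_interaction (U : circle R -> R) : interaction := fun X x =>
  if [pick k : X | X == [fset fsval k; (fsval k + 1)%R]%fset] is Some k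
  then - U (x (fsval k) - x (fsval k + 1)) else 0.

(* Configurations in the finite volume L are tuples indexed along the
   enumeration of L. *)
Definition restrict L x : (size L).-tuple (circle R) :=
  map_tuple x (in_tuple L).

Definition glue L (t : (size L).-tuple (circle R)) x : config R := fun k =>
  if k \in L then nth (x k) t (index k L) else x k.

(* The sum ranges over the sets meeting L whose term is nonzero; for
   [nn_interaction U] there are finitely many. *)
Definition hamiltonian (Phi : interaction) L x : R :=
  \sum_(X \in [set X : {fset int} | (X `&` L)%fset != fset0]) Phi X x.

Definition partition_function (Phi : interaction) L x : \bar R :=
  (\int[tuple_prob (leb R) (size L)]_t
     (expR (- hamiltonian Phi L (glue t x)))%:E)%E.

Definition gibbs_density (Phi : interaction) L x
    (t : (size L).-tuple (circle R)) : R :=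
  (fine (partition_function Phi L x))^-1
    * expR (- hamiltonian Phi L (glue t x)).

Definition outside_events L : set (set (config R)) :=
  <<s \bigcup_(k in [set k : int | k \notin L])
        preimage_set_system setT (fun x : config R => x k) measurable >>.

(* DLR equations: the conditional law of the configuration in L given the
   outside events has density [gibbs_density Phi L x] with respect to Leb^L. *)
Definition is_gibbs_measure (Phi : interaction)
    (rho : probability (config R) R) : Prop :=
  forall L (A : set ((size L).-tuple (circle R))) (B : set (config R)),
    measurable A -> outside_events L B ->
    rho (restrict L @^-1` A `&` B) =
    (\int[rho]_(x in B) \int[tuple_prob (leb R) (size L)]_(t in A)
       (gibbs_density Phi x t)%:E)%E.

End gibbs.

Definition weak_star_cvg (R : realType) (rho : R -> probability (config R) R)
    (rho_oo : probability (config R) R) : Prop :=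
  forall f : config R -> R, continuous f ->
    (fun beta : R => \int[rho beta]_x f x) @ +oo --> \int[rho_oo]_x f x.

(* P is the product over Z of copies of the probability measure m, specified on
   finite-dimensional rectangles. *)
Definition is_product_measure (R : realType) (P : set (config R) -> \bar R)
    (m : set (circle R) -> \bar R) : Prop :=
  forall (L : {fset int}) (A : int -> set (circle R)),
    (forall k, measurable (A k)) ->
    P [set x | forall k, k \in L -> A k (x k)] = (\prod_(k <- L) m (A k))%E.

Section increments.
Context {R : realType}.
Implicit Types (x : config R) (nu : set (config R) -> \bar R).

Definition shift (t : circle R) x : config R := fun k => x k + t.

Definition difference_map x : config R := fun k => x k - x (k + 1).

Definition difference01 x : circle R := x 0 - x 1.

Definition symmetric_measure nu : Prop :=
  forall (t : circle R) (A : set (config R)), measurable A ->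
    pushforward nu (shift t) A = nu A.

Definition symmetric_with_increments nu (m : set (circle R) -> \bar R) : Prop :=
  symmetric_measure nu /\
  is_product_measure (pushforward nu difference_map) m.

End increments.

Section potential.
Context {R : realType} (U : circle R -> R).

Definition real_analytic : Prop :=
  forall a : R, exists u : nat -> R,
    \forall s \near a, pseries u (s - a) @ \oo --> U (circle_proj s).

(* The l-th derivative of U, computed on the 1-periodic lift of U to R. *)
Definition circle_derive (l : nat) (c : circle R) : R :=
  derive1n l (fun s : R => U (circle_proj s)) (repr c).

Definition maximizers : set (circle R) := [set c | U c = sup (range U)].

(* l is the least positive order of a nonvanishing derivative of U at c. *)
Definition is_flatness (c : circle R) (l : nat) : Prop :=
  [/\ (1 <= l)%N, circle_derive l c != 0 &
      forall k, (1 <= k < l)%N -> circle_derive k c = 0].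

Definition flatness (c : circle R) : nat := get (is_flatness c).

Definition omega (c : circle R) : R :=
  - circle_derive (flatness c) c / (flatness c)`!%:R.

(* For analytic nonconstant U there are finitely many maximizers, so that this
   finitely supported maximum, and the sums below, are the expected ones. *)
Definition max_flatness : nat :=
  \big[maxn/0%N]_(c \in maximizers) flatness c.

Definition flattest : set (circle R) :=
  [set c | maximizers c /\ flatness c = max_flatness].

Definition weight (c : circle R) : R := omega c `^ (- max_flatness%:R^-1).

Definition limit_marginal (A : set (circle R)) : \bar R :=
  ((\sum_(c \in flattest) (weight c)%:E * \d_c A) *
   ((\sum_(c \in flattest) weight c)^-1)%:E)%E.

End potential.

(* Main.v *)
(* The single-site DLR equations make a Gibbs measure invariant under resampling
   one spin. Hence the probability of a finite window of increments is an integral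
   of a product of transition kernels exp(b(s - t)), continued on both sides by long
   chains of such kernels. Since b is bounded these chains forget their endpoints
   exponentially fast (Doeblin), so that the increments are i.i.d. with density
   exp(b - pressure) and independent of the uniform spin at 0. Such a measure is
   determined by the law of one increment.

   Cutting the circle at a point that is not a maximizer turns the increment law
   into a law on an interval. Laplace's method at each maximizer c, where
   U = U_max - omega(c) x^l(c) to leading order, gives convergence of its
   distribution function away from the maximizers. The distribution function of
   the increment law at beta = 1 is continuous, so composing it with quantile
   functions realizes the increments at all temperatures, and at the limit, on one
   probability space; quantiles converge almost surely, and weak* convergence
   follows by dominated convergence. *)

Require Import Defs.
From HB Require Import structures.
From mathcomp Require Import all_boot all_order all_algebra finmap.
From mathcomp Require Import all_classical all_reals all_analysis.
From mathcomp Require Import measurable_realfun ring lra zify.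

Set Implicit Arguments.
Unset Strict Implicit.
Unset Printing Implicit Defensive.
Import Order.TTheory GRing.Theory Num.Theory.
Import numFieldNormedType.Exports.

Local Open Scope classical_set_scope.
Local Open Scope ring_scope.

(** * The circle *)

(** The DLR equations are used one spin at a time, so they say nothing directly about a window of
    spins. The remedy is to divide by the Boltzmann factor of a block of edges: under rho weighted
    by the inverse of this factor, every interior spin of the block may be resampled with plain Leb,
    so interior spins are integrated out one by one and become iterated kernels. The mass of the
    weighted measure is unknown, a priori possibly infinite; it is eliminated by applying the same
    estimates to the whole space, whose probability is 1. Subtracting the pressure leaves the
    conditional densities unchanged and makes exp(b) a probability density, so that the kernels
    preserve constants and, for |b| <= M, contract at rate 1 - exp(-M). No infinite product is built
    from scratch: the increments at beta = 1 already form one, and moving its coordinates gives a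
    product with any marginal. The same construction therefore yields both the existence of the
    limit and the convergence. In Laplace's method everything is rescaled by beta^(1/l_max), which
    kills the less flat maximizers; the partition function disappears in a ratio of two
    integrals. *)

Section circle_section.
Context {R : realType}.
Implicit Types (x y s : R) (c : circle R).

Lemma circle_proj_int x (n : int) : circle_proj (x + n%:~R) = circle_proj x.
Proof. by apply/circle_proj_eq; rewrite addrC addKr; exact: intr_int. Qed.

Lemma circle_projN : {morph @circle_proj R : x / - x}.
Proof.
move=> x; apply/eqP; rewrite -addr_eq0 -circle_projD addNr.
by apply/eqP; rewrite -[LHS]addr0 -[X in _ + X](subrr (circle_proj 0)) addrA -circle_projD addr0 subrr.
Qed.

Lemma circle_projB : {morph @circle_proj R : x y / x - y}.
Proof. by move=> x y; rewrite circle_projD circle_projN. Qed.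

(** Section of the projection with values in [s, s + 1). The cut s stays free so that it can later
    be placed away from the maximizers. *)
Definition csec s c : R := repr c - (Num.floor (repr c - s))%:~R.

Lemma csecK s : cancel (csec s) (@circle_proj R).
Proof.
move=> c; rewrite /csec -mulrNz circle_proj_int.
by rewrite /circle_proj reprK.
Qed.

Lemma csec_itv s c : s <= csec s c < s + 1.
Proof.
rewrite /csec; set x := repr c.
have /andP[h1 h2] := floor_itv (x - s).
move: h1 h2; rewrite intrD. by lra.
Qed.

Lemma csec_proj s x : s <= x < s + 1 -> csec s (circle_proj x) = x.
Proof.
move=> xs; have ys := csec_itv s (circle_proj x).
have /circle_proj_eq := csecK s (circle_proj x).
move=> /intrP[n nE]; have -> : csec s (circle_proj x) = x + n%:~R by lra.
move: xs ys => /andP[x1 x2] /andP[y1 y2]; have n1 : -1 < n%:~R :> R by lra.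
have n2 : n%:~R < 1 :> R by lra.
have {}n2 : n < 1 by rewrite -(ltr_int R).
have {}n1 : -1 < n by rewrite -(ltr_int R) mulrN1z.
move: n1 n2.
by clear; case: n => [[|n]|[|n]]//=; rewrite addr0.
Qed.

(** In the quotient topology a set is open when its preimage is, and the preimage of the image of A
    is the union of the integer translates of A. *)
Lemma circle_proj_open (A : set R) : open A -> open (@circle_proj R @` A).
Proof.
move=> oA; rewrite /open/=.
have -> : (@circle_proj R) @` A =
    [set c | exists n : int, A (repr c + n%:~R)].
  apply/seteqP; split=> c /=.
    move=> [x Ax <-].
    have /esym/circle_proj_eq/intrP[n nE] : circle_proj (repr (circle_proj x)) = circle_proj x.
      by rewrite /circle_proj reprK.
    by exists n; rewrite -nE addrC subrK.
  by move=> [n An]; eexists; first exact: An; rewrite circle_proj_int /circle_proj reprK.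
suff : open ((@circle_proj R) @^-1` [set c | exists n : int, A (repr c + n%:~R)]) by [].
rewrite (_ : _ @^-1` _ = \bigcup_(n : int) ((fun x => x + n%:~R) @^-1` A)).
  apply: bigcup_open => n _; apply: open_comp => // x _.
  by apply: continuousD; [exact: cvg_id|exact: cvg_cst].
apply/seteqP; split=> x /=.
  move=> [n An].
  have /circle_proj_eq/intrP[m mE] : circle_proj (repr (circle_proj x)) = circle_proj x.
    by rewrite /circle_proj reprK.
  exists (m + n) => //=.
  by rewrite intrD -mE; have -> : x + (repr (circle_proj x) - x + n%:~R) = repr (circle_proj x) + n%:~R by ring.
move=> [n _ /= An].
have /esym/circle_proj_eq/intrP[m mE] : circle_proj (repr (circle_proj x)) = circle_proj x.
  by rewrite /circle_proj reprK.
exists (m + n); rewrite intrD -mE.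
by have -> : repr (circle_proj x) + (x - repr (circle_proj x) + n%:~R) = x + n%:~R by ring.
Qed.

(** The section jumps at the cut, but above level x >= s it is the image of the open interval (x, s
    + 1), which is open on the circle. *)
Lemma measurable_csec s : measurable_fun setT (csec s : circle R -> measurableTypeR R).
Proof.
apply: (@measurability _ _ _ _ _ _ (@RGenOInfty.G R)); first exact: RGenOInfty.measurableE.
move=> _ [_ [x ->] <-]; rewrite setTI.
have [xs|sx] := ltP x s.
  rewrite (_ : _ @^-1` _ = setT) //; apply/seteqP; split=> // c _ /=.
  by rewrite in_itv/= andbT; have := csec_itv s c; lra.
rewrite (_ : _ @^-1` _ = (@circle_proj R) @` `]x, (s + 1)[).
  by apply: sub_sigma_algebra; apply: circle_proj_open; exact: itv_open.
apply/seteqP; split=> c /=; rewrite in_itv/= ?andbT.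
  move=> xc; exists (csec s c); last exact: csecK.
  by rewrite /= in_itv/=; have := csec_itv s c; lra.
move=> [y]; rewrite /= in_itv/= => ys <-.
by rewrite csec_proj; lra.
Qed.

(** The difference is taken on real representatives and then projected, so that no comparison of the
    Borel sets of a product with the product sigma-algebra is needed. *)
Lemma measurable_circleB d (T : measurableType d) (f g : T -> circle R) :
  measurable_fun setT f -> measurable_fun setT g ->
  measurable_fun setT (fun t => f t - g t).
Proof.
move=> mf mg.
rewrite (_ : (fun t => _) = (@circle_rv R) \o
    (fun t => (csec 0 (f t) - csec 0 (g t) : measurableTypeR R))).
  apply: measurableT_comp; first exact: measurable_circle_proj.
  by apply: measurable_funB; apply: measurableT_comp => //; exact: measurable_csec.
by apply/funext => t /=; rewrite /circle_rv circle_projB !csecK.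
Qed.

Lemma measurable_circleN d (T : measurableType d) (f : T -> circle R) :
  measurable_fun setT f -> measurable_fun setT (fun t => - f t).
Proof.
move=> mf; rewrite (_ : (fun t => _) = (fun t => 0 - f t)).
  by apply: measurable_circleB => //; exact: measurable_cst.
by apply/funext => t; rewrite sub0r.
Qed.

Lemma measurable_circleD d (T : measurableType d) (f g : T -> circle R) :
  measurable_fun setT f -> measurable_fun setT g ->
  measurable_fun setT (fun t => f t + g t).
Proof.
move=> mf mg; rewrite (_ : (fun t => _) = (fun t => f t - (- g t))).
  by apply: measurable_circleB => //; exact: measurable_circleN.
by apply/funext => t; rewrite opprK.
Qed.

Lemma circle_compact : compact [set: circle R].
Proof.
rewrite (_ : setT = (@circle_proj R) @` `[0, 1]).
  apply: continuous_compact; last exact: segment_compact.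
  by apply: continuous_subspaceT; exact: circle_proj_continuous.
apply/seteqP; split=> // c _; exists (csec 0 c); last exact: csecK.
by rewrite /= in_itv/=; have := csec_itv 0 c; lra.
Qed.

Lemma circle_liftN_continuous (T : topologicalType) (f : circle R -> T) :
  continuous (f \o @circle_proj R) -> continuous f.
Proof.
move=> cf; apply/continuousP => A oA.
suff : open ((@circle_proj R) @^-1` (f @^-1` A)) by [].
by move/continuousP : cf; apply.
Qed.

(** The image of Lebesgue measure under a translation gives half-open intervals their length, hence
    is Lebesgue measure. *)
Lemma lebesgue_integral_shift (f : R -> \bar R) (a : R) (D : set R) :
  measurable D ->
  measurable_fun setT (f : measurableTypeR R -> _) -> (forall x, 0 <= f x)%E ->
  (\int[lebesgue_measure]_(x in D) f x =
   \int[lebesgue_measure]_(x in [set x | D (x + a)%R]) f (x + a)%R)%E.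
Proof.
move=> mD mf f0.
have msh : measurable_fun setT (fun x : measurableTypeR R => (x + a : measurableTypeR R)).
  by apply: measurable_funD => //; exact: measurable_cst.
pose mu : {measure set (measurableTypeR R) -> \bar R} :=
  pushforward (@lebesgue_measure R) (fun x : measurableTypeR R => (x + a : measurableTypeR R)).
rewrite (@eq_measure_integral _ (measurableTypeR R) R D (mu msh)).
  by rewrite ge0_integral_pushforward//; exact: measurable_funTS.
move=> A mA _; apply: lebesgue_measure_unique => // _ [[x y] _ <-].
transitivity (lebesgue_measure (`](x - a), (y - a)] : set (measurableTypeR R))).
  rewrite !lebesgue_measure_itv/= !lte_fin ltrD2r; case: ifPn => // _.
  by rewrite -!EFinB; congr (_%:E); ring.
congr lebesgue_measure.
by apply/seteqP; split=> z/=; rewrite !in_itv/=; lra.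
Qed.

Lemma integral_leb0 (f : circle R -> \bar R) :
  measurable_fun setT f -> (forall c, 0 <= f c)%E ->
  (\int[leb R]_c f c = \int[lebesgue_measure]_(x in `[0%R, 1%R[) f (circle_proj x))%E.
Proof.
move=> mf f0.
rewrite ge0_integral_distribution//.
have mg : measurable_fun setT (f \o @circle_rv R).
  by apply: measurableT_comp => //; exact: measurable_circle_proj.
rewrite integral_uniform//; last by move=> ?; exact: f0.
by rewrite subr0 invr1 mul1e -integral_itv_bndo_bndc//; exact: measurable_funTS.
Qed.

(* Cutting [s, s+1) at the integer n = ceil s and shifting its two pieces by n - 1 and n reassembles [0, 1). *)
Lemma integral_leb s (f : circle R -> \bar R) :
  measurable_fun setT f -> (forall c, 0 <= f c)%E ->
  (\int[leb R]_c f c = \int[lebesgue_measure]_(x in `[s, (s + 1)%R[) f (circle_proj x))%E.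
Proof.
move=> mf f0; rewrite integral_leb0//.
have mg : measurable_fun setT (fun x : measurableTypeR R => f (circle_proj x)).
  by apply: measurableT_comp => //; exact: measurable_circle_proj.
pose n := Num.ceil s.
have /andP[h1 h2] := ceil_itv s; rewrite -/n in h1 h2.
rewrite intrD mulrN1z in h1.
have ni (b c : itv_bound R) (m : int) :
    (\int[lebesgue_measure]_(x in [set` Interval b c]) f (circle_proj x) =
    \int[lebesgue_measure]_(x in [set x | (x + m%:~R)%R \in Interval b c]) f (circle_proj x))%E.
  rewrite (lebesgue_integral_shift m%:~R)//.
  by apply: eq_integral => x _; rewrite circle_proj_int.
pose t := s - n%:~R + 1.
have split_itv (a b c : R) : a <= b -> b <= c ->
    (\int[lebesgue_measure]_(x in `[a, c[) f (circle_proj x) =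
    \int[lebesgue_measure]_(x in `[a, b[) f (circle_proj x) +
    \int[lebesgue_measure]_(x in `[b, c[) f (circle_proj x))%E.
  move=> ab bc; rewrite (@itv_bndbnd_setU _ _ _ (BLeft b)) ?bnd_simp//.
  rewrite ge0_integral_setU//; first exact: measurable_funTS.
  apply/disj_setPS => x [] /=; rewrite !in_itv/=; lra.
rewrite (split_itv 0 t 1) ?(split_itv s n%:~R (s + 1)); [|rewrite /t; lra..].
rewrite addeC; congr (_ + _)%E.
  rewrite [RHS](ni _ _ (n - 1)); congr integral.
  by apply/seteqP; split=> x /=; rewrite !in_itv/= intrB /t; lra.
rewrite [RHS](ni _ _ n); congr integral.
by apply/seteqP; split=> x /=; rewrite !in_itv/= /t; lra.
Qed.

(** With a real representative of a as the cut, translation carries [0, 1) exactly onto the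
    fundamental interval [a, a + 1). *)
Lemma integral_leb_shift (f : circle R -> \bar R) (a : circle R) :
  measurable_fun setT f -> (forall c, 0 <= f c)%E ->
  (\int[leb R]_c f (c + a)%R = \int[leb R]_c f c)%E.
Proof.
move=> mf f0.
have mg : measurable_fun setT (fun x : measurableTypeR R => f (circle_proj x)).
  by apply: measurableT_comp => //; exact: measurable_circle_proj.
rewrite integral_leb0//; last first.
  by apply: measurableT_comp => //; apply: measurable_circleD => //; exact: measurable_cst.
rewrite (integral_leb (csec 0 a))// [RHS](lebesgue_integral_shift (csec 0 a))//.
rewrite (_ : [set x | _] = `[0, 1[%classic).
  by apply: eq_integral => x _; rewrite circle_projD csecK.
by apply/seteqP; split=> x /=; rewrite !in_itv/=; lra.
Qed.

End circle_section.
(** * Configurations *)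

Section config_space.
Context {R : realType}.
Implicit Types (x y : config R) (k : int).

Lemma continuous_coord k : continuous (fun x : config R => x k).
Proof. exact: (@proj_continuous int (fun=> circle R) k). Qed.

Lemma measurable_coord k : measurable_fun setT (fun x : config R => x k).
Proof.
apply: (@measurability _ _ _ _ _ _ (@open (circle R))) => // _ [B oB <-].
rewrite setTI; apply: sub_sigma_algebra.
by move/continuousP: (@continuous_coord k); apply.
Qed.

Lemma config_cvg (F : set_system (config R)) x : Filter F ->
  (forall k, (fun y => y k) @ F --> x k) -> F --> x.
Proof.
move=> FF Fx; apply/(@cvg_sup _ _ _ F x) => k A /=.
rewrite (@nbhsE (initial_topology _)) => -[B [[V oV VB] Bx] BA].
apply: (filterS BA); rewrite -VB; apply: Fx.
by apply: open_nbhs_nbhs; split=> //; rewrite -VB in Bx.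
Qed.

Lemma config_compact : compact [set: config R].
Proof.
have := @tychonoff int (fun=> circle R) (fun=> setT) (fun=> @circle_compact R).
by congr compact; apply/seteqP; split.
Qed.

(** Finitely many coordinates constrained to arcs with rational endpoints: a countable base of the
    product topology. *)
Definition cylinder (s : seq (int * (rat * rat))) : set (config R) :=
  [set x | forall t, t \in s ->
     ((@circle_proj R) @` `](ratr t.2.1), (ratr t.2.2)[) (x t.1)].

Definition coordinate_events : set (set (config R)) :=
  \bigcup_k preimage_set_system setT (fun x : config R => x k) measurable.

(** The cylinders containing x generate a filter that converges to x in each coordinate, hence in
    the product; so this filter contains every open set around x. *)
Lemma open_cylinder_cover (O : set (config R)) : open O ->
  O = \bigcup_(s in [set s | cylinder s `<=` O]) cylinder s.
Proof.
move=> oO; apply/seteqP; split=> [x Ox|x [s /= sO]]; last exact: sO.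
pose F : set_system (config R) :=
  filter_from [set s | cylinder s x] cylinder.
have FF : Filter F.
  apply: filter_from_filter; first by exists [::] => t.
  move=> s1 s2 /= s1x s2x; exists (s1 ++ s2).
    by move=> t; rewrite mem_cat => /orP[]; [exact: s1x|exact: s2x].
  by move=> y h; split=> t ts; apply: h; rewrite mem_cat ts ?orbT.
have Fx : F --> x.
  apply: config_cvg => k V Vx.
  have : nbhs (csec 0 (x k)) ((@circle_proj R) @^-1` V).
    by apply: circle_proj_continuous; rewrite csecK.
  move=> /nbhs_ballP[e /= e0 eV].
  have [p] : exists p : rat, csec 0 (x k) - e < ratr p < csec 0 (x k).
    by have [p] := @rat_in_itvoo R (csec 0 (x k) - e) (csec 0 (x k)) ltac:(lra);
    rewrite in_itv/= => ?; exists p.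
  have [q] : exists q : rat, csec 0 (x k) < ratr q < csec 0 (x k) + e.
    by have [q] := @rat_in_itvoo R (csec 0 (x k)) (csec 0 (x k) + e) ltac:(lra);
    rewrite in_itv/= => ?; exists q.
  move=> qx px; exists [:: (k, (p, q))].
    move=> t; rewrite inE => /eqP -> /=; exists (csec 0 (x k)); last exact: csecK.
    by rewrite /= in_itv/=; lra.
  move=> y /(_ _ (mem_head _ _)) /= [r]; rewrite in_itv/= => rpq <-.
  apply: eV; rewrite /ball/= ltr_norml; lra.
have [s /= sx sO] : F O by apply: Fx; apply: open_nbhs_nbhs.
by exists s.
Qed.

(** There are countably many rational cylinders, so an open set is a countable union of finite
    intersections of coordinate events. *)
Lemma measurable_configE : @measurable _ (config R) = <<s coordinate_events>>.
Proof.
apply/seteqP; split; last first.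
  apply: smallest_sub; first exact: sigma_algebra_measurable.
  by move=> _ [k _ [A mA <-]]; exact: measurable_coord.
apply: smallest_sub; first exact: smallest_sigma_algebra.
move=> O /open_cylinder_cover ->.
rewrite bigcup_mkcond.
pose GT : measurableType _ := g_sigma_algebraType coordinate_events.
apply: (@countable_bigcupT_measurable _ GT); first exact: countableP.
move=> s; case: ifPn => _; last exact: measurable0.
rewrite (_ : cylinder s = \big[setI/setT]_(t <- s)
    [set x | ((@circle_proj R) @` `](ratr t.2.1), (ratr t.2.2)[) (x t.1)]).
  apply: bigsetI_measurable => t _; apply: sub_sigma_algebra.
  exists t.1 => //; exists ((@circle_proj R) @` `](ratr t.2.1), (ratr t.2.2)[).
    by apply: sub_sigma_algebra; apply: circle_proj_open; exact: itv_open.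
  by rewrite setTI.
rewrite -bigcap_seq; apply/seteqP; split=> x /= h t; exact: h.
Qed.

Lemma measurable_config d (T : measurableType d) (f : T -> config R) :
  (forall k, measurable_fun setT (fun t => f t k)) -> measurable_fun setT f.
Proof.
move=> mf; apply: (measurability _ measurable_configE) => _ [_ [k _ [A mA <-]] <-].
by rewrite !setTI; have := mf k measurableT A mA; rewrite setTI.
Qed.

Definition boxes : set (set (config R)) :=
  [set E | exists (L : {fset int}) (A : int -> set (circle R)),
     (forall k, measurable (A k)) /\ E = [set x | forall k, k \in L -> A k (x k)]].

Lemma measurable_box (L : {fset int}) (A : int -> set (circle R)) :
  (forall k, measurable (A k)) ->
  measurable [set x : config R | forall k, k \in L -> A k (x k)].
Proof.
move=> mA; rewrite (_ : [set x | _] = \big[setI/setT]_(k <- L) [set x : config R | A k (x k)]).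
  apply: bigsetI_measurable => k _; rewrite -[X in measurable X]setTI.
  exact: (measurable_coord k).
by rewrite -bigcap_seq; apply/seteqP; split=> x /= h t; exact: h.
Qed.

Lemma measurable_config_boxes : @measurable _ (config R) = <<s boxes>>.
Proof.
apply/seteqP; split.
  rewrite measurable_configE; apply: smallest_sub; first exact: smallest_sigma_algebra.
  move=> _ [k _ [A mA <-]]; apply: sub_sigma_algebra; exists [fset k]%fset, (fun=> A).
  split=> //; rewrite setTI; apply/seteqP; split=> x /= h; last by apply: h; rewrite inE.
  by move=> j; rewrite inE => /eqP ->.
apply: smallest_sub; first exact: sigma_algebra_measurable.
by move=> _ [L [A [mA ->]]]; exact: measurable_box.
Qed.

Lemma setI_closed_boxes : setI_closed boxes.
Proof.
move=> _ _ [L1 [A1 [m1 ->]]] [L2 [A2 [m2 ->]]].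
exists (L1 `|` L2)%fset, (fun k => (if k \in L1 then A1 k else setT) `&`
                                   (if k \in L2 then A2 k else setT)).
split.
  by move=> k; apply: measurableI; case: ifPn.
apply/seteqP; split=> x /=.
  by move=> [h1 h2] k _; split; case: ifPn => // kL; [exact: h1|exact: h2].
move=> h; split=> k kL; have := h k; rewrite in_fsetU kL/= ?orbT => /(_ isT) [] //.
Qed.

(** Boxes are stable under intersection, generate the Borel sets and contain the whole space, so
    Dynkin's theorem applies. *)
Lemma config_measure_unique (m1 m2 : {measure set (config R) -> \bar R}) :
  (m1 setT < +oo)%E ->
  (forall E, boxes E -> m1 E = m2 E) ->
  forall E, measurable E -> m1 E = m2 E.
Proof.
move=> m1T m12; apply: (measure_unique boxes (fun=> setT)) => //.
- exact: measurable_config_boxes.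
- exact: setI_closed_boxes.
- move=> _; exists fset0, (fun=> setT); split=> //.
  by apply/seteqP; split.
- by apply/seteqP; split=> // x _; exists 0%N.
Qed.

End config_space.
(** * Increments *)

Section reconstruction.
Context {R : realType}.
Implicit Types (x d : config R) (k : int).

(** Inverse of the map sending x to its spin at 0 and its increments. [Negz n] is the site -(n + 1),
    reached from 0 by adding the increments at -1, ..., -(n + 1). *)
Definition recon (p : circle R * config R) : config R := fun k =>
  match k with
  | Posz n => p.1 - \sum_(j < n) p.2 (Posz j)
  | Negz n => p.1 + \sum_(j < n.+1) p.2 (Negz j)
  end.

Lemma difference_map_recon t d : difference_map (recon (t, d)) = d.
Proof.
apply/funext => -[n|[|n]]; rewrite /difference_map.
- rewrite (_ : Posz n + 1 = Posz n.+1)/=; last by rewrite -PoszD addn1.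
  by rewrite big_ord_recr/= opprB [X in X - t]addrC addrA addrACA addNr addr0 addrAC subrr add0r.
- by rewrite /= big_ord_recr !big_ord0/= add0r subr0 addrC addKr.
- rewrite (_ : Negz n.+1 + 1 = Negz n)/=; last by rewrite !NegzE -addn1 PoszD; lia.
  by rewrite [X in _ + X - _]big_ord_recr/= opprD addrACA subrr add0r addrC addKr.
Qed.

Lemma reconK x : recon (x 0, difference_map x) = x.
Proof.
apply/funext => -[n|n] /=; rewrite /difference_map.
  elim: n => [|n IH]; first by rewrite big_ord0 subr0.
  rewrite big_ord_recr/= opprD addrA IH -PoszD addn1 opprB addrC addrNK.
  by [].
elim: n => [|n IH]; first by rewrite big_ord_recr big_ord0/= add0r addrC subrK.
rewrite big_ord_recr/= addrA IH addrC (_ : Negz n.+1 + 1 = Negz n) ?subrK//.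
by rewrite !NegzE -addn1 PoszD; lia.
Qed.

Lemma recon_shift t s d : recon (t + s, d) = Defs.shift s (recon (t, d)).
Proof. by apply/funext => -[n|n]; rewrite /Defs.shift/= -!addrA [s + _]addrC. Qed.

Lemma measurable_difference_map : measurable_fun setT (@difference_map R).
Proof.
by apply: measurable_config => k; apply: measurable_circleB; exact: measurable_coord.
Qed.

HB.instance Definition _ := @isMeasurableFun.Build _ _ _ _
  (@difference_map R) measurable_difference_map.

Lemma measurable_recon : measurable_fun setT recon.
Proof.
have ms (I : Type) (s : seq I) (g : I -> int) :
    measurable_fun setT (fun p : circle R * config R => \sum_(j <- s) p.2 (g j)).
  elim: s => [|j s IH].
    by under eq_fun do rewrite big_nil; exact: measurable_cst.
  under eq_fun do rewrite big_cons.
  apply: measurable_circleD => //.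
  exact: (measurableT_comp (@measurable_coord R (g j)) measurable_snd).
apply: measurable_config => -[n|n] /=.
  by apply: measurable_circleB; [exact: measurable_fst|exact: ms].
by apply: measurable_circleD; [exact: measurable_fst|exact: ms].
Qed.

HB.instance Definition _ := @isMeasurableFun.Build _ _ _ _ recon measurable_recon.

Lemma measurable_shift (t : circle R) : measurable_fun setT (@Defs.shift R t).
Proof.
apply: measurable_config => k; apply: measurable_circleD => //.
exact: measurable_coord.
Qed.

Lemma shift_difference (t : circle R) x : difference_map (Defs.shift t x) = difference_map x.
Proof. by apply/funext => k; rewrite /difference_map /Defs.shift opprD addrACA subrr addr0. Qed.

Definition difference_law (rho : probability (config R) R) : probability (config R) R :=
  distribution rho (@difference_map R).

Lemma leb_shift (a : circle R) (B : set (circle R)) : measurable B ->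
  leb R [set t | B (a + t)] = leb R B.
Proof.
move=> mB.
have mB' : measurable [set t | B (a + t)].
  rewrite -[X in measurable X]setTI.
  by apply: (@measurable_circleD R _ _ (cst a) id) => //; exact: measurable_cst.
have mf : measurable_fun setT (fun c : circle R => (\1_B c : R)%:E).
  by apply/measurable_EFinP; exact: measurable_indic.
have := integral_leb_shift a mf (fun c => ltac:(by rewrite lee_fin)).
have E : [set t | B (a + t)] = (fun t : circle R => B (t + a)).
  by apply/seteqP; split=> t /=; rewrite addrC.
by rewrite E in mB' *; rewrite !integral_indic// !setIT.
Qed.

(* Averaging the symmetry over t in Leb turns the event x_0 + t in B into a translate of B. *)
Lemma symmetric_independence (rho : probability (config R) R) :
  symmetric_measure rho ->
  forall B D, measurable B -> measurable D ->
  rho [set x | B (x 0) /\ D (difference_map x)] =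
  (leb R B * difference_law rho D)%E.
Proof.
move=> sym B D mB mD.
pose S : set (circle R * config R) := [set p | B (p.2 0 + p.1) /\ D (difference_map p.2)].
have mS : measurable S.
  have h1 : measurable_fun setT (fun p : circle R * config R => p.2 0 + p.1).
    apply: (@measurable_circleD R _ _ (fun p : circle R * config R => p.2 0) fst).
      exact: (measurableT_comp (@measurable_coord R 0) measurable_snd).
    exact: measurable_fst.
  have h2 : measurable_fun setT (fun p : circle R * config R => difference_map p.2).
    exact: (measurableT_comp measurable_difference_map measurable_snd).
  by have := measurableI _ _ (h1 measurableT _ mB) (h2 measurableT _ mD); rewrite !setTI.
have mE : measurable [set x : config R | B (x 0) /\ D (difference_map x)].
  by have := measurableI _ _ (@measurable_coord R 0 measurableT _ mB)
    (@measurable_difference_map measurableT _ mD); rewrite !setTI.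
have := @indic_fubini_tonelli _ _ _ _ R (leb R) rho S mS.
rewrite indic_fubini_tonelli_FE// indic_fubini_tonelli_GE//.
rewrite (eq_integral (cst (rho [set x | B (x 0) /\ D (difference_map x)]))); last first.
  move=> t _ /=; rewrite -(sym t _ mE) /pushforward; congr (rho _).
  apply/seteqP; split=> x; rewrite /xsection/= inE /S/= shift_difference//.
rewrite integral_cst//.
rewrite [X in (_ * X)%E](probability_setT (leb R)) mule1.
move=> ->.
have mDD : measurable ((@difference_map R) @^-1` D).
  by rewrite -[X in measurable X]setTI; exact: measurable_difference_map.
rewrite (eq_integral (fun x => leb R B * (\1_((@difference_map R) @^-1` D) x)%:E)%E); last first.
  move=> x _ /=; rewrite indicE; case: (boolP (_ \in _)); rewrite ?inE ?notin_setE => Dx.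
    rewrite mule1; apply: etrans (leb_shift (x 0) mB); congr (leb R _).
    apply/seteqP; split=> t; rewrite /ysection/= inE /S/=; first by case.
    by [].
  rewrite mule0 (_ : ysection S x = set0) ?measure0//.
  by apply/seteqP; split=> t //; rewrite /ysection/= inE /S/= => -[].
rewrite ge0_integralZl//.
- by rewrite integral_indic// setIT.
- by apply/measurable_EFinP; exact: measurable_indic.
Qed.

(** A uniform spin at 0 together with independent increments of law P. The symmetric probability
    measures are exactly those of this form. *)
Definition recon_law (P : probability (config R) R) : probability (config R) R :=
  distribution (leb R \x P)%E recon.

(** The hypothesis gives the joint law of the spin at 0 and the increments on rectangles, hence it
    is a product measure; [recon] maps it back to rho. *)
Lemma independence_recon (rho : probability (config R) R) :
  (forall B D, measurable B -> measurable D ->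
    rho [set x | B (x 0) /\ D (difference_map x)] =
    (leb R B * difference_law rho D)%E) ->
  forall E, measurable E -> rho E = recon_law (difference_law rho) E.
Proof.
move=> ind E mE; rewrite /recon_law /distribution /pushforward.
have mX : measurable_fun setT (fun x : config R => (x 0, difference_map x)).
  apply: measurable_fun_pair; [exact: measurable_coord|exact: measurable_difference_map].
pose m' : {measure set (circle R * config R) -> \bar R} :=
  pushforward rho (fun x : config R => (x 0, difference_map x)).
apply/esym/(etrans (@product_measure_unique _ _ _ _ _ (leb R) (difference_law rho) (m' mX) _ _ _)).
- by move=> A B mA mB; rewrite -ind.
- by rewrite -[X in measurable X]setTI; exact: measurable_recon.
- rewrite /m'/pushforward; congr (rho _); apply/seteqP; split=> x /=; by rewrite reconK.
Qed.

Lemma symmetric_recon (rho : probability (config R) R) : symmetric_measure rho ->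
  forall E, measurable E -> rho E = recon_law (difference_law rho) E.
Proof. by move=> sym; apply: independence_recon; exact: symmetric_independence. Qed.

Lemma recon_law_difference (P : probability (config R) R) E : measurable E ->
  pushforward (recon_law P) (@difference_map R) E = P E.
Proof.
move=> mE; rewrite /recon_law /distribution /pushforward/=.
rewrite (_ : _ @^-1` _ = setT `*` E); last first.
  by apply/seteqP; split=> -[t d] /=; rewrite difference_map_recon//; case.
rewrite product_measure1E//.
by rewrite [X in (X * _)%E](probability_setT (leb R)) mul1e.
Qed.

(** A global shift moves the spin at 0 and fixes the increments, and Leb is translation
    invariant. *)
Lemma recon_law_symmetric (P : probability (config R) R) : symmetric_measure (recon_law P).
Proof.
move=> s E mE.
have mrE : measurable (recon @^-1` E).
  by rewrite -[X in measurable X]setTI; exact: measurable_recon.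
have mp : measurable_fun setT (fun p : circle R * config R => (s + p.1, p.2)).
  apply: measurable_fun_pair; last exact: measurable_snd.
  by apply: measurable_circleD; [exact: measurable_cst|exact: measurable_fst].
pose m' : {measure set (circle R * config R) -> \bar R} :=
  pushforward (leb R \x P)%E (fun p : circle R * config R => (s + p.1, p.2)).
rewrite /recon_law /distribution [RHS](@product_measure_unique _ _ _ _ _ _ _ (m' mp))//.
  rewrite /m' /pushforward; congr (product_measure1 _ _ _).
  by apply/seteqP; split=> -[t d]; rewrite /= addrC recon_shift.
move=> A B mA mB; have -> : m' mp (A `*` B) = (leb R \x P)%E ([set t | A (s + t)] `*` B) by [].
rewrite product_measure1E//; last first.
  rewrite -[X in measurable X]setTI.
  by apply: (@measurable_circleD R _ _ (cst s) id) => //; exact: measurable_cst.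
by congr (_ * _)%E; exact: leb_shift.
Qed.

Lemma product_measure_ext (P Q : {measure set (config R) -> \bar R}) m m' :
  is_product_measure P m -> is_product_measure Q m' ->
  (forall A, measurable A -> m A = m' A) ->
  forall E, measurable E -> P E = Q E.
Proof.
move=> Pm Qm mm'; apply: config_measure_unique.
  have := Pm fset0 (fun=> setT) (fun=> measurableT).
  rewrite big_seq_fset0 (_ : [set x | _] = setT) => [->|]; first by rewrite ltry.
  by apply/seteqP; split.
move=> _ [L [A [mA ->]]]; rewrite Pm// Qm//.
by apply: eq_bigr => k _; exact: mm'.
Qed.

Lemma symmetric_with_increments_unique (rho : probability (config R) R)
    (nu : {measure set (config R) -> \bar R}) m :
  symmetric_with_increments rho m -> symmetric_with_increments nu m ->
  forall E, measurable E -> nu E = rho E.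
Proof.
move=> [rs ri] [ns ni].
have nuT : nu setT = 1%E.
  have := ni fset0 (fun=> setT) (fun=> measurableT).
  rewrite big_seq_fset0 (_ : [set x | _] = setT)//.
  by apply/seteqP; split.
(* The empty box shows that [nu] has mass 1, so normalizing does not change it; it only presents
   [nu] as a probability, to which [symmetric_recon] applies. *)
pose nu' : probability (config R) R := mnormalize nu rho.
have nuE E : nu' E = nu E.
  by rewrite /nu'/= /mnormalize nuT/= onee_eq0/= invr1 mule1.
have nu's : symmetric_measure nu'.
  by move=> t A mA; rewrite /pushforward !nuE; exact: ns.
have nu'i : is_product_measure (pushforward nu' (@difference_map R)) m.
  by move=> L A mA; rewrite /pushforward nuE; exact: ni.
move=> E mE; rewrite (symmetric_recon rs mE) -nuE (symmetric_recon nu's mE).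
have mrE : measurable (recon @^-1` E).
  by rewrite -[X in measurable X]setTI; exact: measurable_recon.
rewrite /recon_law /distribution /pushforward.
apply: (@product_measure_unique _ _ _ _ _ (leb R) (difference_law nu')
  (leb R \x difference_law rho)%E) => // A B mA mB.
apply: etrans (@product_measure1E _ _ _ _ _ (leb R) (difference_law rho) A B mA mB) _.
congr (_ * _)%E.
exact: (@product_measure_ext (difference_law rho) (difference_law nu') _ _ ri nu'i).
Qed.

Lemma recon_law_increments (P : probability (config R) R) m :
  is_product_measure P m -> symmetric_with_increments (recon_law P) m.
Proof.
move=> Pm; split; first exact: recon_law_symmetric.
by move=> L A mA; rewrite recon_law_difference ?Pm//; exact: measurable_box.
Qed.

Lemma difference01E : @difference01 R = (fun d => d 0) \o @difference_map R.
Proof. by apply/funext => x; rewrite /difference01 /difference_map/= add0r. Qed.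

Lemma measurable_difference01 : measurable_fun setT (@difference01 R).
Proof.
by rewrite difference01E; exact: (measurableT_comp (@measurable_coord R 0) measurable_difference_map).
Qed.

Lemma increments_difference01 (rho : set (config R) -> \bar R) m A :
  symmetric_with_increments rho m -> measurable A ->
  pushforward rho (@difference01 R) A = m A.
Proof.
move=> [_ ri] mA; have := ri [fset 0]%fset (fun=> A) (fun=> mA).
rewrite big_seq_fset1 => <-; rewrite /pushforward; congr (rho _).
rewrite difference01E; apply/seteqP; split=> x /=; last by apply; rewrite inE.
by move=> h k; rewrite inE => /eqP ->.
Qed.

End reconstruction.

(** * Change of variables for the image of a measure with a density *)

Section weighted_pushforward.
Local Open Scope ereal_scope.
Context d d' (S : measurableType d) (T : measurableType d') (R : realType).
Variables (mu : {measure set S -> \bar R}) (h : S -> T) (phi : S -> R).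
Hypotheses (mh : measurable_fun setT h) (mphi : measurable_fun setT phi).
Hypothesis phi0 : forall s, (0 <= phi s)%R.

(** The image under h of phi times mu. The proofs are arguments of the definition so that a measure
    structure can be attached to the term itself. *)
Definition weighted_pushforward (mh : measurable_fun setT h)
    (mphi : measurable_fun setT phi) (phi0 : forall s, (0 <= phi s)%R) (E : set T) : \bar R :=
  \int[mu]_(s in h @^-1` E) (phi s)%:E.

Local Notation wp := (weighted_pushforward mh mphi phi0).

Let mephi : measurable_fun setT (fun s => (phi s)%:E).
Proof. exact/measurable_EFinP. Qed.

Let mpre E : measurable E -> measurable (h @^-1` E).
Proof. by move=> mE; rewrite -[X in measurable X]setTI; exact: mh. Qed.

Let wp0 : wp set0 = 0.
Proof. by rewrite /weighted_pushforward preimage_set0 integral_set0. Qed.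

Let wp_ge0 E : 0 <= wp E.
Proof. by apply: integral_ge0 => s _; exact: phi0. Qed.

Let wp_sigma_additive : semi_sigma_additive wp.
Proof.
move=> F mF tF mUF; rewrite /weighted_pushforward preimage_bigcup.
rewrite ge0_integral_bigcup//; last 4 first.
- by move=> k; exact: mpre.
- exact: measurable_funTS.
- by move=> s _; rewrite lee_fin.
- apply/trivIsetP => i j _ _ ij; rewrite -preimage_setI.
  by move/trivIsetP : tF => ->//; rewrite preimage_set0.
by apply: is_cvg_nneseries => n _ _; apply: integral_ge0 => s _; rewrite lee_fin.
Qed.

HB.instance Definition _ := isMeasure.Build _ _ _ wp wp0 wp_ge0 wp_sigma_additive.

Import HBNNSimple.

Let mwc (f : {nnsfun T >-> R}) r :
  measurable_fun setT (fun s => (r * \1_(f @^-1` [set r]) (h s))%:E).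
Proof.
apply/measurable_EFinP; apply: measurable_funM; first exact: measurable_cst.
by apply: measurableT_comp => //; exact: measurable_indic.
Qed.

Let integral_wp_nnsfun (f : {nnsfun T >-> R}) :
  \int[wp]_y (f y)%:E = \int[mu]_s ((f (h s))%:E * (phi s)%:E).
Proof.
under [LHS]eq_integral do rewrite fimfunE -fsumEFin//.
rewrite [LHS]ge0_integral_fsum//; last 2 first.
- by move=> r; exact/measurable_EFinP/measurableT_comp.
- by move=> n x _; rewrite EFinM nnfun_muleindic_ge0.
under [RHS]eq_integral.
  move=> s _; rewrite fimfunE -fsumEFin// ge0_mule_fsuml; last first.
    by move=> r; rewrite EFinM nnfun_muleindic_ge0.
  over.
rewrite [RHS]ge0_integral_fsum//; last 2 first.
- by move=> r; apply: emeasurable_funM => //; exact: mwc.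
- by move=> n s _; apply: mule_ge0; [rewrite EFinM; exact: nnfun_muleindic_ge0|rewrite lee_fin].
apply: eq_fsbigr => r _.
rewrite integralZl_indic_nnsfun//= integral_indic// setIT.
(* A negative r is not a value of f, and then both sides vanish; otherwise r can be pulled out of
   the integral. *)
have [r0|r0] := ltP r 0%R.
  have -> : f @^-1` [set r] = set0.
    apply/seteqP; split => // y /= fy.
    by have : (0 <= f y)%R by []; rewrite fy leNgt r0.
  rewrite measure0 mule0; apply/esym/integral0_eq => s _.
  by rewrite indic0 mulr0 mul0e.
rewrite [RHS](eq_integral (fun s => r%:E * ((\1_(f @^-1` [set r]) (h s))%:E * (phi s)%:E))); last first.
  by move=> s _; rewrite EFinM muleA.
rewrite ge0_integralZl//; last 2 first.
- apply: emeasurable_funM => //.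
  by apply/measurable_EFinP; apply: measurableT_comp => //; exact: measurable_indic.
- by move=> s _; rewrite mule_ge0// lee_fin.
congr (_ * _); rewrite /weighted_pushforward [LHS]integral_mkcond/=.
apply: eq_integral => s _; rewrite patchE indicE/=.
have -> : (h s \in f @^-1` [set r]) = (s \in h @^-1` (f @^-1` [set r])).
  by apply/idP/idP; rewrite !inE.
by case: ifP => _; rewrite ?mul1e ?mul0e.
Qed.

Lemma integral_weighted_pushforward (f : T -> \bar R) :
  measurable_fun setT f -> (forall y, 0 <= f y) ->
  \int[wp]_y f y = \int[mu]_s (f (h s) * (phi s)%:E).
Proof.
move=> mf f0; pose f_ := nnsfun_approx measurableT mf.
have ndf y m n : (m <= n)%N -> (f_ m y)%:E <= (f_ n y)%:E.
  by move=> mn; rewrite lee_fin; exact/lefP/nd_nnsfun_approx.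
transitivity (limn (fun n => \int[wp]_y (f_ n y)%:E)).
  rewrite -monotone_convergence//=.
  - apply: eq_integral => y _; apply/esym/cvg_lim => //=.
    exact: cvg_nnsfun_approx.
  - by move=> n; exact/measurable_EFinP/measurable_funTS.
  - by move=> n ? _; rewrite lee_fin.
  - by move=> y _ m n; exact: ndf.
transitivity (limn (fun n => \int[mu]_s ((f_ n (h s))%:E * (phi s)%:E))).
  by apply: congr_lim; apply/funext => n; exact: integral_wp_nnsfun.
rewrite -monotone_convergence//=.
- apply: eq_integral => s _; apply/cvg_lim => //=.
  by apply: cvgeZr => //; exact: cvg_nnsfun_approx.
- move=> n; apply: emeasurable_funM => //.
  by apply/measurable_EFinP; apply: measurableT_comp.
- by move=> n s _; rewrite mule_ge0// lee_fin.
- by move=> s _ m n mn; apply: lee_wpmul2r; [rewrite lee_fin|exact: ndf].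
Qed.

End weighted_pushforward.

(** * Single-site DLR equations *)

Section single_site.
Context {R : realType}.
Implicit Types (x : config R) (k : int) (b : circle R -> R).

Definition upd x k (t : circle R) : config R := fun j => if j == k then t else x j.

Lemma nn_interaction_pair b k x :
  nn_interaction b [fset k; (k + 1)%R]%fset x = - b (x k - x (k + 1)).
Proof.
rewrite /nn_interaction; case: pickP => [[j jk] /= /eqP/fsetP E|].
  have jE : j = k.
    have := E k; have := E (k + 1); have := E j; have := E (j + 1).
    rewrite !inE; lia.
  by rewrite jE.
have kk : k \in [fset k; (k + 1)%R]%fset by rewrite !inE eqxx.
by move=> /(_ [` kk]%fset) /=; rewrite eqxx.
Qed.

Lemma nn_interaction_other b (X : {fset int}) x :
  (forall k, X != [fset k; (k + 1)%R]%fset) -> nn_interaction b X x = 0.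
Proof.
move=> Xk; rewrite /nn_interaction; case: pickP => // -[j jX] /= /eqP E.
by have := Xk j; rewrite -E eqxx.
Qed.

(** Among the sets meeting {k} only the edges {k - 1, k} and {k, k + 1} carry an interaction. *)
Lemma hamiltonian_site b k x :
  hamiltonian (nn_interaction b) [fset k]%fset x =
  - (b (x (k - 1) - x k) + b (x k - x (k + 1))).
Proof.
rewrite /hamiltonian.
pose X1 := [fset (k - 1)%R; k]%fset; pose X2 := [fset k; (k + 1)%R]%fset.
have X12 : X1 != X2.
  by apply/eqP => /fsetP/(_ (k - 1)); rewrite !inE eqxx; lia.
rewrite -(@fsbig_widen _ _ _ _ [set X1; X2]); last 2 first.
- move=> X /= [->|->]; apply/fset0Pn; exists k; rewrite !inE; lia.
- move=> X /= [Xk nX]; apply: nn_interaction_other => j; apply/eqP => XE; apply: nX.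
  move: Xk => /fset0Pn[i]; rewrite XE !inE => /andP[/orP[]/eqP-> /eqP jk].
    by right; rewrite jk.
  left; rewrite /X1 (_ : k - 1 = j); last lia.
  by congr [fset _; _]%fset; lia.
rewrite fsbigU0 ?fsbig_set1//=; last first.
  by move=> X /= [-> /eqP]; rewrite (negbTE X12).
have -> : X1 = [fset (k - 1)%R; ((k - 1) + 1)%R]%fset by rewrite subrK.
by rewrite !nn_interaction_pair subrK opprD.
Qed.

(** The length is a variable with an equation because the size of [[fset k]] is 1 only up to a
    propositional equality. *)
Lemma integral_tuple_prob1 (P : probability (circle R) R) n (f : circle R -> \bar R)
    (c0 : circle R) : n = 1%N ->
  measurable_fun setT f -> (forall c, 0 <= f c)%E ->
  (\int[tuple_prob P n]_t f (nth c0 t 0) = \int[P]_c f c)%E.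
Proof.
move=> -> mf f0.
have mn0 : measurable_fun setT (fun t : 1.-tuple (circle R) => nth c0 t 0).
  rewrite (_ : (fun t => _) = (fun t => tnth t ord0)); first exact: measurable_tnth.
  by apply/funext => t; rewrite (tnth_nth c0).
rewrite ge0_integral_distribution//; last exact: measurableT_comp.
have mg : measurable_fun setT (fun p : circle R * 0.-tuple (circle R) => f p.1).
  exact: (measurableT_comp mf measurable_fst).
have := @fubini_tonelli1 _ _ _ _ R P (tuple_prob P 0) _ mg (fun p => f0 p.1).
rewrite /fubini_F /= => E; apply: etrans E _.
apply: eq_integral => c _; rewrite integral_cst//.
by rewrite [X in (_ * X)%E](probability_setT (tuple_prob P 0)) mule1.
Qed.

Lemma measurable_upd k : measurable_fun setT (fun p : config R * circle R => upd p.1 k p.2).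
Proof.
apply: measurable_config => j; rewrite /upd.
case: eqP => _; first exact: measurable_snd.
exact: (measurableT_comp (@measurable_coord R j) measurable_fst).
Qed.

Definition site_weight b k x : R := expR (b (x (k - 1) - x k) + b (x k - x (k + 1))).

Definition site_partition b k x : \bar R := (\int[leb R]_t (site_weight b k (upd x k t))%:E)%E.

Definition site_density b k x t : R :=
  (fine (site_partition b k x))^-1 * site_weight b k (upd x k t).

Lemma glue_site k x (t : (size [fset k]%fset).-tuple (circle R)) c0 :
  Defs.glue t x = upd x k (nth c0 t 0).
Proof.
apply/funext => j; rewrite /Defs.glue /upd inE; case: eqP => // ->.
rewrite (_ : index k [fset k]%fset = 0%N).
  by apply: set_nth_default; rewrite size_tuple cardfs1.
by apply/eqP; rewrite -leqn0 -ltnS -[X in (_ < X)%N](cardfs1 k) index_mem inE.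
Qed.

Lemma measurable_site_weight b k : measurable_fun setT b ->
  measurable_fun setT (site_weight b k).
Proof.
move=> mb; apply: measurableT_comp; first exact: measurable_expR.
by apply: measurable_funD; apply: measurableT_comp => //;
  apply: measurable_circleB; exact: measurable_coord.
Qed.

Section dlr.
Variables (b : circle R -> R) (M : R) (rho : probability (config R) R).
Hypotheses (mb : measurable_fun setT b) (bM : forall c, `|b c| <= M).
Hypothesis gibbs : is_gibbs_measure (nn_interaction b) rho.

Lemma site_weight_bounds k x :
  expR (- (M + M)) <= site_weight b k x <= expR (M + M).
Proof.
rewrite /site_weight !ler_expR.
have := bM (x (k - 1) - x k); have := bM (x k - x (k + 1)).
by rewrite !ler_norml; lra.
Qed.

Lemma measurable_site_weight_upd k :
  measurable_fun setT (fun p : config R * circle R => site_weight b k (upd p.1 k p.2)).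
Proof. exact: measurableT_comp (measurable_site_weight k mb) (measurable_upd k). Qed.

Lemma measurable_site_partition k : measurable_fun setT (site_partition b k).
Proof.
apply: (@measurable_fun_fubini_tonelli_F _ _ _ _ R (leb R)
  (fun p => (site_weight b k (upd p.1 k p.2))%:E)).
  by apply/measurable_EFinP; exact: measurable_site_weight_upd.
by move=> p; rewrite lee_fin; exact: expR_ge0.
Qed.

Lemma site_partition_bounds k x :
  ((expR (- (M + M)))%:E <= site_partition b k x <= (expR (M + M))%:E)%E.
Proof.
have mw : measurable_fun setT (fun t => (site_weight b k (upd x k t))%:E).
  apply/measurable_EFinP.
  exact: (measurableT_comp (measurable_site_weight_upd k) (pair1_measurable x)).
have le1 (r : R) : (\int[leb R]_t (cst r%:E) t = r%:E)%E.
  by rewrite integral_cst// [X in (_ * X)%E](probability_setT (leb R)) mule1.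
apply/andP; split.
  rewrite -[leLHS]le1; apply: ge0_le_integral => //.
  - by move=> t _; rewrite lee_fin; exact: expR_ge0.
  - by move=> t _; rewrite lee_fin; have /andP[] := site_weight_bounds k (upd x k t).
rewrite -[leRHS]le1; apply: ge0_le_integral => //.
- by move=> t _; rewrite lee_fin; exact: expR_ge0.
- by move=> t _; rewrite lee_fin; have /andP[] := site_weight_bounds k (upd x k t).
Qed.

Lemma site_partition_fine k x :
  site_partition b k x = (fine (site_partition b k x))%:E /\
  0 < fine (site_partition b k x).
Proof.
have /andP[h1 h2] := site_partition_bounds k x.
have fp : site_partition b k x \is a fin_num.
  by rewrite fin_real// (lt_le_trans _ h1) ?ltNyr// (le_lt_trans h2) ?ltry.
rewrite fineK//; split=> //; rewrite -lte_fin fineK//.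
by apply: lt_le_trans h1; rewrite lte_fin expR_gt0.
Qed.

Lemma site_density_ge0 k x t : 0 <= site_density b k x t.
Proof.
apply: mulr_ge0; last exact: expR_ge0.
rewrite invr_ge0 ltW//.
by case: (site_partition_fine k x).
Qed.

Lemma measurable_site_density k :
  measurable_fun setT (fun p : config R * circle R => site_density b k p.1 p.2).
Proof.
apply: measurable_funM; last exact: measurable_site_weight_upd.
(* The partition function is positive, so its inverse is the power -1, a measurable function of
   it. *)
rewrite (_ : (fun p => _) = (fun p => (fine (site_partition b k p.1)) `^ (-1))); last first.
  by apply/funext => p; rewrite powR_inv1// ltW//; case: (site_partition_fine k p.1).
apply: (measurableT_comp (measurable_powR (-1))).
apply: measurableT_comp => //.
exact: (measurableT_comp (measurable_site_partition k) measurable_fst).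
Qed.

Lemma gibbs_density_site k x (t : (size [fset k]%fset).-tuple (circle R)) c0 :
  gibbs_density (nn_interaction b) x t = site_density b k x (nth c0 t 0).
Proof.
rewrite /gibbs_density /site_density hamiltonian_site opprK (glue_site _ _ c0).
congr ((fine _)^-1 * _); rewrite /partition_function /site_partition.
rewrite -(@integral_tuple_prob1 _ _ _ c0 (cardfs1 k)); last 2 first.
- apply/measurable_EFinP.
  exact: (measurableT_comp (measurable_site_weight_upd k) (pair1_measurable x)).
- by move=> c; rewrite lee_fin; exact: expR_ge0.
by apply: eq_integral => u _; rewrite hamiltonian_site opprK (glue_site _ _ c0).
Qed.

Lemma gibbs_site k (A : set (circle R)) (B : set (config R)) :
  measurable A -> outside_events [fset k]%fset B ->
  rho [set x | A (x k) /\ B x] =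
  (\int[rho]_(x in B) \int[leb R]_(t in A) (site_density b k x t)%:E)%E.
Proof.
move=> mA oB; have c0 := (point : circle R).
pose A' := [set t : (size [fset k]%fset).-tuple (circle R) | A (nth c0 t 0)].
have mn0 n : n = 1%N -> measurable_fun setT (fun t : n.-tuple (circle R) => nth c0 t 0).
  move=> ->; rewrite (_ : (fun t => _) = (fun t => tnth t ord0)); first exact: measurable_tnth.
  by apply/funext => t; rewrite (tnth_nth c0).
have mA' : measurable A'.
  by rewrite -[X in measurable X]setTI; exact: (mn0 _ (cardfs1 k)).
have := gibbs mA' oB.
rewrite (_ : _ `&` B = [set x | A (x k) /\ B x]); last first.
  have rk x : nth c0 (Defs.restrict [fset k]%fset x) 0 = x k.
    have k0 : index k [fset k]%fset = 0%N.
      by apply/eqP; rewrite -leqn0 -ltnS -[X in (_ < X)%N](cardfs1 k) index_mem inE.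
    rewrite /= (nth_map 0) ?cardfs1// -[X in nth _ _ X]k0 nth_index// inE//.
  by apply/seteqP; split=> x /= -[]; rewrite /A'/= rk.
move=> ->; apply: eq_integral => x _.
have mD : measurable_fun setT (fun t => (site_density b k x t)%:E).
  apply/measurable_EFinP.
  exact: (measurableT_comp (measurable_site_density k) (pair1_measurable x)).
rewrite integral_mkcond [RHS]integral_mkcond.
rewrite -(@integral_tuple_prob1 _ _ _ c0 (cardfs1 k)); last 2 first.
- by apply/(measurable_restrictT _ mA); exact: measurable_funTS.
- by move=> t; apply: erestrict_ge0 => u _; rewrite lee_fin site_density_ge0.
apply: eq_integral => t _; rewrite !patchE -(gibbs_density_site _ _ c0).
by congr (if _ then _ else _); apply/idP/idP; rewrite !inE.
Qed.

End dlr.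
End single_site.

(** * Invariance under resampling one spin *)

Section resampling.
Context {R : realType}.
Implicit Types (x : config R) (k : int) (b : circle R -> R).

Lemma upd_upd x k s t : upd (upd x k s) k t = upd x k t.
Proof. by apply/funext => j; rewrite /upd; case: eqP. Qed.

Lemma upd_same x k t : upd x k t k = t.
Proof. by rewrite /upd eqxx. Qed.

Lemma upd_other x k t j : j != k -> upd x k t j = x j.
Proof. by rewrite /upd => /negbTE ->. Qed.

(** The single-site DLR equation against nonnegative test functions. This is the form in which the
    Gibbs property is used from here on; it sees b only through the conditional density. *)
Definition site_dlr (rho : probability (config R) R) b k :=
  forall F : config R -> \bar R, measurable_fun setT F -> (forall x, 0 <= F x)%E ->
  (\int[rho]_x F x =
   \int[rho]_x \int[leb R]_t (F (upd x k t) * (site_density b k x t)%:E))%E.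

Lemma outside_box k (L : {fset int}) (A : int -> set (circle R)) :
  (forall j, measurable (A j)) ->
  outside_events [fset k]%fset [set x | forall j, j \in L -> j != k -> A j (x j)].
Proof.
move=> mA; rewrite (_ : [set x | _] =
    \big[setI/setT]_(j <- L | j != k) [set x : config R | A j (x j)]).
  rewrite /outside_events; set G := \bigcup_(_ in _) _.
  apply: (@bigsetI_measurable _ (g_sigma_algebraType G)) => j jk.
  apply: sub_sigma_algebra; exists j; first by rewrite /= inE.
  by exists (A j) => //; rewrite setTI.
rewrite -bigcap_seq_cond; apply/seteqP; split=> x /= h j.
  by move=> /andP[jL jk]; exact: h.
by move=> jL jk; apply: h; rewrite /= jL.
Qed.

(** The right-hand side is the integral of F for the image of the weighted product of rho and Leb
    under the update map. That image agrees with rho on boxes, which is the DLR equation for sets,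
    hence everywhere. *)
Lemma gibbs_site_dlr b (M : R) (rho : probability (config R) R) k :
  measurable_fun setT b -> (forall c, `|b c| <= M) ->
  is_gibbs_measure (nn_interaction b) rho -> site_dlr rho b k.
Proof.
move=> mb bM gibbs F mF F0.
have mphi := measurable_site_density mb bM k.
have phi0 (p : config R * circle R) : 0 <= site_density b k p.1 p.2.
  exact: (site_density_ge0 mb bM).
pose wp : {measure set (config R) -> \bar R} :=
  weighted_pushforward (rho \x leb R)%E (measurable_upd k) mphi phi0.
rewrite (@eq_measure_integral _ _ _ setT wp).
  rewrite integral_weighted_pushforward// fubini_tonelli1//.
    apply: emeasurable_funM; last exact/measurable_EFinP.
    exact: (measurableT_comp mF (measurable_upd k)).
  by move=> p; rewrite mule_ge0// lee_fin.
move=> E mE _; apply: config_measure_unique => //.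
  by apply: (le_lt_trans (probability_le1 rho measurableT)); rewrite ltry.
move=> _ [L [A [mA ->]]].
(* [A'] isolates the constraint on the spin at k, trivial when k is outside L; the other constraints
   form an event outside {k}. *)
pose A' := if k \in L then A k else setT.
have mA' : measurable A' by rewrite /A'; case: ifP.
have A'1 : k \in L -> A' = A k by rewrite /A' => ->.
have A'0 : k \notin L -> A' = setT by rewrite /A' => /negbTE ->.
clearbody A'.
have := gibbs_site mb bM gibbs mA' (@outside_box k L A mA).
pose B := [set x : config R | forall j, j \in L -> j != k -> A j (x j)].
pose E' := [set x | A' (x k) /\ B x].
rewrite -/B -/E'.
have EE' : [set x : config R | forall j, j \in L -> A j (x j)] = E'.
  apply/seteqP; split=> x.
    move=> /= h; split; last by move=> j jL _; exact: h.
    by case: (boolP (k \in L)) => kL; [rewrite A'1//; exact: h|rewrite A'0].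
  move=> [/= Ak h] j jL; have [jk|jk] := eqVneq j k; last exact: h.
  by rewrite jk in jL *; rewrite -A'1.
move=> H; rewrite EE'; apply: (etrans H); rewrite /wp /= /weighted_pushforward.
rewrite [RHS]integral_mkcond fubini_tonelli1; last 2 first.
- apply/(measurable_restrictT _ _).1; last exact/measurable_funTS/measurable_EFinP.
  rewrite -[X in measurable X]setTI; apply: measurable_upd => //.
  by rewrite -EE'; exact: measurable_box.
- by move=> p; apply: erestrict_ge0 => q _; rewrite lee_fin.
rewrite [LHS]integral_mkcond; apply: eq_integral => x _.
rewrite patchE /fubini_F; case: ifPn => xB.
  rewrite [LHS]integral_mkcond; apply: eq_integral => t _.
  rewrite !patchE/=; congr (if _ then _ else _).
  move: xB; rewrite inE => xB.
  apply/idP/idP; rewrite !inE /E' /= upd_same.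
    by move=> At; split=> // j jL jk; rewrite upd_other//; exact: xB.
  by case.
rewrite (eq_integral (cst 0%E)) ?integral0// => t _.
rewrite patchE ifF//; apply/negbTE; move: xB; apply: contra; rewrite !inE => -[_ h] j jL jk.
by have := h j jL jk; rewrite upd_other.
Qed.

Lemma site_weight_sub b a k x :
  site_weight (fun c => b c - a) k x = expR (- (a + a)) * site_weight b k x.
Proof. by rewrite /site_weight -expRD; congr expR; ring. Qed.

(** The constant multiplies the weight and the partition function by the same factor. *)
Lemma site_density_sub b a (M : R) k x t :
  measurable_fun setT b -> (forall c, `|b c| <= M) ->
  site_density (fun c => b c - a) k x t = site_density b k x t.
Proof.
move=> mb bM; rewrite /site_density site_weight_sub.
have [ZE Z0] := site_partition_fine mb bM k x.
have -> : site_partition (fun c => b c - a) k x =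
    ((expR (- (a + a)))%:E * site_partition b k x)%E.
  rewrite /site_partition -ge0_integralZl//.
  - by apply: eq_integral => u _; rewrite site_weight_sub EFinM.
  - apply/measurable_EFinP.
    exact: (measurableT_comp (measurable_site_weight_upd mb k) (pair1_measurable x)).
  - by move=> u _; rewrite lee_fin; exact: expR_ge0.
rewrite ZE -EFinM /= invfM mulrACA mulVf ?mul1r//.
by apply: lt0r_neq0; exact: expR_gt0.
Qed.

Definition resample k (F : config R -> \bar R) x : \bar R := (\int[leb R]_t F (upd x k t))%E.

Section invariance.
Variables (rho : probability (config R) R) (b : circle R -> R) (M : R).
Hypotheses (mb : measurable_fun setT b) (bM : forall c, `|b c| <= M).
Hypothesis dlr : forall k, site_dlr rho b k.

Lemma measurable_resample k (F : config R -> \bar R) : measurable_fun setT F ->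
  (forall x, 0 <= F x)%E -> measurable_fun setT (resample k F).
Proof.
move=> mF F0; apply: (@measurable_fun_fubini_tonelli_F _ _ _ _ R (leb R)
  (fun p => F (upd p.1 k p.2))) => //.
exact: (measurableT_comp mF (measurable_upd k)).
Qed.

(* rho weighted by 1/G is invariant under resampling the site k with Leb, because G carries all the dependence of the conditional density on the spin at k. *)
Lemma resample_invariance k (G : config R -> R) (F : config R -> \bar R) :
  measurable_fun setT (fun x => (G x)^-1) -> (forall x, 0 < G x) ->
  (forall x t, G (upd x k t) * site_weight b k x = G x * site_weight b k (upd x k t)) ->
  measurable_fun setT F -> (forall x, 0 <= F x)%E ->
  (\int[rho]_x (F x * ((G x)^-1)%:E) = \int[rho]_x (resample k F x * ((G x)^-1)%:E))%E.
Proof.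
move=> mG G0 GE mF F0.
(* The right-hand side involves H only through its resampling, and resampling is idempotent; using
   this for F and for [resample k F] gives the claim. *)
have main (H : config R -> \bar R) : measurable_fun setT H -> (forall x, 0 <= H x)%E ->
    (\int[rho]_x (H x * ((G x)^-1)%:E) =
     \int[rho]_x ((site_weight b k x / (G x * fine (site_partition b k x)))%:E * resample k H x))%E.
  move=> mH H0; rewrite (dlr k); last 2 first.
  - by apply: emeasurable_funM => //; exact/measurable_EFinP.
  - by move=> x; rewrite mule_ge0// lee_fin invr_ge0 ltW.
  apply: eq_integral => x _; rewrite -ge0_integralZl//; last 2 first.
  - have mh : measurable_fun setT (fun p : config R * circle R => H (upd p.1 k p.2)).
      exact: (measurableT_comp mH (measurable_upd k)).
    exact: (measurableT_comp mh (pair1_measurable x)).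
  - have [_ Z0] := site_partition_fine mb bM k x.
    by rewrite lee_fin divr_ge0 ?expR_ge0// mulr_ge0// ltW.
  apply: eq_integral => t _; rewrite muleAC -muleA [RHS]muleC -EFinM; congr (_ * _%:E)%E.
  have [_ Z0] := site_partition_fine mb bM k x.
  rewrite /site_density.
  have w0 : 0 < site_weight b k (upd x k t) by exact: expR_gt0.
  have -> : site_weight b k x = G x * site_weight b k (upd x k t) / G (upd x k t).
    by rewrite -GE mulrAC mulfV ?mul1r//; apply: lt0r_neq0.
  have := G0 x; have := G0 (upd x k t).
  move: (G x) (G (upd x k t)) (site_weight b k (upd x k t)) (fine _) Z0 w0.
  clear; move=> g g' w z z0 w0 g'0 g0.
  have -> : g * w / g' / (g * z) = (g / g) * (g'^-1 * (z^-1 * w)) by rewrite invfM; ring.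
  by rewrite mulfV ?mul1r; [rewrite [RHS]mulrC|exact: lt0r_neq0].
rewrite main//.
rewrite main//; last 2 first.
- exact: measurable_resample.
- by move=> x; exact: integral_ge0.
apply: eq_integral => x _; congr (_ * _)%E.
rewrite [RHS]/resample [RHS](eq_integral (cst (resample k F x))); last first.
  by move=> t _; apply: eq_integral => s _; rewrite upd_upd.
by rewrite integral_cst// [X in (_ * X)%E](probability_setT (leb R)) mule1.
Qed.

End invariance.
End resampling.

(** * Integrating out a chain of spins *)

Section chain.
Context {R : realType}.
Implicit Types (x : config R) (k : int).

Notation kernel := (circle R -> circle R -> R).

Definition mkernel (g : kernel) : Prop :=
  measurable_fun setT (fun p : circle R * circle R => g p.1 p.2) /\ forall s t, 0 <= g s t.

(** The kernel acts on densities: f lives at one site and its image at the next site to the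
    right. *)
Definition ker_op (g : kernel) (f : circle R -> \bar R) (z : circle R) : \bar R :=
  (\int[leb R]_t (f t * (g t z)%:E))%E.

Fixpoint path_weight k (gs : seq kernel) x : R :=
  if gs is g :: gs' then g (x k) (x (k + 1)) * path_weight (k + 1) gs' x else 1.

Definition mkernels (gs : seq kernel) : Prop := forall i, (i < size gs)%N -> mkernel (nth (fun _ _ => 1) gs i).

Lemma mkernels_cons g gs : mkernels (g :: gs) <-> mkernel g /\ mkernels gs.
Proof.
split=> [h|[h1 h2] [|i]]; [split; [exact: (h 0%N)|]|by []|exact: h2].
by move=> i; exact: (h i.+1).
Qed.

Lemma path_weight_ge0 k gs x : mkernels gs -> 0 <= path_weight k gs x.
Proof.
elim: gs k => [|g gs IH] k //= /mkernels_cons[[_ g0] mgs].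
by rewrite mulr_ge0// IH.
Qed.

Lemma measurable_path_weight k gs : mkernels gs -> measurable_fun setT (path_weight k gs).
Proof.
elim: gs k => [|g gs IH] k //= /mkernels_cons[[mg g0] mgs].
apply: measurable_funM; last exact: IH.
have mp : measurable_fun setT (fun x : config R => (x k, x (k + 1))).
  by apply: measurable_fun_pair; exact: measurable_coord.
exact: (measurableT_comp mg mp).
Qed.

Lemma path_weight_cat k gs gs' x :
  path_weight k (gs ++ gs') x = path_weight k gs x * path_weight (k + (size gs)%:Z) gs' x.
Proof.
elim: gs k => [|g gs IH] k /=; first by rewrite mul1r addr0.
by rewrite IH mulrA; congr (_ * path_weight _ _ _); lia.
Qed.

Lemma path_weight_upd k gs x j t : (j < k) || (k + (size gs)%:Z < j) ->
  path_weight k gs (upd x j t) = path_weight k gs x.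
Proof.
elim: gs k => [//|g gs IH] k /= jk.
rewrite IH ?upd_other//; last by apply/orP; move: jk => /=; lia.
- by apply/eqP; move: jk; lia.
- by apply/eqP; move: jk; lia.
Qed.

Lemma measurable_ker_op (f : circle R -> circle R -> \bar R) g : mkernel g ->
  measurable_fun setT (fun p : circle R * circle R => f p.1 p.2) ->
  (forall s t, 0 <= f s t)%E ->
  measurable_fun setT (fun p : circle R * circle R => ker_op g (f p.1) p.2) /\
  (forall s t, 0 <= ker_op g (f s) t)%E.
Proof.
move=> [mg g0] mf f0; split; last first.
  by move=> s t; apply: integral_ge0 => u _; rewrite mule_ge0// lee_fin.
apply: (@measurable_fun_fubini_tonelli_F _ _ _ _ R (leb R)
  (fun p : (circle R * circle R) * circle R => f p.1.1 p.2 * (g p.2 p.1.2)%:E)%E).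
  apply: emeasurable_funM.
    have m1 : measurable_fun setT (fun p : (circle R * circle R) * circle R => (p.1.1, p.2)).
      apply: measurable_fun_pair; last exact: measurable_snd.
      exact: (measurableT_comp measurable_fst measurable_fst).
    exact: (measurableT_comp mf m1).
  apply/measurable_EFinP.
  have m1 : measurable_fun setT (fun p : (circle R * circle R) * circle R => (p.2, p.1.2)).
    apply: measurable_fun_pair; first exact: measurable_snd.
    exact: (measurableT_comp measurable_snd measurable_fst).
  exact: (measurableT_comp mg m1).
by move=> p; rewrite mule_ge0// lee_fin.
Qed.

Definition ker_iter (gs : seq kernel) (f : circle R -> \bar R) := foldl (fun f g => ker_op g f) f gs.

Lemma ker_iter_cat gs gs' f : ker_iter (gs ++ gs') f = ker_iter gs' (ker_iter gs f).
Proof. exact: foldl_cat. Qed.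

Variables (rho : probability (config R) R) (b : circle R -> R) (M : R).
Hypotheses (mb : measurable_fun setT b) (bM : forall c, `|b c| <= M).
Hypothesis dlr : forall k, site_dlr rho b k.

Definition step_kernel : kernel := fun s t => expR (b (s - t)).

Lemma mkernel_step : mkernel step_kernel.
Proof.
split; last by move=> s t; exact: expR_ge0.
apply: measurableT_comp; first exact: measurable_expR.
apply: measurableT_comp => //.
by apply: measurable_circleB; [exact: measurable_fst|exact: measurable_snd].
Qed.

Lemma mkernels_nseq n g : mkernel g -> mkernels (nseq n g).
Proof. by move=> mg i; rewrite size_nseq nth_nseq => ->. Qed.

(** The Boltzmann factor of the n edges that start at A. It plays the role of G in
    [resample_invariance] for all interior sites at once. *)
Definition bulk_weight A n x := path_weight A (nseq n step_kernel) x.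

Lemma bulk_weight_gt0 A n x : 0 < bulk_weight A n x.
Proof.
rewrite /bulk_weight; elim: n A => [|n IH] A //=; rewrite mulr_gt0//.
exact: expR_gt0.
Qed.

Lemma measurable_bulk_weightV A n : measurable_fun setT (fun x => (bulk_weight A n x)^-1).
Proof.
rewrite (_ : (fun x => _) = (fun x => (bulk_weight A n x) `^ (-1))); last first.
  by apply/funext => x; rewrite powR_inv1// ltW// bulk_weight_gt0.
apply: (measurableT_comp (measurable_powR (-1))).
by apply: measurable_path_weight; apply: mkernels_nseq; exact: mkernel_step.
Qed.

(** The n edges split into i to the left of k - 1, the two edges at k, and j to the right of k + 1.
    Only the two in the middle see the spin at k, and their product is [site_weight]. *)
Lemma bulk_weight_upd A n k x t : A < k -> k < A + n%:Z ->
  bulk_weight A n (upd x k t) * site_weight b k x =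
  bulk_weight A n x * site_weight b k (upd x k t).
Proof.
move=> Ak kn; pose i := absz (k - A - 1)%R; pose j := absz (A + n%:Z - k - 1)%R.
have -> : n = (i + (2 + j))%N by rewrite /i /j; lia.
rewrite /bulk_weight !nseqD !path_weight_cat !size_nseq.
have -> : A + i%:Z = k - 1 by rewrite /i; lia.
rewrite (path_weight_upd (k := A)); last by rewrite size_nseq /i; lia.
rewrite (path_weight_upd (k := k - 1 + 2%:Z)); last by rewrite size_nseq; lia.
by rewrite /= subrK !mulr1 /step_kernel /site_weight !expRD; ring.
Qed.

(** Induction along the path: resampling the spin at k turns K and the first kernel into one
    application of [ker_op]. The bounds on k keep every integrated site strictly inside the block;
    the spins at A and at the end of the path are left untouched. *)
Lemma chain A n (K : circle R -> circle R -> \bar R) k (gs : seq kernel) :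
  measurable_fun setT (fun p : circle R * circle R => K p.1 p.2) ->
  (forall s t, 0 <= K s t)%E -> mkernels gs ->
  A < k -> k + (size gs)%:Z <= A + n%:Z ->
  (\int[rho]_x (K (x A) (x k) * (path_weight k gs x)%:E * ((bulk_weight A n x)^-1)%:E) =
   \int[rho]_x (ker_iter gs (K (x A)) (x (k + (size gs)%:Z)%R) * ((bulk_weight A n x)^-1)%:E))%E.
Proof.
elim: gs K k => [|g gs IH] K k mK K0 mgs Ak kn.
  by apply: eq_integral => x _; rewrite mule1 /= addr0.
move: mgs => /mkernels_cons[mg mgs].
have [mK' K'0] := measurable_ker_op mg mK K0.
have -> : k + (size (g :: gs))%:Z = k + 1 + (size gs)%:Z by rewrite /=; lia.
rewrite -(IH (fun s => ker_op g (K s)))//; last 2 first.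
- by lia.
- by move: kn => /=; lia.
rewrite (resample_invariance mb bM dlr (k := k)); last 5 first.
- exact: measurable_bulk_weightV.
- exact: bulk_weight_gt0.
- by move=> x t; apply: bulk_weight_upd => //; move: kn => /=; lia.
- apply: emeasurable_funM; last first.
    by apply/measurable_EFinP; apply: measurable_path_weight; apply/mkernels_cons.
  have mp : measurable_fun setT (fun x : config R => (x A, x k)).
    by apply: measurable_fun_pair; exact: measurable_coord.
  exact: (measurableT_comp mK mp).
- move=> x; rewrite mule_ge0// lee_fin; apply: path_weight_ge0.
  by apply/mkernels_cons.
apply: eq_integral => x _; congr (_ * _)%E; rewrite /resample /ker_op.
rewrite -ge0_integralZr//; last 3 first.
- have mp : measurable_fun setT (fun t : circle R => (x A, t)) by exact: pair1_measurable.
  apply: emeasurable_funM; first exact: (measurableT_comp mK mp).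
  have mq : measurable_fun setT (fun t : circle R => (t, x (k + 1))) by exact: pair2_measurable.
  by apply/measurable_EFinP; exact: (measurableT_comp mg.1 mq).
- by move=> t _; rewrite mule_ge0// lee_fin; case: mg.
- by rewrite lee_fin; exact: path_weight_ge0.
apply: eq_integral => t _ /=.
rewrite path_weight_upd; last by apply/orP; left; lia.
rewrite upd_same !upd_other; last 2 first.
- by apply/eqP; lia.
- by apply/eqP; lia.
by rewrite EFinM muleA.
Qed.

End chain.

(** * Convolution kernels on the circle and Doeblin contraction *)

Section circle_convolution.
Context {R : realType}.
Local Open Scope ereal_scope.
Implicit Types (u f : circle R -> \bar R).

Lemma integral_leb_sub u z : measurable_fun setT u -> (forall c, 0 <= u c) ->
  \int[leb R]_t u (t - z)%R = \int[leb R]_t u t.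
Proof. by move=> mu u0; exact: (@integral_leb_shift _ _ (- z)%R). Qed.

(* Reflection invariance of Leb comes from translation invariance alone, by integrating u (t - z) in both orders. *)
Lemma integral_leb_rev u t : measurable_fun setT u -> (forall c, 0 <= u c) ->
  \int[leb R]_z u (t - z)%R = \int[leb R]_z u z.
Proof.
move=> mu u0.
have muB : measurable_fun setT (fun p : circle R * circle R => u (p.1 - p.2)%R).
  apply: measurableT_comp => //.
  by apply: measurable_circleB; [exact: measurable_fst|exact: measurable_snd].
have mub (s : circle R) : measurable_fun setT (fun z : circle R => u (s - z)%R).
  exact: (measurableT_comp muB (pair1_measurable s)).
have c (s : circle R) : \int[leb R]_z u (s - z)%R = \int[leb R]_z u (- z)%R.
  rewrite -(@integral_leb_shift _ _ s)//; apply: eq_integral => z _.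
  by rewrite opprD addrCA subrr addr0.
have := @fubini_tonelli _ _ _ _ R (leb R) (leb R) _ muB (fun p => u0 _).
rewrite (eq_integral (cst (\int[leb R]_z u (- z)%R))); last by move=> s _; exact: c.
rewrite integral_cst// [X in _ * X](probability_setT (leb R)) mule1 c => ->.
rewrite (eq_integral (cst (\int[leb R]_z u z))); last first.
  by move=> s _; exact: integral_leb_sub.
by rewrite integral_cst// [X in _ * X](probability_setT (leb R)) mule1.
Qed.

Lemma integral_leb_cst (c : \bar R) : \int[leb R]_t cst c t = c.
Proof. by rewrite integral_cst// [X in _ * X](probability_setT (leb R)) mule1. Qed.

Notation kernel := (circle R -> circle R -> R).

Definition mnneg f := measurable_fun setT f /\ forall c, 0 <= f c.

Lemma mnneg_ker_op (g : kernel) f : mkernel g -> mnneg f -> mnneg (ker_op g f).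
Proof.
move=> mg [mf f0].
have mK : measurable_fun setT (fun p : circle R * circle R => f p.2).
  exact: (measurableT_comp mf measurable_snd).
have [m1 m2] := @measurable_ker_op R (fun _ t => f t) g mg mK (fun _ t => f0 t).
split; last by move=> c; exact: (m2 0%R).
have m1' : measurable_fun setT (fun p : circle R * circle R => ker_op g f p.2) by exact: m1.
exact: (measurableT_comp m1' (pair1_measurable (0%R : circle R))).
Qed.

Lemma mnneg_ker_iter gs f : mkernels gs -> mnneg f -> mnneg (ker_iter gs f).
Proof.
elim: gs f => [|g gs IH] f //= /mkernels_cons[mg mgs] mf.
by apply: IH => //; exact: mnneg_ker_op.
Qed.

Lemma measurable_ker_op_integrand (g : kernel) f z : mkernel g -> mnneg f ->
  measurable_fun setT (fun t => f t * (g t z)%:E).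
Proof.
move=> [mg g0] [mf f0]; apply: emeasurable_funM => //.
by apply/measurable_EFinP; exact: (measurableT_comp mg (pair2_measurable z)).
Qed.

Lemma le_ker_op (g : kernel) f f' : mkernel g -> mnneg f -> mnneg f' ->
  (forall c, f c <= f' c) -> forall z, ker_op g f z <= ker_op g f' z.
Proof.
move=> mg mf mf' ff' z; apply: ge0_le_integral => //.
- by move=> t _; rewrite mule_ge0//; [case: mf|rewrite lee_fin; case: mg].
- exact: measurable_ker_op_integrand.
- exact: measurable_ker_op_integrand.
- by move=> t _; rewrite lee_wpmul2r// lee_fin; case: mg.
Qed.

Lemma le_ker_iter gs f f' : mkernels gs -> mnneg f -> mnneg f' ->
  (forall c, f c <= f' c) -> forall z, ker_iter gs f z <= ker_iter gs f' z.
Proof.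
elim: gs f f' => [|g gs IH] f f' //= /mkernels_cons[mg mgs] mf mf' ff' z.
apply: IH => //; [exact: mnneg_ker_op|exact: mnneg_ker_op|exact: le_ker_op].
Qed.

Lemma ker_opZ (g : kernel) f (c : R) : (0 <= c)%R -> mkernel g -> mnneg f ->
  ker_op g (fun t => c%:E * f t) = (fun t => c%:E * ker_op g f t).
Proof.
move=> c0 mg mf; apply/funext => z; rewrite /ker_op -ge0_integralZl//.
- by apply: eq_integral => t _; rewrite muleA.
- exact: measurable_ker_op_integrand.
- by move=> t _; rewrite mule_ge0//; [case: mf|rewrite lee_fin; case: mg].
Qed.

Lemma mnnegZ f (c : R) : (0 <= c)%R -> mnneg f -> mnneg (fun t => c%:E * f t).
Proof.
move=> c0 [mf f0]; split; first by apply: emeasurable_funM => //; exact: measurable_cst.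
by move=> t; rewrite mule_ge0.
Qed.

Lemma ker_iterZ gs f (c : R) : (0 <= c)%R -> mkernels gs -> mnneg f ->
  ker_iter gs (fun t => c%:E * f t) = (fun t => c%:E * ker_iter gs f t).
Proof.
move=> c0; elim: gs f => [|g gs IH] f //= /mkernels_cons[mg mgs] mf.
by rewrite ker_opZ// IH//; exact: mnneg_ker_op.
Qed.

Lemma mnneg_cst (c : R) : (0 <= c)%R -> mnneg (cst c%:E).
Proof. by move=> c0; split=> // t; rewrite lee_fin. Qed.

Lemma ker_op_le (g : kernel) f (C W : R) : mkernel g -> mnneg f ->
  (forall s t, (g s t <= W)%R) -> (0 <= C)%R -> (forall c, f c <= C%:E) ->
  forall z, ker_op g f z <= (C * W)%:E.
Proof.
move=> mg mf gW C0 fC z; rewrite -[leRHS]integral_leb_cst; apply: ge0_le_integral => //.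
- by move=> t _; rewrite mule_ge0//; [case: mf|rewrite lee_fin; case: mg].
- exact: measurable_ker_op_integrand.
- by move=> t _; rewrite EFinM; apply: lee_pmul => //;
    rewrite ?lee_fin//; [case: mf|case: mg].
Qed.

Lemma ker_iter_bounded gs f (C W : R) : mkernels gs -> mnneg f ->
  (forall i s t, (i < size gs)%N -> (nth (fun _ _ => 1%R) gs i s t <= W)%R) ->
  (0 <= C)%R -> (0 <= W)%R -> (forall c, f c <= C%:E) ->
  exists C' : R, forall z, ker_iter gs f z <= C'%:E.
Proof.
elim: gs f C => [|g gs IH] f C /=; first by move=> _ _ _ _ _ fC; exists C.
move=> /mkernels_cons[mg mgs] mf gW C0 W0 fC.
apply: (IH _ (C * W)%R) => //.
- exact: mnneg_ker_op.
- by move=> i s t; exact: (gW i.+1).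
- by rewrite mulr_ge0.
- by apply: ker_op_le => // s t; exact: (gW 0%N).
Qed.

Section translation_kernel.
Variables (u : circle R -> R) (h : circle R -> R).
Hypotheses (mu : measurable_fun setT u) (u0 : forall c, (0 <= u c)%R).
Hypotheses (mh : measurable_fun setT h) (h0 : forall c, (0 <= h c)%R).

(** The shape h s * u (s - t) covers both the bare transition kernel, with h = 1, and the kernels
    that record an event on the spin s and on the increment s - t. *)
Lemma mkernel_translation : mkernel (fun s t => h s * u (s - t))%R.
Proof.
split; last by move=> s t; rewrite mulr_ge0.
apply: measurable_funM; first exact: (measurableT_comp mh measurable_fst).
apply: measurableT_comp => //.
by apply: measurable_circleB; [exact: measurable_fst|exact: measurable_snd].
Qed.

Lemma ker_op_cst (c : R) : (0 <= c)%R -> (forall s, h s = 1%R) ->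
  ker_op (fun s t => h s * u (s - t))%R (cst c%:E) =
  (fun=> c%:E * \int[leb R]_t (u t)%:E).
Proof.
move=> c0 h1; apply/funext => z; rewrite /ker_op.
rewrite -(@integral_leb_sub (fun t => (u t)%:E) z); last 2 first.
- exact/measurable_EFinP.
- by move=> t; rewrite lee_fin.
rewrite -ge0_integralZl//.
- by apply: eq_integral => t _; rewrite h1 mul1r.
- apply/measurable_EFinP; apply: measurableT_comp => //.
  by apply: measurable_circleB => //; exact: measurable_cst.
- by move=> t _; rewrite lee_fin.
Qed.

(** By Tonelli the inner integral is that of u (t - z) in z, which does not depend on t by
    reflection and translation invariance. *)
Lemma integral_ker_op f : mnneg f ->
  \int[leb R]_z ker_op (fun s t => h s * u (s - t))%R f z =
  (\int[leb R]_t (f t * (h t)%:E)) * \int[leb R]_t (u t)%:E.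
Proof.
move=> [mf f0].
have mg := mkernel_translation.
have mF : measurable_fun setT (fun p : circle R * circle R =>
    f p.1 * (h p.1 * u (p.1 - p.2))%:E).
  apply: emeasurable_funM; first exact: (measurableT_comp mf measurable_fst).
  by apply/measurable_EFinP; exact: mg.1.
rewrite /ker_op -(@fubini_tonelli _ _ _ _ R (leb R) (leb R) _ mF); last first.
  by move=> p; rewrite mule_ge0// lee_fin; exact: mg.2.
have meu : measurable_fun setT (fun t => (u t)%:E) by exact/measurable_EFinP.
have eu0 t : 0 <= (u t)%:E by rewrite lee_fin.
rewrite -ge0_integralZr//; last 3 first.
- by apply: emeasurable_funM => //; exact/measurable_EFinP.
- by move=> t _; rewrite mule_ge0// lee_fin.
- exact: integral_ge0.
apply: eq_integral => t _ /=.
rewrite -(@integral_leb_rev (fun t => (u t)%:E) t)// -ge0_integralZl//.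
- by apply: eq_integral => z _; rewrite EFinM muleA.
- apply: (measurableT_comp meu); apply: measurable_circleB => //; exact: measurable_cst.
- by rewrite mule_ge0// lee_fin.
Qed.

End translation_kernel.

Section doeblin.
Variables (w : circle R -> R) (e : R).
Hypotheses (mw : measurable_fun setT w) (e0 : (0 < e)%R) (we : forall c, (e <= w c)%R).
Hypothesis w1 : \int[leb R]_t (w t)%:E = 1.
Let g : kernel := fun s t => w (s - t)%R.

Let w0 c : (0 <= w c)%R. Proof. by rewrite (le_trans (ltW e0)). Qed.

Let mg : mkernel g.
Proof.
have := @mkernel_translation w (cst 1%R) mw w0 (measurable_cst _) (fun=> ler01).
by rewrite (_ : (fun s t => _) = g)//; apply/funext => s; apply/funext => t; rewrite mul1r.
Qed.

Lemma integral_excess : \int[leb R]_t (w t - e)%:E = (1 - e)%:E.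
Proof.
have : \int[leb R]_t (w t)%:E = \int[leb R]_t (cst e%:E t + (w t - e)%:E).
  by apply: eq_integral => t _; rewrite /= -EFinD addrC subrK.
rewrite ge0_integralD//; last 3 first.
- by move=> t _; rewrite lee_fin ltW.
- by move=> t _; rewrite lee_fin subr_ge0.
- by apply/measurable_EFinP; apply: measurable_funB => //; exact: measurable_cst.
rewrite integral_leb_cst w1 EFinB => ->.
by rewrite addeAC subee ?add0e.
Qed.

Let mexc (z : circle R) : measurable_fun setT (fun t : circle R => (w (t - z)%R - e)%:E).
Proof.
apply/measurable_EFinP; apply: measurable_funB; last exact: measurable_cst.
by apply: measurableT_comp => //; apply: measurable_circleB => //; exact: measurable_cst.
Qed.

Lemma integral_excess_sub z : \int[leb R]_t (w (t - z)%R - e)%:E = (1 - e)%:E.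
Proof.
rewrite -integral_excess -(@integral_leb_sub (fun t => (w t - e)%:E) z)//.
- by apply/measurable_EFinP; apply: measurable_funB => //; exact: measurable_cst.
- by move=> t; rewrite lee_fin subr_ge0.
Qed.

(** Doeblin's splitting w = e + (w - e): the constant part remembers only the mass of f, so any
    dependence on the shape of f passes through the excess. *)
Lemma ker_op_split f z : mnneg f ->
  ker_op g f z = (\int[leb R]_t f t) * e%:E + \int[leb R]_t (f t * (w (t - z)%R - e)%:E).
Proof.
move=> [mf f0]; rewrite -ge0_integralZr//; last by rewrite lee_fin ltW.
rewrite -ge0_integralD//.
- by apply: eq_integral => t _; rewrite -ge0_muleDr ?lee_fin ?subr_ge0 ?(ltW e0)// -EFinD [in RHS]addrC subrK.
- by move=> t _; rewrite mule_ge0// lee_fin ltW.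
- by apply: emeasurable_funM => //; exact: measurable_cst.
- by move=> t _; rewrite mule_ge0// lee_fin subr_ge0.
- exact: emeasurable_funM.
Qed.

(** The constant part contributes m e and the excess, of mass 1 - e, at least lo (1 - e) and at most
    hi (1 - e). Hence the distances of the bounds from the mean m shrink by the factor 1 - e. *)
Lemma doeblin_step f (m lo hi : R) : mnneg f ->
  \int[leb R]_t f t = m%:E -> (0 <= lo)%R -> (0 <= hi)%R ->
  (forall c, lo%:E <= f c) -> (forall c, f c <= hi%:E) ->
  [/\ \int[leb R]_t ker_op g f t = m%:E,
      forall c, (m - (1 - e) * (m - lo))%:E <= ker_op g f c &
      forall c, ker_op g f c <= (m + (1 - e) * (hi - m))%:E].
Proof.
move=> mf fm lo0 hi0 flo fhi; split.
- have -> : g = (fun s t => cst 1%R s * w (s - t))%R.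
    by apply/funext => s; apply/funext => t; rewrite mul1r.
  rewrite integral_ker_op//.
  by rewrite w1 mule1 -fm; apply: eq_integral => t _; rewrite mule1.
- move=> z; rewrite ker_op_split//.
  have -> : (m - (1 - e) * (m - lo) = m * e + lo * (1 - e))%R by ring.
  rewrite fm -EFinM EFinD leeD2l// [leLHS]EFinM -(integral_excess_sub z) -ge0_integralZl//.
  + apply: ge0_le_integral => //.
    * by move=> t _; rewrite mule_ge0// lee_fin// subr_ge0.
    * by apply: emeasurable_funM => //; exact: measurable_cst.
    * by apply: emeasurable_funM => //; case: mf.
    * by move=> t _; rewrite lee_wpmul2r// lee_fin subr_ge0.
  + by move=> t _; rewrite lee_fin subr_ge0.
- move=> z; rewrite ker_op_split//.
  have -> : (m + (1 - e) * (hi - m) = m * e + hi * (1 - e))%R by ring.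
  rewrite fm -EFinM EFinD leeD2l// [leRHS]EFinM -(integral_excess_sub z) -ge0_integralZl//.
  + apply: ge0_le_integral => //.
    * by move=> t _; rewrite mule_ge0//; [case: mf|rewrite lee_fin subr_ge0].
    * by apply: emeasurable_funM => //; case: mf.
    * by apply: emeasurable_funM => //; exact: measurable_cst.
    * by move=> t _; rewrite lee_wpmul2r// lee_fin subr_ge0.
  + by move=> t _; rewrite lee_fin subr_ge0.
Qed.

Lemma doeblin n f (m lo hi : R) : mnneg f ->
  \int[leb R]_t f t = m%:E -> (0 <= lo <= m)%R -> (m <= hi)%R ->
  (forall c, lo%:E <= f c) -> (forall c, f c <= hi%:E) ->
  [/\ \int[leb R]_t ker_iter (nseq n g) f t = m%:E,
      forall c, (m - (1 - e) ^+ n * (m - lo))%:E <= ker_iter (nseq n g) f c &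
      forall c, ker_iter (nseq n g) f c <= (m + (1 - e) ^+ n * (hi - m))%:E].
Proof.
have e1 : (e <= 1)%R.
  rewrite -lee_fin -w1 -[leLHS]integral_leb_cst; apply: ge0_le_integral => //.
  - by move=> t _; rewrite lee_fin ltW.
  - exact/measurable_EFinP.
  - by move=> t _; rewrite lee_fin.
elim: n f lo hi => [|n IH] f lo hi mf fm /andP[lo0 lom] mhi flo fhi /=.
  by rewrite expr0 !mul1r; split=> // c; [rewrite subKr|rewrite addrC subrK].
have hi0 : (0 <= hi)%R by rewrite (le_trans lo0)// (le_trans lom).
have [h1 h2 h3] := doeblin_step mf fm lo0 hi0 flo fhi.
have mf' : mnneg (ker_op g f) by exact: mnneg_ker_op.
have [||k1 k2 k3] := IH _ _ _ mf' h1 _ _ h2 h3.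
- have : (0 <= e * (m - lo))%R by rewrite mulr_ge0 ?subr_ge0// ltW.
  have : (0 <= (1 - e) * (m - lo))%R by rewrite mulr_ge0 ?subr_ge0.
  lra.
- have : (0 <= (1 - e) * (hi - m))%R by rewrite mulr_ge0 ?subr_ge0.
  lra.
split=> // c; rewrite exprSr.
- by apply: le_trans (k2 c); rewrite lee_fin subKr mulrA.
- by apply: (le_trans (k3 c)); rewrite lee_fin addrAC subrr add0r mulrA.
Qed.

End doeblin.
End circle_convolution.
#[local] Arguments leb : simpl never.

(** * Increments of Gibbs measures *)

Section gibbs_increments.
Context {R : realType}.
Implicit Types (x : config R) (k : int).
Variables (rho : probability (config R) R) (b : circle R -> R) (M : R).
Hypotheses (mb : measurable_fun setT b) (bM : forall c, `|b c| <= M).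
Hypothesis dlr : forall k, site_dlr rho b k.
Hypothesis b1 : (\int[leb R]_t (expR (b t))%:E = 1)%E.

Local Notation w := (fun c => expR (b c)).
Local Notation wk := (step_kernel b).

Let mw : measurable_fun setT w.
Proof. by apply: measurableT_comp => //; exact: measurable_expR. Qed.

Let w0 c : 0 <= w c. Proof. exact: expR_ge0. Qed.

(** The transition kernel restricted to a left spin in B and an increment in A. *)
Definition edge (B A : set (circle R)) : circle R -> circle R -> R :=
  fun s t => \1_B s * (\1_A (s - t) * expR (b (s - t))).

Definition increment_prob (A : set (circle R)) : \bar R :=
  (\int[leb R]_t (\1_A t * expR (b t))%:E)%E.

Let mu A : measurable A -> measurable_fun setT (fun t => \1_A t * w t).
Proof. by move=> mA; apply: measurable_funM => //; exact: measurable_indic. Qed.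

Let u0 (A : set (circle R)) t : 0 <= \1_A t * w t.
Proof. by rewrite mulr_ge0// expR_ge0. Qed.

Lemma mkernel_edge B A : measurable B -> measurable A -> mkernel (edge B A).
Proof.
move=> mB mA; apply: (@mkernel_translation R (fun t => \1_A t * w t) \1_B).
- exact: mu.
- exact: u0.
- exact: measurable_indic.
- by move=> c; rewrite indicE.
Qed.

Lemma edge_le B A s t : edge B A s t <= expR M.
Proof.
rewrite /edge; have h c : expR (b c) <= expR M.
  by rewrite ler_expR (le_trans (ler_norm _)).
rewrite !indicE; case: (_ \in _); case: (_ \in _); rewrite ?mul0r ?mulr0 ?mul1r ?expR_ge0//.
Qed.

Lemma increment_prob_le1 A : measurable A -> (0 <= increment_prob A <= 1)%E.
Proof.
move=> mA; apply/andP; split.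
  by apply: integral_ge0 => t _; rewrite lee_fin.
rewrite -b1; apply: ge0_le_integral => //.
- by apply/measurable_EFinP; exact: mu.
- by apply/measurable_EFinP; exact: mw.
- move=> t _; rewrite lee_fin indicE; case: (_ \in _); rewrite ?mul1r ?mul0r ?expR_ge0//.
Qed.

Lemma increment_prob_fin A : measurable A ->
  increment_prob A = (fine (increment_prob A))%:E.
Proof.
move=> mA; rewrite fineK//; have /andP[h1 h2] := increment_prob_le1 mA.
by rewrite ge0_fin_numE// (le_lt_trans h2) ?ltry.
Qed.

Lemma increment_probT : increment_prob setT = 1%E.
Proof. by rewrite -b1; apply: eq_integral => t _; rewrite indicT mul1r. Qed.

Section edge_chain.
Variables (F G : nat -> set (circle R)).
Hypotheses (mF : forall i, measurable (F i)) (mG : forall i, measurable (G i)).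
Let gs s := [seq edge (F i) (G i) | i <- s].

Lemma mkernels_edges s : mkernels (gs s).
Proof.
move=> i; rewrite size_map => si; rewrite (nth_map 0%N)//; exact: mkernel_edge.
Qed.

Lemma ker_iter_edges_cst (s : seq nat) (c : R) : 0 <= c -> (forall i, i \in s -> F i = setT) ->
  ker_iter (gs s) (cst c%:E) =
  cst (c * \prod_(i <- s) fine (increment_prob (G i)))%:E.
Proof.
elim: s c => [|i s IH] c c0 sT /=; first by rewrite big_nil mulr1.
rewrite big_cons mulrA.
have -> : ker_op (edge (F i) (G i)) (cst c%:E) =
    cst (c * fine (increment_prob (G i)))%:E.
  apply: etrans (@ker_op_cst R (fun t => \1_(G i) t * w t) \1_(F i) (mu (mG i)) (@u0 _) c c0 _) _.
    by move=> t; rewrite sT ?mem_head// indicT.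
  by apply/funext => z; rewrite EFinM -increment_prob_fin.
rewrite IH//; last by move=> j js; apply: sT; rewrite inE js orbT.
rewrite mulr_ge0// fine_ge0//; have /andP[//] := increment_prob_le1 (mG i).
Qed.

Lemma integral_ker_iter_edges (s : seq nat) f : mnneg f -> (forall i, i \in s -> F i = setT) ->
  (\int[leb R]_t ker_iter (gs s) f t =
  (\int[leb R]_t f t) * (\prod_(i <- s) fine (increment_prob (G i)))%:E)%E.
Proof.
elim: s f => [|i s IH] f mf sT /=; first by rewrite big_nil mule1.
rewrite IH//; last 2 first.
- by apply: mnneg_ker_op => //; exact: mkernel_edge.
- by move=> j js; apply: sT; rewrite inE js orbT.
rewrite big_cons EFinM muleA; congr (_ * _)%E.
rewrite [LHS](@integral_ker_op R (fun t => \1_(G i) t * w t) \1_(F i))//; last exact: mu.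
rewrite -increment_prob_fin//; congr (_ * _)%E.
by apply: eq_integral => t _; rewrite sT ?mem_head// indicT mule1.
Qed.

(** At most one spin is constrained. Before it the density stays constant, since unmarked kernels
    multiply constants by a probability; after it only the total mass matters. Both sides therefore
    factorize. *)
Lemma integral_ker_iter_marked (s1 s2 : seq nat) i :
  (forall j, j \in s1 -> F j = setT) -> (forall j, j \in s2 -> F j = setT) ->
  (\int[leb R]_t ker_iter (gs (s1 ++ i :: s2)) (cst 1) t =
  leb R (F i) * (\prod_(j <- s1 ++ i :: s2) fine (increment_prob (G j)))%:E)%E.
Proof.
move=> s1T s2T; rewrite /gs map_cat ker_iter_cat.
rewrite ker_iter_edges_cst// mul1r /=.
set c := \prod_(j <- s1) _.
have c0 : 0 <= c.
  apply: prodr_ge0 => j _; rewrite fine_ge0//.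
  by have /andP[] := increment_prob_le1 (mG j).
rewrite integral_ker_iter_edges//; last first.
  by apply: mnneg_ker_op; [exact: mkernel_edge|exact: mnneg_cst].
rewrite [X in (X * _)%E](@integral_ker_op R (fun t => \1_(G i) t * w t) \1_(F i))//; last exact: mu.
rewrite ge0_integralZl//; last by apply/measurable_EFinP; exact: measurable_indic.
rewrite integral_indic// setIT -[X in (_ * X * _)%E]/(increment_prob (G i)).
rewrite big_cat big_cons/= -/c increment_prob_fin// !EFinM.
by rewrite [(c%:E * _)%E]muleC -!muleA; congr (_ * _)%E; rewrite muleA.
Qed.

End edge_chain.

Fixpoint event k (l : seq (set (circle R) * set (circle R))) : set (config R) :=
  if l is p :: l' then [set x | p.1 (x k) /\ p.2 (x k - x (k + 1)) /\ event (k + 1) l' x]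
  else setT.

Lemma path_weight_event k l x :
  path_weight k [seq edge p.1 p.2 | p <- l] x = \1_(event k l) x * bulk_weight b k (size l) x.
Proof.
elim: l k => [|p l IH] k /=; first by rewrite indicT mul1r.
rewrite IH /bulk_weight/= /edge /step_kernel.
have -> : \1_[set y | p.1 (y k) /\ p.2 (y k - y (k + 1)) /\ event (k + 1) l y] x =
   \1_(p.1) (x k) * (\1_(p.2) (x k - x (k + 1)) * \1_(event (k + 1) l) x) :> R.
  rewrite !indicE -!natrM !mulnb; congr (nat_of_bool _)%:R.
  apply/idP/idP; rewrite !inE/=.
    by move=> [h1 [h2 h3]]; rewrite !mem_set.
  by move=> /andP[/set_mem h1 /andP[/set_mem h2 /set_mem h3]].
ring.
Qed.

Lemma measurable_event k l : (forall p, List.In p l -> measurable p.1 /\ measurable p.2) ->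
  measurable (event k l).
Proof.
elim: l k => [|p l IH] k //= h.
have [m1 m2] := h p (or_introl erefl).
have e1 := @measurable_coord R k measurableT _ m1.
have e2 := measurable_circleB (@measurable_coord R k) (@measurable_coord R (k + 1)) measurableT m2.
have e3 := IH (k + 1) (fun q ql => h q (or_intror ql)).
by have := measurableI _ _ e1 (measurableI _ _ e2 e3); rewrite !setTI.
Qed.

#[local] Notation e := (expR (- M)).

Lemma measurable_ker_iter (f : circle R -> circle R -> \bar R) gs : mkernels gs ->
  measurable_fun setT (fun p : circle R * circle R => f p.1 p.2) ->
  (forall s t, 0 <= f s t)%E ->
  measurable_fun setT (fun p : circle R * circle R => ker_iter gs (f p.1) p.2) /\
  (forall s t, 0 <= ker_iter gs (f s) t)%E.
Proof.
elim: gs f => [//|g gs IH] f /mkernels_cons[mg mgs] mf f0 /=.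
have [m1 m2] := measurable_ker_op mg mf f0.
exact: (IH (fun s => ker_op g (f s)) mgs m1 m2).
Qed.

Lemma measurable_edge_event (F G : nat -> set (circle R)) (s : seq nat) k :
  (forall i, measurable (F i)) -> (forall i, measurable (G i)) ->
  measurable (event k [seq (F i, G i) | i <- s]).
Proof.
move=> mF mG; apply: measurable_event; elim: s => [//|j s IH] p /=.
case=> [<-|h]; last exact: IH.
by split; [exact: mF|exact: mG].
Qed.

Let e0 : 0 < e. Proof. exact: expR_gt0. Qed.

Let we c : e <= w c.
Proof. by rewrite ler_expR; have := bM c; rewrite ler_norml => /andP[]. Qed.

Let W1 : 1 <= expR M.
Proof.
have M0 : 0 <= M by rewrite (le_trans _ (bM point)).
by rewrite -expR0 ler_expR.
Qed.

Let e1 : e <= 1.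
Proof.
have M0 : 0 <= M by rewrite (le_trans _ (bM point)).
by rewrite -expR0 ler_expR oppr_le0.
Qed.

(** Mass of the weighted measure, the unknown normalization that [event_law] eliminates. *)
Definition bulk_mass k n : \bar R := (\int[rho]_x ((bulk_weight b k n x)^-1)%:E)%E.

(** The window [gs] is flanked by long chains. The left one makes the incoming density nearly 1
    whatever the spin at k; the right one makes the outgoing density nearly equal to its mass m. Up
    to errors governed by d the integrand is then m times the inverse bulk weight. C bounds all the
    densities to which Doeblin's estimate is applied. *)
Lemma sandwich (gs : seq (circle R -> circle R -> R)) k N (C m : R) :
  mkernels gs -> (forall z, ker_iter gs (cst 1%E) z <= C%:E)%E ->
  expR M <= C -> (\int[leb R]_z ker_iter gs (cst 1%E) z = m%:E)%E ->
  (1 - e) ^+ N * C <= 1 ->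
  let d := (1 - e) ^+ N * C in
  let n := (N.+1 + (size gs + N))%N in
  let X := (\int[rho]_x ((path_weight k (nseq N.+1 wk ++ gs ++ nseq N wk) x)%:E *
     ((bulk_weight b k n x)^-1)%:E))%E in
  ((((1 - d) * (1 - d) * m)%:E * bulk_mass k n <= X) /\
   (X <= ((1 + d) * (m + d))%:E * bulk_mass k n))%E.
Proof.
move=> mgs SC WC Sm dC d n X.
have q0 : 0 <= (1 - e) ^+ N by rewrite exprn_ge0// subr_ge0.
have C1 : 1 <= C by rewrite (le_trans W1).
have d0 : 0 <= d by rewrite mulr_ge0// (le_trans _ C1).
have qd : (1 - e) ^+ N <= d by rewrite /d ler_peMr.
have mwk : mkernel wk by exact: mkernel_step.
have mws j : mkernels (nseq j wk) by exact: mkernels_nseq.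
have mgw : mkernels (gs ++ nseq N wk).
  move=> i; rewrite size_cat nth_cat => iN; case: ltnP => si; first exact: mgs.
  by apply: mws; rewrite ltn_subLR.
have mall : mkernels (nseq N wk ++ (gs ++ nseq N wk)).
  move=> i; rewrite size_cat nth_cat => iN; case: ltnP => si; first exact: mws.
  by apply: mgw; rewrite ltn_subLR// size_cat.
have m1 : mnneg (cst 1%E : circle R -> \bar R) by exact: mnneg_cst.
have S0 := mnneg_ker_iter mgs m1.
have m0 : 0 <= m by rewrite -lee_fin -Sm; apply: integral_ge0 => z _; case: S0.
have mC : m <= C.
  rewrite -lee_fin -Sm -(integral_leb_cst C%:E); apply: ge0_le_integral => //.
  - by move=> z _; case: S0.
  - by case: S0.
have T1 f (p lo hi : R) := @doeblin R w e mw e0 we b1 N f p lo hi.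
have K0 y : mnneg (fun z => (wk y z)%:E).
  split; last by move=> z; rewrite lee_fin; exact: mwk.2.
  apply/measurable_EFinP; exact: (measurableT_comp mwk.1 (pair1_measurable y)).
(* The first of the N + 1 left kernels supplies the initial density, bounded by exp M and of mass 1;
   the other N bring it within d of 1. *)
have Kb y z : ((1 - d)%:E <= ker_iter (nseq N wk) (fun z => (wk y z)%:E) z <= (1 + d)%:E)%E.
  have [] := @T1 (fun z => (wk y z)%:E) 1 0 (expR M).
  - exact: K0.
  - rewrite (@integral_leb_rev R (fun z => (w z)%:E) y)//; exact/measurable_EFinP.
  - by rewrite lexx ler01.
  - exact: W1.
  - by move=> c; rewrite lee_fin expR_ge0.
  - by move=> c; rewrite lee_fin ler_expR (le_trans (ler_norm _)).
  move=> _ h2 h3; apply/andP; split.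
    by apply: le_trans (h2 z); rewrite lee_fin subr0 mulr1 lerD2l lerN2.
  apply: (le_trans (h3 z)); rewrite lee_fin lerD2l /d ler_wpM2l//.
  by rewrite (le_trans _ WC)// gerBl.
have fin y z : (((1 - d) * (1 - d) * m)%:E <=
    ker_iter (nseq N wk ++ (gs ++ nseq N wk)) (fun z => (wk y z)%:E) z <=
    ((1 + d) * (m + d))%:E)%E.
  rewrite !ker_iter_cat.
  pose f1 := ker_iter (nseq N wk) (fun z => (wk y z)%:E); rewrite -/f1.
  have mf1 : mnneg f1 by exact: (mnneg_ker_iter (mws N) (K0 y)).
  have S2b c : 0 <= c -> mnneg (fun t => c%:E * ker_iter gs (cst 1%E) t)%E.
    by move=> c0; exact: mnnegZ.
  have up t : (ker_iter gs f1 t <= (1 + d)%:E * ker_iter gs (cst 1%E) t)%E.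
    have d10 : 0 <= 1 + d by rewrite addr_ge0.
    have := @le_ker_iter R gs f1 (fun t => (1 + d)%:E * cst 1%E t)%E mgs mf1 (mnnegZ d10 m1).
    rewrite ker_iterZ// => h; apply: h => c; rewrite mule1.
    by have /andP[] := Kb y c.
  have lo t : ((1 - d)%:E * ker_iter gs (cst 1%E) t <= ker_iter gs f1 t)%E.
    have d10 : 0 <= 1 - d by rewrite subr_ge0.
    have := @le_ker_iter R gs (fun t => (1 - d)%:E * cst 1%E t)%E f1 mgs (mnnegZ d10 m1) mf1.
    rewrite ker_iterZ// => h; apply: h => c; rewrite mule1.
    by have /andP[] := Kb y c.
  (* By monotonicity it remains to mix the response of the window to the constant 1, which has mass
     m and lies between 0 and C. *)
  have [] := @T1 (ker_iter gs (cst 1%E)) m 0 C.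
  - exact: S0.
  - exact: Sm.
  - by rewrite lexx.
  - exact: mC.
  - by case: S0.
  - exact: SC.
  move=> _ h2 h3; apply/andP; split.
    apply: (@le_trans _ _ ((1 - d)%:E * ker_iter (nseq N wk) (ker_iter gs (cst 1%E)) z)%E).
      rewrite -mulrA EFinM; apply: lee_wpmul2l; first by rewrite lee_fin subr_ge0.
      apply: le_trans (h2 z); rewrite lee_fin subr0 mulrBl mul1r lerD2l lerN2.
      by rewrite ler_wpM2r.
    have d10 : 0 <= 1 - d by rewrite subr_ge0.
    have := @le_ker_iter R (nseq N wk) (fun t => (1 - d)%:E * ker_iter gs (cst 1%E) t)%E
      (ker_iter gs f1) (mws N) (S2b _ d10) (mnneg_ker_iter mgs mf1) lo z.
    by rewrite ker_iterZ.
  have d10 : 0 <= 1 + d by rewrite addr_ge0.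
  have := @le_ker_iter R (nseq N wk) (ker_iter gs f1)
    (fun t => (1 + d)%:E * ker_iter gs (cst 1%E) t)%E
    (mws N) (mnneg_ker_iter mgs mf1) (S2b _ d10) up z.
  rewrite ker_iterZ// => /le_trans; apply.
  rewrite EFinM lee_wpmul2l// ?lee_fin//.
  apply: (le_trans (h3 z)); rewrite lee_fin lerD2l /d ler_wpM2l//.
  by rewrite gerBl.
(* [chain] is applied from site k + 1, its K being the first left kernel, between the sites k and k
   + 1. *)
have XE : X = (\int[rho]_x (ker_iter (nseq N wk ++ (gs ++ nseq N wk)) (fun z => (wk (x k) z)%:E)
    (x (k + 1 + (size (nseq N wk ++ (gs ++ nseq N wk)))%:Z)%R) * ((bulk_weight b k n x)^-1)%:E))%E.
  have kn : k + 1 + (size (nseq N wk ++ (gs ++ nseq N wk)))%:Z <= k + n%:Z.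
    by rewrite !size_cat !size_nseq -addrA lerD2l -PoszD lez_nat add1n.
  have kk : k < k + 1 by rewrite ltrDl.
  have mK := proj2 (measurable_EFinP _ _) mwk.1.
  have K0' s t : (0 <= (wk s t)%:E)%E by rewrite lee_fin; exact: mwk.2.
  apply: etrans (chain mb bM dlr mK K0' mall kk kn).
  by apply: eq_integral => x _; rewrite /= EFinM.
have mbw := measurable_bulk_weightV mb k n.
have bw0 x : (0 <= ((bulk_weight b k n x)^-1)%:E)%E.
  by rewrite lee_fin invr_ge0 ltW// bulk_weight_gt0.
have mX : measurable_fun setT (fun x => (ker_iter (nseq N wk ++ (gs ++ nseq N wk)) (fun z => (wk (x k) z)%:E)
    (x (k + 1 + (size (nseq N wk ++ (gs ++ nseq N wk)))%:Z)%R) * ((bulk_weight b k n x)^-1)%:E))%E.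
  apply: emeasurable_funM; last exact/measurable_EFinP.
  set l := nseq N wk ++ _; set k' := (k + 1 + _)%R.
  have [mK _] := @measurable_ker_iter (fun s t => (wk s t)%:E) l mall
    (proj2 (measurable_EFinP _ _) mwk.1) (fun s t => mwk.2 s t).
  have mp : measurable_fun setT (fun x : config R => (x k, x k')).
    by apply: measurable_fun_pair; exact: measurable_coord.
  exact: (measurableT_comp mK mp).
rewrite XE /bulk_mass; split.
  rewrite -ge0_integralZl//; last 2 first.
  - exact/measurable_EFinP.
  - by rewrite lee_fin !mulr_ge0// subr_ge0.
  apply: ge0_le_integral => //.
  - by move=> x _; rewrite mule_ge0// lee_fin !mulr_ge0// subr_ge0.
  - by apply: emeasurable_funM; [exact: measurable_cst|exact/measurable_EFinP].
  - by move=> x _; rewrite lee_wpmul2r//; have /andP[] := fin (x k) (x (k + 1 + (size (nseq N wk ++ (gs ++ nseq N wk)))%:Z)%R).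
rewrite -ge0_integralZl//; last 2 first.
- exact/measurable_EFinP.
- by rewrite lee_fin mulr_ge0// addr_ge0.
apply: ge0_le_integral => //.
- move=> x _; rewrite mule_ge0//.
  by have [_] := mnneg_ker_iter mall (K0 (x k)); apply.
- by apply: emeasurable_funM; [exact: measurable_cst|exact/measurable_EFinP].
- by move=> x _; rewrite lee_wpmul2r//; have /andP[] := fin (x k) (x (k + 1 + (size (nseq N wk ++ (gs ++ nseq N wk)))%:Z)%R).
Qed.

Lemma path_weight_sandwich k N l x :
  path_weight (k - N.+1%:Z) (nseq N.+1 wk ++ [seq edge p.1 p.2 | p <- l] ++ nseq N wk) x =
  \1_(event k l) x * bulk_weight b (k - N.+1%:Z) (N.+1 + (size l + N)) x.
Proof.
rewrite !path_weight_cat path_weight_event /bulk_weight !nseqD !path_weight_cat.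
rewrite !size_nseq size_map subrK; ring.
Qed.

Section limit.
Variables (F G : nat -> set (circle R)).
Hypotheses (mF : forall i, measurable (F i)) (mG : forall i, measurable (G i)).
Variables (s1 s2 : seq nat) (i0 : nat).
Hypotheses (s1T : forall j, j \in s1 -> F j = setT) (s2T : forall j, j \in s2 -> F j = setT).
Let s := s1 ++ i0 :: s2.
Let l := [seq (F i, G i) | i <- s].
Let m := fine (leb R (F i0)) * \prod_(j <- s) fine (increment_prob (G j)).

(** [C'] is free above a threshold so that two different events can share [C'] and N, hence the same
    error and the same bulk mass. *)
Lemma event_sandwich k :
  exists C : R, expR M <= C /\ forall C' N, C <= C' -> (1 - e) ^+ N * C' <= 1 ->
  let d := (1 - e) ^+ N * C' in
  let E := bulk_mass (k - N.+1%:Z) (N.+1 + (size s + N)) in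
  ((((1 - d) * (1 - d) * m)%:E * E <= rho (event k l)) /\
   (rho (event k l) <= ((1 + d) * (m + d))%:E * E))%E.
Proof.
pose gs := [seq edge p.1 p.2 | p <- l].
have gsE : gs = [seq edge (F i) (G i) | i <- s] by rewrite /gs /l -map_comp.
have mgs : mkernels gs by rewrite gsE; exact: mkernels_edges.
have [|||||C gsC] := @ker_iter_bounded R gs (cst 1%E) 1 (expR M) mgs.
- exact: mnneg_cst.
- move=> i s' t; rewrite gsE size_map => si.
  by rewrite (nth_map 0%N)//; exact: edge_le.
- by [].
- exact: expR_ge0.
- by [].
exists (Num.max (expR M) C); split; first by rewrite le_max lexx.
move=> C' N; rewrite ge_max => /andP[MC CC] dC d E.
have Sm : (\int[leb R]_z ker_iter gs (cst 1%E) z = m%:E)%E.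
  rewrite gsE integral_ker_iter_marked// /m EFinM fineK//.
  exact: fin_num_measure.
have SC z : (ker_iter gs (cst 1) z <= C'%:E)%E.
  by apply: le_trans (gsC z) _; rewrite lee_fin.
have XE : (\int[rho]_x ((path_weight (k - N.+1%:Z) (nseq N.+1 wk ++ gs ++ nseq N wk) x)%:E *
    ((bulk_weight b (k - N.+1%:Z) (N.+1 + (size gs + N)) x)^-1)%:E) = rho (event k l))%E.
  have mE : measurable (event k l).
    exact: measurable_edge_event.
  have := integral_indic rho (@measurableT _ _) mE; rewrite setIT => <-.
  apply: eq_integral => x _; rewrite path_weight_sandwich /gs !size_map -EFinM.
  by rewrite mulfK//; apply: lt0r_neq0; exact: bulk_weight_gt0.
have [] := sandwich (k - N.+1%:Z) mgs SC MC Sm dC.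
by rewrite XE /gs !size_map.
Qed.

End limit.

(** The sandwich is used for the event and for the whole space, on the same block. The second
    confines the bulk mass near 1, and the error tends to 0 as the flanking chains grow. *)
Lemma event_law F G (mF : forall i, measurable (F i)) (mG : forall i, measurable (G i))
    (s1 s2 : seq nat) i0 k :
  (forall j, j \in s1 -> F j = setT) -> (forall j, j \in s2 -> F j = setT) ->
  rho (event k [seq (F i, G i) | i <- s1 ++ i0 :: s2]) =
  (leb R (F i0) * (\prod_(j <- s1 ++ i0 :: s2) fine (increment_prob (G j)))%:E)%E.
Proof.
move=> s1T s2T.
have [C1 [MC1 H1]] := @event_sandwich F G mF mG s1 s2 i0 s1T s2T k.
have mT (_ : nat) := @measurableT _ (circle R).
(* The same chain without any constraint, whose event is the whole space. *)
have [C2 [MC2 H2]] := @event_sandwich (fun=> setT) (fun=> setT) mT mT s1 s2 i0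
  (fun _ _ => erefl) (fun _ _ => erefl) k.
set s := s1 ++ i0 :: s2 in H1 H2 *.
set m := fine _ * _ in H1.
set m' := fine _ * _ in H2.
have m'1 : m' = 1.
  rewrite /m' probability_setT mul1r big1// => j _.
  by rewrite increment_probT.
rewrite m'1 in H2.
have -> : (leb R (F i0) * (\prod_(j <- s) fine (increment_prob (G j)))%:E = m%:E)%E.
  by rewrite /m EFinM fineK// fin_num_measure.
have m0 : 0 <= m.
  rewrite mulr_ge0 ?fine_ge0//; apply: prodr_ge0 => j _; rewrite fine_ge0//.
  by have /andP[] := increment_prob_le1 (mG j).
have eT (s' : seq nat) k' :
    event k' [seq (setT : set (circle R), setT : set (circle R)) | i <- s'] = setT.
  elim: s' k' => [//|j s' IH] k' /=; rewrite IH.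
  by apply/seteqP; split.
rewrite eT in H2.
set E0 := event k _ in H1 *.
have mE0 : measurable E0.
  exact: measurable_edge_event.
have p1 : (rho E0 <= 1)%E by exact: probability_le1.
have pE : rho E0 = (fine (rho E0))%:E by rewrite fineK// fin_num_measure.
rewrite pE; congr _%:E; set p := fine (rho E0) in pE *.
have p0 : 0 <= p by rewrite fine_ge0.
rewrite pE lee_fin in p1; rewrite pE in H1.
clearbody m p E0; pose C := Num.max C1 C2.
have C0 : 0 < C by rewrite lt_max (lt_le_trans _ MC1)// expR_gt0.
(* With d = (1 - e)^N C and bulk mass r, the whole space gives (1 - d)^2 r <= 1 <= (1 + d)^2 r.
   Eliminating r from the bounds for p, with p <= 1 and d^2 <= d, leaves an error of at most d (4 +
   2 m). *)
have key N : (1 - e) ^+ N * C <= 2^-1 -> `|p - m| <= (1 - e) ^+ N * C * (4 + 2 * m).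
  move=> dC; have dC1 : (1 - e) ^+ N * C <= 1 by rewrite (le_trans dC)// invf_le1// ler1n.
  have := H1 C N; rewrite le_max lexx/= => /(_ isT dC1).
  have := H2 C N; rewrite le_max lexx orbT/= => /(_ isT dC1).
  set d := _ * C in dC dC1 *; set E := bulk_mass _ _.
  have d0 : 0 <= d by rewrite mulr_ge0 ?(ltW C0)// exprn_ge0// subr_ge0.
  clearbody d; have E0' : (0 <= E)%E.
    by apply: integral_ge0 => x _; rewrite lee_fin invr_ge0 ltW// bulk_weight_gt0.
  rewrite (probability_setT rho).
  case: E E0' => [r| |]//.
    rewrite lee_fin -!EFinM !lee_fin mulr1 => r0 [h1 h2] [h3 h4].
    have d1 : 0 <= 1 - d by rewrite subr_ge0.
    have k1 : p * ((1 - d) * (1 - d)) <= (1 + d) * (m + d).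
      have : (1 + d) * (m + d) * ((1 - d) * (1 - d) * r) <= (1 + d) * (m + d) * 1.
        by apply: ler_wpM2l => //; rewrite mulr_ge0// addr_ge0.
      have : p * ((1 - d) * (1 - d)) <= (1 + d) * (m + d) * r * ((1 - d) * (1 - d)).
        by apply: ler_wpM2r => //; rewrite mulr_ge0// subr_ge0.
      lra.
    have k2 : (1 - d) * (1 - d) * m <= p * ((1 + d) * (1 + d)).
      have : (1 - d) * (1 - d) * m * 1 <= (1 - d) * (1 - d) * m * ((1 + d) * (1 + d) * r).
        by apply: ler_wpM2l => //; rewrite !mulr_ge0.
      have : (1 - d) * (1 - d) * m * r * ((1 + d) * (1 + d)) <= p * ((1 + d) * (1 + d)).
        by apply: ler_wpM2r => //; rewrite mulr_ge0// addr_ge0.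
      lra.
    have dp : d * p <= d by rewrite ler_piMr.
    have dd : d * d <= d by rewrite ler_piMr.
    have ddp : 0 <= d * d * p by rewrite !mulr_ge0.
    have ddp' : d * d * p <= d by rewrite (le_trans _ dp)// ler_wpM2r// ler_piMr.
    have ddm : 0 <= d * d * m by rewrite !mulr_ge0.
    have dm : 0 <= d * m by rewrite mulr_ge0.
    by rewrite ler_norml; apply/andP; split; lra.
  (* An infinite bulk mass would make the lower bound for the whole space infinite, since 1 - d >
     0. *)
  move=> _ [] + _; rewrite mulr1 gt0_muley ?leye_eq// lte_fin mulr_gt0// subr_gt0; lra.
apply/eqP/negPn/negP => pm.
have {}pm : 0 < `|p - m| by rewrite normr_gt0 subr_eq0.
have q1 : `|1 - e| < 1 by rewrite ger0_norm ?subr_ge0// ltrBlDr ltrDl.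
(* The first bound ensures d <= 1/2, as [key] requires; the second makes the error smaller than half
   of |p - m|. *)
pose eps := Num.min (2^-1 / C) (`|p - m| / 2 / (C * (4 + 2 * m))).
have D0 : 0 < C * (4 + 2 * m) by rewrite mulr_gt0// ltr_wpDr// mulr_ge0.
have eps0 : 0 < eps by rewrite lt_min !divr_gt0.
have /cvgrPdist_lt/(_ eps eps0) := cvg_expr q1.
move=> [N _ /(_ N (leqnn N))] /=; rewrite sub0r normrN ger0_norm; last first.
  by rewrite exprn_ge0// subr_ge0.
rewrite lt_min => /andP[h1 h2].
have := key N; rewrite -ler_pdivlMr// (ltW h1) => /(_ isT).
move: h2; rewrite ltr_pdivlMr// mulrA => h2 h3.
have := le_lt_trans h3 h2.
by rewrite ltr_pdivlMr// mulr_natr mulr2n -subr_gt0 opprD addrA subrr sub0r oppr_gt0 ltNge (ltW pm).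
Qed.

End gibbs_increments.

(** * Law of the increments of a Gibbs measure *)

Section gibbs_law.
Context {R : realType}.
Implicit Types (x : config R) (k : int).

Lemma event_iota (F G : nat -> set (circle R)) c n j x :
  event (c + n%:Z) [seq (F i, G i) | i <- iota n j] x <->
  forall i, (n <= i < n + j)%N ->
    F i (x (c + i%:Z)) /\ G i (x (c + i%:Z) - x (c + i%:Z + 1)).
Proof.
elim: j n => [|j IH] n /=.
  by split=> // _ i; rewrite addn0; lia.
have cn : c + n%:Z + 1 = c + n.+1%:Z by lia.
rewrite cn IH; split.
  move=> [h1 [h2 h3]] i ni; have [->|nei] := eqVneq i n; first by rewrite cn.
  by apply: h3; move: nei => /eqP; lia.
move=> h; have [|h1 h2] := h n; first by lia.
split=> //; split; last by move=> i ni; apply: h; lia.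
by move: h2; rewrite cn.
Qed.

Lemma prod_fset_window (L : {fset int}) K (g : int -> R) :
  (forall k, k \in L -> (`|k| <= K)%N) ->
  \prod_(i <- iota 0 (K + K.+1)) (if (i%:Z - K%:Z) \in L then g (i%:Z - K%:Z) else 1) =
  \prod_(k <- L) g k.
Proof.
move=> LK; pose h (i : nat) := i%:Z - K%:Z.
rewrite -(big_map h xpredT (fun k => if k \in L then g k else 1)) -big_mkcond/= -big_filter.
apply: perm_big; apply: uniq_perm; rewrite ?fset_uniq ?filter_uniq//.
  by rewrite map_inj_uniq ?iota_uniq// => i j; rewrite /h; lia.
move=> k; rewrite mem_filter; case: (boolP (k \in L)) => //= kL.
apply/mapP; exists (absz (k + K%:Z)%R); last by rewrite /h; have := LK _ kL; lia.
by rewrite mem_iota; have := LK _ kL; lia.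
Qed.

Section normalized.
Variables (rho : probability (config R) R) (b : circle R -> R) (M : R).
Hypotheses (mb : measurable_fun setT b) (bM : forall c, `|b c| <= M).
Hypothesis dlr : forall k, site_dlr rho b k.
Hypothesis b1 : (\int[leb R]_t (expR (b t))%:E = 1)%E.

(** L is enclosed in the window from -K to K, of 2K + 1 sites, with trivial constraints off L. Site
    0 has index K there and is the only marked spin, as [event_law] demands. *)
Lemma joint_law (B : set (circle R)) (L : {fset int}) (A : int -> set (circle R)) :
  measurable B -> (forall k, measurable (A k)) ->
  rho [set x | B (x 0) /\ forall k, k \in L -> A k (difference_map x k)] =
  (leb R B * \prod_(k <- L) increment_prob b (A k))%E.
Proof.
move=> mB mA; pose K := (\max_(k <- L) `|k|)%N.
have LK k : k \in L -> (`|k| <= K)%N by move=> kL; rewrite /K; apply: leq_bigmax_seq.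
clearbody K.
pose F (i : nat) := if i == K then B else setT.
pose G (i : nat) := if (i%:Z - K%:Z) \in L then A (i%:Z - K%:Z) else setT.
have mF i : measurable (F i) by rewrite /F; case: ifP.
have mG i : measurable (G i) by rewrite /G; case: ifP.
have FK : F K = B by rewrite /F eqxx.
have F1 j : j \in iota 0 K -> F j = setT.
  by rewrite mem_iota /F => jK; case: eqP => // ?; lia.
have F2 j : j \in iota K.+1 K -> F j = setT.
  by rewrite mem_iota /F => jK; case: eqP => // ?; lia.
have := event_law mb bM dlr b1 mF mG K (- K%:Z) F1 F2.
have -> : iota 0 K ++ K :: iota K.+1 K = iota 0 (K + K.+1) by rewrite iotaD.
have -> : event (- K%:Z) [seq (F i, G i) | i <- iota 0 (K + K.+1)] =
   [set x | B (x 0) /\ forall k, k \in L -> A k (difference_map x k)].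
  apply/seteqP; split=> x.
    have := event_iota F G (- K%:Z) 0 (K + K.+1) x; rewrite addr0 => -> h; split.
      have [|h1 _] := h K; first by lia.
      by move: h1; rewrite FK addNr.
    move=> k kL; have kK := LK k kL.
    have [|_] := h (absz (k + K%:Z)%R); first by lia.
    have -> : - K%:Z + (absz (k + K%:Z)%R)%:Z = k by lia.
    by rewrite /G (_ : (absz (k + K%:Z)%R)%:Z - K%:Z = k) ?kL//; lia.
  move=> /= [h1 h2]; have := event_iota F G (- K%:Z) 0 (K + K.+1) x.
  rewrite addr0 => -> i iK; split.
    by rewrite /F; case: eqP => // ->; rewrite addNr.
  by rewrite /G addrC; case: ifP => // /h2.
rewrite FK => ->; congr (_ * _)%E.
rewrite (eq_bigr (fun i : nat => if (i%:Z - K%:Z) \in L then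
    fine (increment_prob b (A (i%:Z - K%:Z))) else 1)); last first.
  by move=> i _; rewrite /G; case: ifP => //; rewrite increment_probT.
rewrite (prod_fset_window (fun k => fine (increment_prob b (A k))) LK).
rewrite (big_morph EFin EFinM erefl); apply: eq_bigr => k _.
by rewrite -(increment_prob_fin mb b1).
Qed.

(** The product property is [joint_law] without constraint on the spin. Symmetry is obtained
    indirectly: the spin at 0 is uniform and independent of the increments, so rho is a [recon_law],
    and these are symmetric. *)
Lemma gibbs_increments : symmetric_with_increments rho (increment_prob b).
Proof.
have prod : is_product_measure (difference_law rho) (increment_prob b).
  move=> L A mA; have := joint_law L (@measurableT _ (circle R)) mA.
  rewrite [X in (X * _)%E](probability_setT (leb R)) mul1e => <-.
  by congr (rho _); apply/seteqP; split=> x /=; [|case].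
split; last exact: prod.
have E := @independence_recon R rho _.
have {}E : forall E, measurable E -> rho E = recon_law (difference_law rho) E.
  apply: E => B D mB mD.
  have mB' : measurable [set x : config R | B (x 0)].
    by rewrite -[X in measurable X]setTI; exact: measurable_coord.
  (* For fixed B both sides are finite measures in D, and [joint_law] says that they agree on
     boxes. *)
  pose m1 : {measure set (config R) -> \bar R} :=
    pushforward (mrestr rho mB') (@difference_map R).
  have m1E D' : m1 measurable_difference_map D' =
      rho [set x | B (x 0) /\ D' (difference_map x)].
    rewrite /m1 /pushforward /= /mrestr; congr (rho _).
    by apply/seteqP; split=> x [].
  pose r : {nonneg R} := NngNum (fine_ge0 (measure_ge0 (leb R) B)).
  pose m2 : {measure set (config R) -> \bar R} := mscale r (difference_law rho).
  have m2E D' : m2 D' = (leb R B * difference_law rho D')%E.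
    have lB : leb R B = (fine (leb R B))%:E by rewrite fineK// fin_num_measure.
    by rewrite [in RHS]lB.
  rewrite -m1E -m2E; apply: config_measure_unique => //.
    by rewrite m1E (le_lt_trans (probability_le1 _ _)) ?ltry//;
      rewrite (_ : [set x | _] = [set x : config R | B (x 0)])//;
      apply/seteqP; split=> x //= [].
  move=> _ [L [A [mA ->]]]; rewrite m1E m2E prod// -joint_law//.
move=> t A mA.
have mt : measurable ((Defs.shift t) @^-1` A).
  by rewrite -[X in measurable X]setTI; exact: measurable_shift.
rewrite {1}/pushforward E// [RHS]E//.
exact: (recon_law_symmetric (difference_law rho)).
Qed.

End normalized.

Section gibbs.
Variables (rho : probability (config R) R) (b : circle R -> R) (M : R).
Hypotheses (mb : measurable_fun setT b) (bM : forall c, `|b c| <= M).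
Hypothesis gibbs : is_gibbs_measure (nn_interaction b) rho.

Lemma site_dlr_sub a k : site_dlr rho (fun c => b c - a) k.
Proof.
move=> F mF F0; rewrite (gibbs_site_dlr k mb bM gibbs mF F0).
apply: eq_integral => x _; apply: eq_integral => t _.
by congr (_ * _%:E)%E; apply/esym/(site_density_sub _ _ _ _ mb bM).
Qed.

(** Subtracting it from b normalizes the transition kernel without altering the conditional
    densities. *)
Definition pressure : R := ln (fine (\int[leb R]_t (expR (b t))%:E)%E).

Lemma partition_pos : (\int[leb R]_t (expR (b t))%:E = (expR pressure)%:E)%E.
Proof.
have mw : measurable_fun setT (fun t => (expR (b t))%:E).
  by apply/measurable_EFinP; apply: measurableT_comp => //; exact: measurable_expR.
have h1 : ((expR (- M))%:E <= \int[leb R]_t (expR (b t))%:E)%E.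
  rewrite -[leLHS]integral_leb_cst; apply: ge0_le_integral => //.
  - by move=> t _; rewrite lee_fin; exact: expR_ge0.
  - by move=> t _; rewrite lee_fin ler_expR; have := bM t; rewrite ler_norml => /andP[].
have h2 : (\int[leb R]_t (expR (b t))%:E <= (expR M)%:E)%E.
  rewrite -[leRHS]integral_leb_cst; apply: ge0_le_integral => //.
  - by move=> t _; rewrite lee_fin ler_expR; have := bM t; rewrite ler_norml => /andP[].
have Z : (\int[leb R]_t (expR (b t))%:E)%E \is a fin_num.
  by rewrite fin_real// (lt_le_trans _ h1) ?ltNyr// (le_lt_trans h2) ?ltry.
rewrite /pressure lnK ?fineK// posrE -lte_fin fineK//.
by apply: lt_le_trans h1; rewrite lte_fin expR_gt0.
Qed.

Lemma pressure_normalized : (\int[leb R]_t (expR (b t - pressure))%:E = 1)%E.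
Proof.
have mw : measurable_fun setT (fun t => (expR (b t))%:E).
  by apply/measurable_EFinP; apply: measurableT_comp => //; exact: measurable_expR.
rewrite (eq_integral (fun t => (expR (- pressure))%:E * (expR (b t))%:E)%E); last first.
  by move=> t _; rewrite -EFinM -expRD addrC.
rewrite ge0_integralZl//.
by rewrite partition_pos -EFinM -expRD addNr expR0.
Qed.

Lemma gibbs_symmetric_increments :
  symmetric_with_increments rho (increment_prob (fun c => b c - pressure)).
Proof.
apply: (@gibbs_increments rho (fun c => b c - pressure) (M + `|pressure|)).
- by apply: measurable_funB => //; exact: measurable_cst.
- by move=> c; rewrite (le_trans (ler_normB _ _))// lerD2r.
- by move=> k; exact: site_dlr_sub.
- exact: pressure_normalized.
Qed.

End gibbs.

(** The conditional density of a constant potential is 1, so rho is invariant under resampling any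
    spin with Leb. Resampling the constrained spins in turn produces one factor for each. *)
Lemma gibbs_constant (rho : probability (config R) R) (a : R) :
  is_gibbs_measure (nn_interaction (fun=> a)) rho -> is_product_measure rho (leb R).
Proof.
move=> gibbs L A mA.
have mb : measurable_fun setT (fun _ : circle R => a) by exact: measurable_cst.
have bM (c : circle R) : `|(fun _ : circle R => a) c| <= `|a| by [].
have dlr k := gibbs_site_dlr k mb bM gibbs.
have res k (F : config R -> \bar R) : measurable_fun setT F -> (forall x, 0 <= F x)%E ->
    (\int[rho]_x F x = \int[rho]_x resample k F x)%E.
  move=> mF F0; rewrite (dlr k _ mF F0); apply: eq_integral => x _.
  apply: eq_integral => t _; rewrite /site_density.
  have -> : site_weight (fun=> a) k (upd x k t) = expR (a + a) by [].
  rewrite /site_partition (eq_integral (cst (expR (a + a))%:E))//.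
  by rewrite integral_leb_cst /= mulVf ?mule1// gt_eqF// expR_gt0.
(* Induction over a duplicate-free list: resampling the head integrates its indicator and leaves the
   factors of the tail alone, since the head does not occur there. *)
suff H (s : seq int) : uniq s ->
    (\int[rho]_x (\prod_(k <- s) \1_(A k) (x k))%:E = \prod_(k <- s) leb R (A k))%E.
  rewrite -(H L (fset_uniq L)).
  have mE := measurable_box L mA.
  have := integral_indic rho (@measurableT _ _) mE; rewrite setIT => <-.
  apply: eq_integral => x _; congr (_%:E); rewrite indicE.
  case: (boolP (x \in _)); rewrite ?inE ?notin_setE /= => h.
    by rewrite big_seq big1// => k kL; rewrite indicE mem_set//; exact: h.
  move/existsNP : h => [k /not_implyP[kL Ak]].
  by rewrite (big_rem k)//= indicE memNset// mul0r.
elim: s => [|k s IH] /=.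
  rewrite big_nil => _; under eq_integral do rewrite big_nil.
  by rewrite integral_cst// mul1e; exact: probability_setT.
move=> /andP[ks us]; rewrite big_cons -IH//.
have mP (s' : seq int) : measurable_fun setT (fun x : config R => \prod_(k <- s') \1_(A k) (x k) : R).
  elim: s' => [|j s' IH'] ; first by under eq_fun do rewrite big_nil; exact: measurable_cst.
  under eq_fun do rewrite big_cons; apply: measurable_funM => //.
  apply: measurableT_comp; last exact: measurable_coord.
  exact: measurable_indic.
have P0 (s' : seq int) x : 0 <= \prod_(k <- s') \1_(A k) (x k) :> R.
  by apply: prodr_ge0 => j _; rewrite indicE.
apply: etrans (res k (fun x => (\prod_(j <- k :: s) \1_(A j) (x j))%:E) _ _) _.
- by apply/measurable_EFinP.
- by move=> x; rewrite lee_fin.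
rewrite -ge0_integralZl//; [|exact/measurable_EFinP|by move=> x _; rewrite lee_fin].
apply: eq_integral => x _; rewrite /resample.
rewrite (eq_integral (fun t => (\prod_(j <- s) \1_(A j) (x j))%:E * (\1_(A k) t)%:E)%E); last first.
  move=> t _; rewrite big_cons upd_same EFinM muleC; congr (_%:E * _)%E.
  rewrite big_seq [RHS]big_seq; apply: eq_bigr => j js; rewrite upd_other//.
  by apply: contraNneq ks => <-.
rewrite ge0_integralZl//; last 2 first.
- by apply/measurable_EFinP; exact: measurable_indic.
- by rewrite lee_fin.
by rewrite integral_indic// setIT muleC.
Qed.

End gibbs_law.

(** * Power series and their leading terms *)

Section power_series.
Context {R : realType}.
Implicit Types (u : R^nat) (x y : R).

Definition psum_on u (r : R) := forall x, `|x| < r -> cvgn (pseries u x).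

(** The terms at K are bounded, so those of the derived series at x are of order n q^n with q = |x|
    / |K| < 1. A geometric series of ratio p, strictly between q and 1, absorbs the factor n. *)
Lemma cvg_pseries_diffs_inside u K x :
  cvgn (pseries u K) -> `|x| < `|K| -> cvgn (pseries (pseries_diffs u) x).
Proof.
move=> uK xK.
have K0 : 0 < `|K| by exact: le_lt_trans xK.
have [B [_ BK]] := cvg_series_bounded uK.
pose q := `|x| / `|K|; pose p := (1 + q) / 2.
have q0 : 0 <= q by rewrite divr_ge0.
have q1 : q < 1 by rewrite ltr_pdivrMr// mul1r.
have qp : q < p by rewrite /p; lra.
have p1 : p < 1 by rewrite /p; lra.
have B1 n : `|u n * K ^+ n| <= `|B| + 1.
  by apply: BK => //; rewrite (le_lt_trans (ler_norm _))// ltrDl.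
apply: normed_cvg; apply: (@series_le_cvg _ _ (geometric ((`|B| + 1) / `|K| / (p - q) * p) p)).
- by move=> n; exact: normr_ge0.
- move=> n; rewrite /geometric/= mulr_ge0 ?exprn_ge0//; last by rewrite (le_trans q0) ?ltW.
  rewrite mulr_ge0//; last by rewrite (le_trans q0) ?ltW.
  by apply: divr_ge0; [apply: divr_ge0 => //; rewrite addr_ge0|rewrite subr_ge0 ltW].
- move=> n; rewrite /geometric/=.
  (* From p^(n+1) - q^(n+1) = (p - q) times the sum of the p^(n-i) q^i, whose n + 1 terms are each
     at least q^n. *)
  have qn : n.+1%:R * q ^+ n <= p ^+ n.+1 / (p - q).
    rewrite ler_pdivlMr ?subr_gt0// mulrC.
    apply: (@le_trans _ _ (p ^+ n.+1 - q ^+ n.+1)); last first.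
      by rewrite gerBl exprn_ge0.
    rewrite subrXX ler_pM2l ?subr_gt0// mulr_natl.
    rewrite -[X in _ *+ X](card_ord n.+1) -sumr_const; apply: ler_sum => i _.
    have -> : q ^+ n = q ^+ (n - i) * q ^+ i by rewrite -exprD subnK// -ltnS.
    by rewrite /= ler_wpM2r ?exprn_ge0// lerXn2r ?nnegrE// ?(le_trans q0)// ltW.
  have -> : `|pseries_diffs u n * x ^+ n| =
      (`|u n.+1 * K ^+ n.+1| / `|K|) * (n.+1%:R * q ^+ n).
    rewrite /pseries_diffs !normrM !normrX normr_nat /q expr_div_n exprS.
    by field; rewrite ?lt0r_neq0 ?exprn_gt0.
  apply: (@le_trans _ _ ((`|B| + 1) / `|K| * (p ^+ n.+1 / (p - q)))).
    apply: ler_pM => //; first by rewrite mulr_ge0// exprn_ge0.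
    by rewrite ler_pM2r// invr_gt0.
  by rewrite exprS le_eqVlt; apply/orP; left; apply/eqP; ring.
- by apply: is_cvg_geometric_series; rewrite ger0_norm// (le_trans q0)// ltW.
Qed.

Lemma psum_on_diffs u r : psum_on u r -> psum_on (pseries_diffs u) r.
Proof.
move=> ur x xr; apply: (@cvg_pseries_diffs_inside _ ((`|x| + r) / 2)).
  by apply: ur; rewrite ger0_norm; have := normr_ge0 x; lra.
by rewrite [ltRHS]ger0_norm; have := normr_ge0 x; lra.
Qed.

Lemma is_derive_psum u r x : psum_on u r -> `|x| < r ->
  is_derive x (1 : R) (fun x => limn (pseries u x)) (limn (pseries (pseries_diffs u) x)).
Proof.
move=> ur xr; have r0 := normr_ge0 x.
have Kr : `|(`|x| + r) / 2| < r by rewrite ger0_norm; lra.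
apply: (@pseries_snd_diffs _ _ ((`|x| + r) / 2)).
- exact: ur.
- exact: (psum_on_diffs ur Kr).
- exact: (psum_on_diffs (psum_on_diffs ur) Kr).
- by rewrite [ltRHS]ger0_norm; lra.
Qed.

Lemma psum0 u : limn (pseries u 0) = u 0%N.
Proof.
apply/cvg_lim => //; rewrite -(cvg_shiftS (pseries u 0)) /=.
rewrite (_ : (fun n => _) = cst (u 0%N)); first exact: cvg_cst.
apply/funext => n; rewrite /pseries /series/= big_nat_recl// expr0 mulr1.
by rewrite big1 ?addr0// => i _; rewrite expr0n mulr0.
Qed.

Lemma derive1n_psum (f : R -> R) a u r : psum_on u r ->
  (forall x, `|x| < r -> f (a + x) = limn (pseries u x)) ->
  forall k x, `|x| < r -> derive1n k f (a + x) = limn (pseries (iter k (@pseries_diffs R) u) x).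
Proof.
move=> ur fu; elim=> [|k IH] x xr; first exact: fu.
rewrite derive1nS derive1E.
have urk : psum_on (iter k (@pseries_diffs R) u) r.
  by elim: k {IH} => [//|k IHk]; exact: psum_on_diffs.
set g := fun x => limn (pseries (iter k (@pseries_diffs R) u) x) in IH *.
have dg := is_derive_psum urk xr.
have dga : is_derive (a + x) (1 : R) (fun s => g (s - a)) (limn (pseries (iter k.+1 (@pseries_diffs R) u) x)).
  have -> : (fun s => g (s - a)) = g \o (fun s => s - a) by [].
  rewrite -[X in is_derive _ _ _ X]mulr1.
  apply: is_derive1_comp; first by rewrite addrC addKr; exact: dg.
  by rewrite -[1 in X in is_derive _ _ _ X]subr0; apply: is_deriveB.
rewrite (@near_eq_derive _ _ _ _ (fun s => g (s - a))); first exact: derive_val.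
near=> s; rewrite -{1}(subrK a s) addrC IH//.
near: s; apply/nbhs_ballP; exists (r - `|x|) => /=; first by rewrite subr_gt0.
move=> s; rewrite /ball/= => h.
have : `|s - a| <= `|s - a - x| + `|x| by rewrite -{1}(subrK x (s - a)) ler_normD.
have -> : `|s - a - x| = `|a + x - s| by rewrite distrC; congr `|_|; ring.
lra.
Unshelve. all: end_near. Qed.

Lemma iter_diffs0 u k : iter k (@pseries_diffs R) u 0%N = k`!%:R * u k.
Proof.
elim: k u => [|k IH] u; first by rewrite mul1r.
by rewrite iterSr IH /pseries_diffs factS natrM mulrA [_`!%:R * _]mulrC.
Qed.

(** From index l on, the partial sums are u 0 plus x^l times those of the shifted series; for x
    nonzero one may divide by x^l to transfer convergence. *)
Lemma psum_factor u r l : psum_on u r ->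
  (forall k, (0 < k < l)%N -> u k = 0) -> (0 < l)%N ->
  forall x, `|x| < r -> x != 0 ->
  cvgn (pseries (fun n => u (n + l)%N) x) /\
  limn (pseries u x) = u 0%N + x ^+ l * limn (pseries (fun n => u (n + l)%N) x).
Proof.
move=> ur u0 l0 x xr x0.
have E n : pseries u x (n + l)%N = u 0%N + x ^+ l * pseries (fun n => u (n + l)%N) x n.
  rewrite /pseries /series /= (@big_cat_nat _ _ _ l) ?leq_addl//=; congr (_ + _).
    case: l l0 u0 => // l _ u0; rewrite big_nat_recl// expr0 mulr1 big_nat big1 ?addr0// => i il.
    by rewrite u0 ?mul0r//; lia.
  rewrite -{1}[l]add0n big_addn addnK big_distrr/=; apply: eq_bigr => i _.
  by rewrite exprD; ring.
have cu : pseries u x (n + l)%N @[n --> \oo] --> limn (pseries u x).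
  by rewrite (cvg_shiftn l (pseries u x)); exact: ur.
have xl : x ^+ l != 0 by rewrite expf_eq0 negb_and x0 orbT.
have cv : pseries (fun n => u (n + l)%N) x @ \oo --> (limn (pseries u x) - u 0%N) / x ^+ l.
  rewrite (_ : pseries (fun n => u (n + l)%N) x = (fun n => (pseries u x (n + l)%N - u 0%N) / x ^+ l)).
    by apply: cvgM; [apply: cvgB => //; exact: cvg_cst|exact: cvg_cst].
  by apply/funext => n; rewrite E addrC addKr mulrC mulKf.
split; first by apply/cvg_ex; eexists; exact: cv.
by rewrite (cvg_lim _ cv)// mulrC divfK// addrC subrK.
Qed.

(** After removing u 0 and factoring out x^l, the remaining series is continuous at 0 with value u
    l. *)
Lemma psum_expansion (f : R -> R) a u r l : 0 < r -> psum_on u r ->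
  (forall x, `|x| < r -> f (a + x) = limn (pseries u x)) ->
  (forall k, (0 < k < l)%N -> u k = 0) -> (0 < l)%N ->
  forall eta, 0 < eta -> exists2 d : R, 0 < d &
    forall x, `|x| < d -> `|f (a + x) - f a - u l * x ^+ l| <= eta * `|x| ^+ l.
Proof.
move=> r0 ur fu u0 l0 eta eta0.
pose v n := u (n + l)%N.
(* The factorization covers only x nonzero; at 0 convergence follows from that at r / 2. *)
have vr : psum_on v r.
  move=> x xr; have [->|x0] := eqVneq x 0.
    have xr2 : `|r / 2| < r by rewrite ger0_norm; lra.
    have r20 : r / 2 != 0 by rewrite lt0r_neq0// divr_gt0.
    have [c _] := psum_factor ur u0 l0 xr2 r20.
    by apply: is_cvg_pseries_inside c _; rewrite normr0 normr_gt0.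
  by have [] := psum_factor ur u0 l0 xr x0.
have fa : f a = u 0%N by rewrite -[a]addr0 fu ?normr0// psum0.
have cg : {for 0, continuous (fun x => limn (pseries v x))}.
  apply: differentiable_continuous; apply/derivable1_diffP.
  have xr : `|0 : R| < r by rewrite normr0.
  by have [] := is_derive_psum vr xr.
move/cvgrPdist_le : cg => /(_ eta eta0) /nbhs_ballP[d /= d0 dv].
exists (Num.min d r); first by rewrite lt_min d0.
move=> x; rewrite lt_min => /andP[xd xr].
have [->|x0] := eqVneq x 0; first by rewrite addr0 subrr normr0 !expr0n gtn_eqF// !mulr0 subr0 normr0.
have [_ E] := psum_factor ur u0 l0 xr x0.
rewrite fu// E fa; set G := limn _.
have -> : u 0%N + x ^+ l * G - u 0%N - u l * x ^+ l = (G - u l) * x ^+ l by ring.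
rewrite normrM normrX ler_wpM2r ?exprn_ge0//.
have := dv x; rewrite /ball/= sub0r normrN psum0 distrC => /(_ xd); exact.
Qed.

Lemma psum_constant (f : R -> R) a u r : psum_on u r ->
  (forall x, `|x| < r -> f (a + x) = limn (pseries u x)) ->
  (forall k, (0 < k)%N -> u k = 0) ->
  forall x, `|x| < r -> f (a + x) = u 0%N.
Proof.
move=> ur fu u0 x xr; rewrite fu//; apply/cvg_lim => //.
rewrite -(cvg_shiftS (pseries u x)).
rewrite (_ : (fun n => _) = cst (u 0%N)); first exact: cvg_cst.
apply/funext => n; rewrite /pseries /series/= big_nat_recl// expr0 mulr1.
by rewrite big1 ?addr0// => i _; rewrite u0// mul0r.
Qed.

End power_series.
(** * Analytic potentials *)

Section analytic_potential.
Context {R : realType}.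
Variable U : circle R -> R.
Hypothesis anU : real_analytic U.
Implicit Types (a s x : R) (c : circle R).

Local Notation V := (fun s : R => U (circle_proj s)).

Lemma analytic_expansion a : exists u r, [/\ 0 < r, psum_on u r &
  forall x, `|x| < r -> U (circle_proj (a + x)) = limn (pseries u x)].
Proof.
have [u /nbhs_ballP[r /= r0 ru]] := anU a.
have H x : `|x| < r -> pseries u x @ \oo --> U (circle_proj (a + x)).
  move=> xr; have := ru (a + x); rewrite /ball/= opprD addrA subrr add0r normrN => /(_ xr).
  by rewrite addrC addKr.
exists u, r; split=> // x xr; first by apply/cvg_ex; eexists; exact: H.
by apply/esym/cvg_lim => //; exact: H.
Qed.

Lemma continuous_lift : continuous V.
Proof.
move=> a; have [u [r [r0 ur fu]]] := analytic_expansion a.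
have xr : `|0 : R| < r by rewrite normr0.
have cg : {for 0, continuous (fun x => limn (pseries u x))}.
  apply: differentiable_continuous; apply/derivable1_diffP.
  by have [] := is_derive_psum ur xr.
apply/cvgrPdist_lt => e e0.
move/cvgrPdist_lt : cg => /(_ e e0) /nbhs_ballP[d /= d0 du].
apply/nbhs_ballP; exists (Num.min d r); first by rewrite /= lt_min d0.
move=> s; rewrite /ball/= lt_min => /andP[sd sr].
have -> : circle_proj s = circle_proj (a + (s - a)) by rewrite addrC subrK.
rewrite -{1}[a]addr0 !fu//; last by rewrite distrC.
by apply: du; rewrite /ball/= sub0r normrN distrC.
Qed.

Lemma continuous_potential : continuous U.
Proof. by apply: circle_liftN_continuous; exact: continuous_lift. Qed.

Lemma measurable_potential : measurable_fun setT U.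
Proof.
apply: (measurability _ (RGenOpens.measurableE R)).
move=> _ [_ [a [b ->] <-]]; rewrite setTI; apply: sub_sigma_algebra.
by move/continuousP: continuous_potential; apply; exact: itv_open.
Qed.

Lemma range_potential_compact : compact (range U).
Proof.
apply: continuous_compact; last exact: circle_compact.
exact/continuous_subspaceT/continuous_potential.
Qed.

Lemma bounded_potential : exists M : R, forall c, `|U c| <= M.
Proof.
have [M [_ HM]] := compact_bounded range_potential_compact.
exists (M + 1) => c; apply: HM; last by exists c.
by rewrite ltrDl.
Qed.

Lemma has_sup_range : has_sup (range U).
Proof.
split; first by exists (U point), point.
have [M HM] := bounded_potential; exists M => _ [c _ <-].
exact: le_trans (ler_norm _) (HM c).
Qed.

Lemma le_max_potential c : U c <= sup (range U).
Proof. by apply: (sup_upper_bound has_sup_range); exists c. Qed.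

Lemma maximizer_exists : exists c, maximizers U c.
Proof.
have [||c _ cmax] := @compact_EVT_max _ _ U setT _ circle_compact.
- by exists point.
- exact/continuous_subspaceT/continuous_potential.
exists c; apply/le_anti; rewrite le_max_potential/=.
apply: ge_sup; first by exists (U point), point.
by move=> _ [t _ <-]; apply: cmax; rewrite inE.
Qed.

(** V (a + x) = V a + w x^l + o(x^l) with w nonzero: the form in which analyticity reaches Laplace's
    method. *)
Definition nonflat a (l : nat) (w : R) := (0 < l)%N /\ w != 0 /\
  forall eta, 0 < eta -> exists2 d : R, 0 < d &
    forall x, `|x| < d -> `|V (a + x) - V a - w * x ^+ l| <= eta * `|x| ^+ l.

(** Either all Taylor coefficients of positive index vanish, or the least index of a nonzero one is
    l. The coefficients are the derivatives divided by factorials. *)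
Lemma local_dichotomy a :
  (exists2 d : R, 0 < d & forall x, `|x| < d -> V (a + x) = V a) \/
  (exists l w, nonflat a l w /\ derive1n l V a = l`!%:R * w /\
     forall k, (0 < k < l)%N -> derive1n k V a = 0).
Proof.
have [u [r [r0 ur fu]]] := analytic_expansion a.
have D k : derive1n k V a = k`!%:R * u k.
  rewrite -[a]addr0 (@derive1n_psum R V a u r ur fu) ?normr0//.
  by rewrite psum0 iter_diffs0.
have [[k /andP[k0 uk]]|no] := pselect (exists k, (0 < k)%N && (u k != 0)).
  right; have [l /andP[l0 ul] lmin] := ex_minnP (ex_intro (fun k => (0 < k)%N && (u k != 0)) k (introT andP (conj k0 uk))).
  have u0 j : (0 < j < l)%N -> u j = 0.
    move=> /andP[j0 jl]; apply/eqP/negPn/negP => uj.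
    by have := lmin j; rewrite j0 uj => /(_ isT); rewrite leqNgt jl.
  exists l, (u l); split; last by split=> // j jl; rewrite D u0// mulr0.
  by split=> //; split=> //; exact: (@psum_expansion R V a u r l r0 ur fu u0 l0).
left; exists r => // x xr.
have u0 k : (0 < k)%N -> u k = 0.
  move=> k0; apply/eqP/negPn/negP => uk; apply: no; exists k; by rewrite k0.
rewrite (@psum_constant R V a u r ur fu u0 x xr).
by rewrite -{1}[a]addr0 (@psum_constant R V a u r ur fu u0) ?normr0.
Qed.

Lemma nonflat_isolated a l w : nonflat a l w ->
  exists2 d : R, 0 < d & forall x, `|x| < d -> x != 0 -> V (a + x) != V a.
Proof.
move=> [l0 [w0 H]]; have w2 : 0 < `|w| / 2 by rewrite divr_gt0// normr_gt0.
have [d d0 Hd] := H _ w2; exists d => // x xd x0; apply/eqP => E.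
have := Hd x xd; rewrite E subrr sub0r normrN normrM normrX ler_pM2r; last first.
  by rewrite exprn_gt0// normr_gt0.
have : 0 < `|w| by rewrite normr_gt0.
lra.
Qed.

Lemma circle_proj_surj c : exists s, circle_proj s = c.
Proof. by exists (csec 0 c); rewrite csecK. Qed.

Hypothesis ncU : ~ (exists a : R, forall t, U t = a).

(** Identity theorem by connectedness: the maximizers around which V is constant form a set that is
    open and closed in the line, and were it nonempty, U would be constant. *)
Lemma maximizer_not_locally_constant a : V a = sup (range U) ->
  ~ (exists2 d : R, 0 < d & forall x, `|x| < d -> V (a + x) = V a).
Proof.
move=> Va La.
pose Z := [set s | V s = sup (range U) /\ exists2 d : R, 0 < d & forall x, `|x| < d -> V (s + x) = V s].
have oZ : open Z.
  rewrite openE => s [Vs [d d0 sd]]; apply/nbhs_ballP; exists (d / 2); first by rewrite /= divr_gt0.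
  move=> t; rewrite /ball/= => st; have std : `|t - s| < d by rewrite distrC; lra.
  have Vt : V t = V s by rewrite -(sd _ std) addrC subrK.
  split; first by rewrite Vt.
  exists (d / 2); first by rewrite divr_gt0.
  move=> x xd; rewrite Vt -(sd (t + x - s)); first by congr (U (circle_proj _)); ring.
  have := ler_normD (t - s) x; rewrite (distrC t s).
  have -> : t + x - s = t - s + x by ring.
  lra.
have cZ : closed Z.
  move=> s clZ.
  have Vs : V s = sup (range U).
    apply/eqP/negPn/negP => Vs.
    have : \forall t \near s, V t != sup (range U).
      have := @continuous_lift s; move=> /cvgrPdist_lt/(_ (Num.norm (V s - sup (range U)))).
      rewrite normr_gt0 subr_eq0 => /(_ Vs); apply: filterS => t h.
      by apply/eqP => Vt; rewrite Vt ltxx in h.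
    by move=> /clZ[t [[Vt _] /eqP]].
  (* A limit point of Z is a maximizer; were it not flat, it would be isolated among the
     maximizers. *)
  split=> //; have [//|[l [w [nf _]]]] := local_dichotomy s.
  have [d d0 iso] := nonflat_isolated nf.
  have [t [Zt]] := clZ _ (nbhsx_ballx s d d0).
  rewrite /ball/= => st; have [E|ts] := eqVneq (t - s) 0.
    by have [_] := Zt; rewrite (_ : t = s)//; apply/eqP; rewrite -subr_eq0 E.
  have := iso (t - s); rewrite distrC => /(_ st ts).
  by rewrite addrC subrK Zt.1 Vs eqxx.
have ZT : Z = setT.
  have : connected [set: R] by apply/connected_intervalP => x y z /=.
  apply; first by exists a; split.
  - by exists Z => //; rewrite setTI.
  - by exists Z => //; rewrite setTI.
apply: ncU; exists (sup (range U)) => c; have [s <-] := circle_proj_surj c.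
have : Z s by rewrite ZT.
by case.
Qed.

(** With an error below half of the leading term, w x^l has the sign of V (a + x) - V a, hence is
    negative for small nonzero x. Taking x = d / 2 gives w < 0, and x = - d / 2 then forces l to be
    even. *)
Lemma nonflat_max a l w : V a = sup (range U) -> nonflat a l w -> ~~ odd l /\ w < 0.
Proof.
move=> Va [l0 [w0 H]]; have w2 : 0 < `|w| / 2 by rewrite divr_gt0// normr_gt0.
have [d d0 Hd] := H _ w2.
have key x : `|x| < d -> x != 0 -> w * x ^+ l < 0.
  move=> xd x0; have := Hd x xd.
  have Vx : V (a + x) - V a <= 0 by rewrite subr_le0 Va le_max_potential.
  have P : 0 < `|w| * `|x| ^+ l by rewrite mulr_gt0 ?exprn_gt0// normr_gt0.
  have N : `|w * x ^+ l| = `|w| * `|x| ^+ l by rewrite normrM normrX.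
  rewrite ler_norml => /andP[h _]; rewrite ltNge; apply/negP => ge.
  by rewrite (ger0_norm ge) in N; rewrite N in h; lra.
have dd : 0 < d / 2 by rewrite divr_gt0.
have xd : `|d / 2| < d by rewrite ger0_norm; lra.
have k1 := key _ xd (lt0r_neq0 dd).
have wn : w < 0 by move: k1; rewrite pmulr_llt0// exprn_gt0.
split=> //; apply/negP => ol.
have xd' : `|- (d / 2)| < d by rewrite normrN.
have := key _ xd'; rewrite oppr_eq0 lt0r_neq0// => /(_ isT).
rewrite exprNn -signr_odd ol expr1 mulN1r mulrN oppr_lt0.
by rewrite pmulr_lgt0 ?exprn_gt0// ltNge (ltW wn).
Qed.

(** The derivatives are computed at [repr c], but the expansion is transferred by periodicity to
    every lift a of c, because the circle will be cut at a point of another choice. *)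
Lemma maximizer_expansion c : maximizers U c ->
  [/\ is_flatness U c (flatness U c), ~~ odd (flatness U c), 0 < omega U c &
    forall a, circle_proj a = c -> forall eta, 0 < eta -> exists2 d : R, 0 < d &
    forall x, `|x| < d ->
    `|V (a + x) - sup (range U) + omega U c * x ^+ flatness U c| <= eta * x ^+ flatness U c].
Proof.
move=> Uc; have rc : circle_proj (repr c) = c by rewrite /circle_proj reprK.
have Va : V (repr c) = sup (range U) by rewrite /= rc.
have [/maximizer_not_locally_constant //|[l [w [nf [Dl Dk]]]]] := local_dichotomy (repr c).
have [ol w0] := nonflat_max Va nf.
have [l0 [wn0 Hw]] := nf.
have fl : is_flatness U c l.
  split=> //; first by rewrite /circle_derive Dl mulf_neq0// pnatr_eq0 -lt0n fact_gt0.
have fE : flatness U c = l.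
  rewrite /flatness; have [f0 f1 f2] := getPex (ex_intro (is_flatness U c) l fl).
  have [g0 g1 g2] := fl; apply/eqP; rewrite eqn_leq.
  apply/andP; split; rewrite leqNgt; apply/negP => h.
    by move: g1; rewrite f2 ?eqxx// g0.
  by move: f1; rewrite g2 ?eqxx// f0.
have wE : omega U c = - w.
  by rewrite /omega fE /circle_derive Dl [_ * w]mulrC mulNr mulfK// pnatr_eq0 -lt0n fact_gt0.
rewrite fE wE; split=> //; first by rewrite oppr_gt0.
move=> a ac eta eta0; have [d d0 Hd] := Hw _ eta0; exists d => // x xd.
have := Hd x xd; rewrite Va mulNr.
have -> : V (repr c + x) = V (a + x) by rewrite /= !circle_projD rc ac.
have -> : `|x| ^+ l = x ^+ l by rewrite -normrX ger0_norm// exprn_even_ge0.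
by [].
Qed.

Lemma maximizer_isolated a : V a = sup (range U) ->
  exists2 d : R, 0 < d & forall x, `|x| < d -> x != 0 -> V (a + x) != sup (range U).
Proof.
move=> Va; have [/maximizer_not_locally_constant //|[l [w [nf _]]]] := local_dichotomy a.
by have [d d0 h] := nonflat_isolated nf; exists d => // x xd x0; rewrite -Va; exact: h.
Qed.

(** Infinitely many lifts in [0, 1) would accumulate at a maximizer, by continuity, and contradict
    its being isolated. *)
Lemma finite_maximizers : finite_set (maximizers U).
Proof.
apply: contrapT => inf.
pose E := [set s : R | 0 <= s < 1 /\ V s = sup (range U)].
have infE : infinite_set E.
  move=> finE; apply: inf; apply: (@sub_finite_set _ _ (@circle_proj R @` E)); last exact: finite_image.
  move=> c Uc; exists (csec 0 c); last exact: csecK.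
  by split; [have := csec_itv 0 c; lra|rewrite /= csecK].
have bE : bounded_set E.
  exists 1; split => // M M1 s [/andP[s0 s1] _] /=.
  by rewrite ger0_norm// ltW// (lt_trans s1).
have [a /limit_point_infinite_setP lim] := infinite_bounded_limit_point_nonempty infE bE.
have Va : V a = sup (range U).
  apply/eqP/negPn/negP => Va.
  have nb : \forall t \near a, V t != sup (range U).
    have := @continuous_lift a; move=> /cvgrPdist_lt/(_ (Num.norm (V a - sup (range U)))).
    rewrite normr_gt0 subr_eq0 => /(_ Va); apply: filterS => t h.
    by apply/eqP => Vt; rewrite Vt ltxx in h.
  have := lim _ nb; apply; rewrite (_ : _ `&` _ = set0)//.
  by apply/seteqP; split=> t //= [/eqP + [_]].
have [d d0 iso] := maximizer_isolated Va.
have := lim _ (nbhsx_ballx a d d0); apply.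
apply: (@sub_finite_set _ _ [set a]) => // t [].
rewrite /ball/= => at_ [_ Vt]; apply/eqP; rewrite -subr_eq0; apply/negPn/negP => ta.
have := iso (t - a); rewrite distrC => /(_ at_ ta).
by rewrite addrC subrK Vt eqxx.
Qed.

End analytic_potential.
(** * Laplace's method *)

Section laplace.
Context {R : realType}.
Local Notation mu := (@lebesgue_measure R).

(** Reduces limits at infinity to sequences, as dominated convergence requires. The lower bound 1
    keeps every inverse temperature positive and costs nothing, since u may be replaced by its
    maximum with 1. *)
Lemma cvg_pinfty_seq_ge1 (f : R -> R) (l : R) :
  (forall u : R^nat, (forall n, 1 <= u n) -> u n @[n --> \oo] --> +oo ->
     f (u n) @[n --> \oo] --> l) ->
  f x @[x --> +oo] --> l.
Proof.
move=> H; apply/cvg_pinftyP => u uoo.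
pose v n := Num.max 1 (u n).
have v1 n : 1 <= v n by rewrite le_max lexx.
have voo : v n @[n --> \oo] --> +oo.
  apply/cvgryPge => A; move/cvgryPge : uoo => /(_ A); apply: filterS => n.
  by rewrite le_max => ->; rewrite orbT.
have := H v v1 voo; apply: cvg_trans; apply: near_eq_cvg.
move/cvgryPge : uoo => /(_ 1); apply: filterS => n u1.
by rewrite /v; congr f; apply/max_idPr.
Qed.

Lemma lebesgue_integral_scale (f : R -> \bar R) (k : R) : 0 < k ->
  measurable_fun setT (f : measurableTypeR R -> _) -> (forall x, 0 <= f x)%E ->
  (\int[mu]_x f x = k%:E * \int[mu]_x f (k * x)%R)%E.
Proof.
move=> k0 mf f0.
have mk : measurable_fun setT (fun x : measurableTypeR R => (k * x : measurableTypeR R)).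
  exact: mulrl_measurable.
pose r : {nonneg R} := NngNum (ltW k0).
pose m1 : {measure set (measurableTypeR R) -> \bar R} :=
  pushforward mu (fun x : measurableTypeR R => (k * x : measurableTypeR R)).
pose m2 : {measure set (measurableTypeR R) -> \bar R} := mscale r (m1 mk).
rewrite (@eq_measure_integral _ (measurableTypeR R) R setT m2).
  by rewrite ge0_integral_mscale// ge0_integral_pushforward.
move=> A mA _; apply: lebesgue_measure_unique => // _ [[x y] _ <-].
transitivity (k%:E * mu (`](x / k)%R, (y / k)%R] : set (measurableTypeR R)))%E.
  rewrite !lebesgue_measure_itv/= !lte_fin ltr_pM2r ?invr_gt0//.
  case: ifPn => _; last by rewrite mule0.
  by rewrite -!EFinB -EFinM -mulrBl mulrC divfK// lt0r_neq0.
congr (_ * _)%E; congr (mu _).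
by apply/seteqP; split=> z/=; rewrite !in_itv/= ltr_pdivrMr// ler_pdivlMr// ![z * k]mulrC.
Qed.

(** For even l >= 2 one has t^2 - 1 <= t^l, so e times a Gaussian dominates. *)
Lemma integrable_expXn (l : nat) (c : R) : (1 < l)%N -> ~~ odd l -> 1 <= c ->
  mu.-integrable setT (fun t => (expR (- (c * t ^+ l)))%:E).
Proof.
move=> l1 ol c1.
have ig : mu.-integrable setT (fun t => (expR 1)%:E * (gauss_fun t)%:E)%E.
  by apply: integrableZl => //; exact: integrableT_gauss.
apply: le_integrable ig => //.
- apply/measurable_EFinP; apply: measurableT_comp; first exact: measurable_expR.
  apply: measurable_funN; apply: measurable_funM; first exact: measurable_cst.
  exact: exprn_measurable.
- move=> t _; rewrite -EFinM !abse_EFin lee_fin !ger0_norm ?expR_ge0//; last first.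
    by rewrite mulr_ge0 ?expR_ge0.
  rewrite /gauss_fun -expRD ler_expR.
  have t2 : t ^+ 2 - 1 <= t ^+ l.
    have [h|h] := leP (t ^+ 2) 1; first by rewrite (@le_trans _ _ 0)// ?subr_le0 ?exprn_even_ge0.
    rewrite (@le_trans _ _ (t ^+ 2))//; first by rewrite gerBl.
    have -> : l = (2 * l./2)%N by rewrite mul2n even_halfK.
    rewrite exprM ler_eXnr ?ltW//.
    by case: l l1 ol => [|[|[|l]]].
  have tl : 0 <= t ^+ l by rewrite exprn_even_ge0.
  have : t ^+ l <= c * t ^+ l by rewrite ler_peMl.
  lra.
Qed.

(** This is the integral of exp (- t^l), written as the scaling of [laplace_local] delivers it:
    there the limit is exp (- 2 t^l), which leaves room for the dominating function exp (- t^l). *)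
Definition laplace_const (l : nat) : R :=
  2 `^ (l%:R^-1) * fine (\int[mu]_t (expR (- (2 * t ^+ l)))%:E)%E.

Lemma laplace_const_gt0 l : (1 < l)%N -> ~~ odd l -> 0 < laplace_const l.
Proof.
move=> l1 ol; rewrite /laplace_const mulr_gt0 ?powR_gt0//.
have ig := @integrable_expXn l 2 l1 ol _.
have fn : (\int[mu]_t (expR (- (2 * t ^+ l)))%:E)%E \is a fin_num.
  by apply: integrable_fin_num => //; apply: ig; rewrite ler1n.
rewrite -lte_fin fineK//.
apply: (@lt_le_trans _ _ (\int[mu]_(t in `[0%R, 1%R]) (expR (- 2))%:E)%E).
  have m01 : mu (`[0, 1] : set (measurableTypeR R)) = 1%E.
    by rewrite lebesgue_measure_itv/= lte_fin ltr01 -EFinB subr0.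
  by rewrite integral_cst// [X in (_ * X)%E]m01 mule1 lte_fin expR_gt0.
have mf : measurable_fun setT (fun t : measurableTypeR R => (expR (- (2 * t ^+ l)))%:E).
  by apply: (measurable_int mu); apply: ig; rewrite ler1n.
apply: (@le_trans _ _ (\int[mu]_(t in `[0%R, 1%R]) (expR (- (2 * t ^+ l)))%:E)%E).
  apply: ge0_le_integral => //.
  - exact: measurable_funTS.
  - move=> t; rewrite /= in_itv/= => /andP[t0 t1]; rewrite lee_fin ler_expR lerN2.
    by rewrite ger_pMr// exprn_ile1.
exact: ge0_subset_integral.
Qed.

Section local.
Variables (W : R -> R) (c w : R) (l : nat).
Hypotheses (cW : continuous W) (w0 : 0 < w) (l1 : (1 < l)%N) (ol : ~~ odd l).
Hypothesis Wexp : forall eta, 0 < eta -> exists2 d : R, 0 < d &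
  forall x, `|x| < d -> `|W (c + x) + w * x ^+ l| <= eta * x ^+ l.

Definition laplace_int (b x y : R) : R := \int[mu]_(s in `[x, y]) expR (b * W s).

Lemma continuous_expW b : continuous (fun s => expR (b * W s)).
Proof.
move=> s; apply: (@continuous_comp _ _ _ (fun s => b * W s) expR); last exact: continuous_expR.
by apply: continuousM; [exact: cvg_cst|exact: cW].
Qed.

Lemma measurable_expW b : measurable_fun setT (fun s : measurableTypeR R => expR (b * W s)).
Proof. by apply: continuous_measurable_fun; exact: continuous_expW. Qed.

Lemma integrable_expW b x y : mu.-integrable `[x, y] (fun s => (expR (b * W s))%:E).
Proof.
apply: continuous_compact_integrable; first exact: segment_compact.
by apply: continuous_subspaceT; exact: continuous_expW.
Qed.

Lemma laplace_intE b x y :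
  (\int[mu]_(s in `[x, y]) (expR (b * W s))%:E)%E = (laplace_int b x y)%:E.
Proof.
rewrite /laplace_int /Rintegral fineK//; apply: integrable_fin_num => //.
exact: integrable_expW.
Qed.

(* Substituting s = c + t / k with k ^ l = b w / 2 turns the integrand into a function dominated by exp (- t ^ l). *)
Lemma laplace_local : exists2 d0 : R, 0 < d0 & forall d, 0 < d -> d < d0 ->
  (b `^ (l%:R^-1) * laplace_int b (c - d) (c + d)) @[b --> +oo] -->
  w `^ (- l%:R^-1) * laplace_const l.
Proof.
have w2 : 0 < w / 2 by rewrite divr_gt0.
have [d0 d00 Hd0] := Wexp w2.
exists d0 => // d dpos dd0; apply: cvg_pinfty_seq_ge1 => u u1 uoo.
have u0 n : 0 < u n by rewrite (lt_le_trans _ (u1 n)).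
have l0 : (l%:R : R) != 0 by rewrite pnatr_eq0 -lt0n ltnW.
pose k n := (u n * (w / 2)) `^ (l%:R^-1).
have k0 n : 0 < k n by rewrite powR_gt0// mulr_gt0.
have kl n : k n ^+ l = u n * (w / 2).
  rewrite -powR_mulrn ?ltW// -powRrM mulVf// powRr1// ltW// mulr_gt0//.
pose h n (t : R) := (\1_(`[- d, d]%classic) (t / k n) * expR (u n * W (c + t / k n)))%:E.
have mh n : measurable_fun setT (h n : measurableTypeR R -> _).
  apply/measurable_EFinP; apply: measurable_funM.
    apply: (measurableT_comp (@measurable_indic _ _ _ setT `[- d, d]%classic _)) => //.
    exact: mulrr_measurable.
  apply: (measurableT_comp (measurable_expW (u n))).
  by apply: measurable_funD => //; exact: mulrr_measurable.
have hE n : (\int[mu]_t h n t = (k n * laplace_int (u n) (c - d) (c + d))%:E)%E.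
  rewrite (lebesgue_integral_scale (k0 n))//; last first.
    by move=> t; rewrite lee_fin mulr_ge0// ?expR_ge0// indicE.
  rewrite EFinM -laplace_intE; congr (_ * _)%E.
  have mW : measurable_fun setT (fun x : measurableTypeR R => (expR (u n * W x))%:E).
    by apply/measurable_EFinP; exact: measurable_expW.
  rewrite [RHS](@lebesgue_integral_shift _ (fun x => (expR (u n * W x))%:E) c)//.
  rewrite [RHS]integral_mkcond; apply: eq_integral => t _.
  rewrite /h patchE mulrAC mulfV ?lt0r_neq0// mul1r indicE addrC.
  have -> : (t \in [set x | `[c - d, c + d]%classic (x + c)]) = (t \in `[- d, d]%classic).
    by apply/idP/idP; rewrite !inE/= !in_itv/=; lra.
  by case: ifP => _; rewrite ?mul1r ?mul0r.
have tx n (t : R) : u n * (w / 2) * (t / k n) ^+ l = t ^+ l.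
  by rewrite -kl -exprMn mulrCA mulfV ?mulr1// lt0r_neq0.
have tl0 (t : R) : 0 <= t ^+ l by rewrite exprn_even_ge0.
have knear A : \forall n \near \oo, A < k n.
  move/cvgryPgt : uoo => /(_ ((Num.max A 0) ^+ l / (w / 2))); apply: filterS => n.
  rewrite ltr_pdivrMr// -kl => h1.
  have A0 : 0 <= Num.max A 0 by rewrite le_max lexx orbT.
  apply: (@le_lt_trans _ _ (Num.max A 0)); first by rewrite le_max lexx.
  rewrite ltNge; apply/negP => h2; move: h1; rewrite ltNge => /negP; apply.
  by rewrite lerXn2r// nnegrE ltW.
have xnear t e : 0 < e -> \forall n \near \oo, `|t / k n| < e.
  move=> e0; have := knear (`|t| / e); apply: filterS => n.
  by rewrite normrM normfV (gtr0_norm (k0 n)) ltr_pdivrMr// mulrC => ?; rewrite ltr_pdivrMr// mulrC.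
have hlim t : h n t @[n --> \oo] --> (expR (- (2 * t ^+ l)))%:E.
  apply: cvg_EFin; first by near=> n.
  have ylim : u n * W (c + t / k n) @[n --> \oo] --> - (2 * t ^+ l).
    apply/cvgrPdist_le => e e0.
    have t1 : 0 < t ^+ l + 1 by rewrite ltr_wpDl.
    (* After rescaling, the error eta x^l becomes eta / (w / 2) times t^l, which this choice keeps
       below e. *)
    pose eta := e * (w / 2) / (t ^+ l + 1).
    have eta0 : 0 < eta by rewrite divr_gt0// mulr_gt0.
    have [d' d'0 Hd'] := Wexp eta0.
    have := xnear t d' d'0; apply: filterS => n xn.
    have := Hd' _ xn; rewrite -(ler_pM2l (u0 n)) -{1}(gtr0_norm (u0 n)) -normrM => h1.
    have E1 : u n * (W (c + t / k n) + w * (t / k n) ^+ l) = u n * W (c + t / k n) + 2 * t ^+ l.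
      by rewrite -(tx n t); field.
    rewrite E1 in h1; rewrite -normrN opprB opprK; apply: (le_trans h1).
    have -> : u n * (eta * (t / k n) ^+ l) = eta / (w / 2) * t ^+ l.
      by rewrite -(tx n t); field; rewrite lt0r_neq0.
    have -> : eta / (w / 2) = e / (t ^+ l + 1).
      by rewrite /eta; field; rewrite !lt0r_neq0.
    by rewrite mulrAC ler_pdivrMr// ler_pM2l// lerDl.
  have elim : expR (u n * W (c + t / k n)) @[n --> \oo] --> expR (- (2 * t ^+ l)).
    by apply: (cvg_comp _ _ ylim); exact: continuous_expR.
  apply: cvg_trans elim; apply: near_eq_cvg.
  have := xnear t d dpos; apply: filterS => n xn.
  rewrite /h /= indicE mem_set ?mul1r//= in_itv/=.
  by move: xn; rewrite ltr_norml => /andP[/ltW -> /ltW ->].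
(* [d0] was taken for the error w / 2, so W (c + x) <= - (w / 2) x^l on the support, and the scaling
   turns this into - t^l. *)
have hdom n t : (`|h n t| <= (expR (- (1 * t ^+ l)))%:E)%E.
  rewrite /h abse_EFin lee_fin indicE; case: (boolP (_ \in _)) => xd; last first.
    by rewrite mul0r normr0 expR_ge0.
  rewrite !mul1r ger0_norm ?expR_ge0// ler_expR.
  have xd0 : `|t / k n| < d0.
    by apply: le_lt_trans dd0; rewrite ler_norml; move: xd; rewrite inE/= in_itv.
  have := Hd0 _ xd0; rewrite ler_norml => /andP[_].
  have := tx n t; move: (W _) ((t / k n) ^+ l) (t ^+ l) => y x T txT h1.
  have : u n * (y + w * x) <= u n * (w / 2 * x) by rewrite ler_pM2l.
  rewrite -txT; lra.
have ig2 := @integrable_expXn l 2 l1 ol (ler1n R 2%N : is_true (1 <= 2)).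
have lim : (\int[mu]_t h n t)%E @[n --> \oo] --> (\int[mu]_t (expR (- (2 * t ^+ l)))%:E)%E.
  have [] // := @dominated_convergence _ _ R mu setT measurableT h
    (fun t => (expR (- (2 * t ^+ l)))%:E) (fun t => (expR (- (1 * t ^+ l)))%:E) mh.
  - exact: (measurable_int mu ig2).
  - by apply: aeW => t _; exact: hlim.
  - exact: integrable_expXn.
  - by apply: aeW => t n _; exact: hdom.
have fn : (\int[mu]_t (expR (- (2 * t ^+ l)))%:E)%E \is a fin_num by exact: integrable_fin_num.
rewrite -(fineK fn) in lim; move/fine_cvg : lim => lim.
have E2 n : u n `^ (l%:R^-1) * laplace_int (u n) (c - d) (c + d) =
    (w / 2) `^ (- l%:R^-1) * (fine (\int[mu]_t h n t)%E).
  have -> : fine (\int[mu]_t h n t)%E = k n * laplace_int (u n) (c - d) (c + d) by rewrite hE.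
  have -> : k n = u n `^ (l%:R^-1) * (w / 2) `^ (l%:R^-1) by rewrite /k powRM// ltW.
  have wp : (w / 2) `^ (l%:R^-1) != 0 by rewrite lt0r_neq0// powR_gt0.
  rewrite powRN; move: ((w / 2) `^ _) wp (u n `^ _) (laplace_int _ _ _) => y y0 z j.
  by field.
under eq_fun do rewrite E2.
rewrite /laplace_const mulrA.
have -> : w `^ (- l%:R^-1) * 2 `^ l%:R^-1 = (w / 2) `^ (- l%:R^-1).
  rewrite !powRN; have -> : w = w / 2 * 2 by rewrite divfK.
  have p2 : (2 : R) `^ (l%:R^-1) != 0 by rewrite lt0r_neq0// powR_gt0.
  by rewrite mulfK// powRM ?(ltW w2)// invfM -mulrA mulVf// mulr1.
by apply: cvgM; [exact: cvg_cst|exact: lim].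
Unshelve. all: end_near. Qed.

End local.
End laplace.

(** * Laplace's method on an interval with several maxima *)

Section laplace_global.
Context {R : realType}.
Local Notation mu := (@lebesgue_measure R).
Variables (W : R -> R) (zs : seq R) (ls : R -> nat) (ws : R -> R) (A0 B0 : R) (L : nat).
Hypotheses (cW : continuous W) (W0 : forall x, W x <= 0) (uzs : uniq zs).
Hypothesis zsP : forall x, A0 <= x <= B0 -> W x = 0 -> x \in zs.
Hypothesis lsP : forall z, z \in zs -> [/\ (1 < ls z)%N, ~~ odd (ls z), (ls z <= L)%N & 0 < ws z].
Hypothesis Wexp : forall z, z \in zs -> forall eta, 0 < eta -> exists2 d : R, 0 < d &
  forall x, `|x| < d -> `|W (z + x) + ws z * x ^+ ls z| <= eta * x ^+ ls z.
Hypothesis L1 : (1 < L)%N.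

Local Notation J := (laplace_int W).

(** Contribution of the zero z at the scale b^(1/L); a zero of order below L is too sharp to
    count. *)
Definition laplace_mass z : R :=
  if ls z == L then ws z `^ (- L%:R^-1) * laplace_const L else 0.

Lemma laplace_int_ge0 b x y : 0 <= J b x y.
Proof. by apply: Rintegral_ge0 => s _; exact: expR_ge0. Qed.

Lemma laplace_intD b x y z : x <= y -> y <= z -> J b x z = J b x y + J b y z.
Proof.
move=> xy yz; apply: EFin_inj; rewrite EFinD -!laplace_intE//.
rewrite -(integral_itv_obnd_cbnd (r := y)); last first.
  by apply/measurable_EFinP/measurable_funTS; exact: measurable_expW.
rewrite -ge0_integral_setU//.
- by rewrite -itv_bndbnd_setU ?bnd_simp.
- by apply/measurable_EFinP/measurable_funTS; exact: measurable_expW.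
- by apply/disj_setPS => s [] /=; rewrite !in_itv/=; lra.
Qed.

Lemma laplace_int_le b x y c : 0 <= b -> x <= y -> (forall s, s \in `[x, y] -> W s <= c) ->
  J b x y <= expR (b * c) * (y - x).
Proof.
move=> b0 xy Wc; rewrite -lee_fin -laplace_intE//.
have mxy : mu (`[x, y] : set (measurableTypeR R)) = (y - x)%:E.
  rewrite lebesgue_measure_itv/= lte_fin; case: ltP => h; first by rewrite EFinB.
  by have -> : x = y by [apply/le_anti; rewrite xy]; rewrite subrr.
rewrite EFinM -mxy -integral_cst//; apply: ge0_le_integral => //.
- by apply/measurable_EFinP/measurable_funTS; exact: measurable_expW.
- by move=> s sxy; rewrite lee_fin ler_expR ler_wpM2l// Wc.
Qed.

Lemma powR_le_id (b : R) : 1 <= b -> b `^ (L%:R^-1) <= b.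
Proof.
move=> b1; rewrite -[leRHS]powRr1; last by rewrite (le_trans _ b1).
by apply: ler_powR => //; rewrite invf_le1 ?ltr0n ?ler1n ltnW.
Qed.

(** On a compact interval without zeros W stays below some - m < 0, and exponential decay beats the
    factor b^(1/L). *)
Lemma laplace_nonmax x y : A0 <= x -> x <= y -> y <= B0 ->
  (forall z, z \in zs -> ~~ (x <= z <= y)) ->
  b `^ (L%:R^-1) * J b x y @[b --> (+oo : set_system R)] --> (0 : R).
Proof.
move=> Ax xy yB nz.
have [c cxy cmax] := @EVT_max R W x y xy (continuous_subspaceT cW).
rewrite in_itv/= in cxy.
have Wc : W c < 0.
  rewrite lt_neqAle W0 andbT; apply/eqP => Wc.
  have := nz c; rewrite cxy => /(_ _)/negP; apply; last by [].
  by apply: zsP => //; lra.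
pose m := - W c; have m0 : 0 < m by rewrite oppr_gt0.
have JB b : 0 <= b -> J b x y <= expR (- (b * m)) * (y - x).
  move=> b0; by rewrite /m mulrN opprK; exact: laplace_int_le.
apply/cvgrPdist_le => e e0.
(* From exp (- t) <= 4 / t^2 at t = b m, and b^(1/L) <= b, the quantity is at most C / b. *)
pose C := 4 * (y - x) / m ^+ 2.
have C0 : 0 <= C by apply: divr_ge0; [apply: mulr_ge0 => //; rewrite subr_ge0|rewrite exprn_ge0// ltW].
near=> b.
have b1 : 1 <= b by near: b; exact: nbhs_pinfty_ge.
have bC : C / e <= b by near: b; apply: nbhs_pinfty_ge; rewrite num_real.
have b0 : 0 < b by rewrite (lt_le_trans _ b1).
rewrite sub0r normrN ger0_norm; last by rewrite mulr_ge0 ?powR_ge0// laplace_int_ge0.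
have h1 : b `^ (L%:R^-1) * J b x y <= b * (expR (- (b * m)) * (y - x)).
  by apply: ler_pM; rewrite ?powR_ge0 ?laplace_int_ge0 ?powR_le_id ?JB// ltW.
apply: (le_trans h1).
have bm : 0 < b * m by rewrite mulr_gt0.
have h2 : expR (- (b * m)) <= 4 / (b * m) ^+ 2.
  have h3 : b * m / 2 <= expR (b * m / 2).
    by apply: le_trans (expR_ge1Dx _); rewrite lerDr.
  rewrite expRN -[leLHS]div1r ler_pdivrMr ?expR_gt0// mulrAC ler_pdivlMr ?exprn_gt0// mul1r.
  have -> : expR (b * m) = expR (b * m / 2) ^+ 2.
    by rewrite expr2 -expRD; congr expR; field.
  have : (b * m / 2) ^+ 2 <= expR (b * m / 2) ^+ 2.
    by rewrite ler_pXn2r ?nnegrE ?expR_ge0// divr_ge0// ltW.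
  by rewrite expr_div_n; lra.
apply: (@le_trans _ _ (b * (4 / (b * m) ^+ 2 * (y - x)))).
  by rewrite ler_pM2l// ler_wpM2r// subr_ge0.
have -> : b * (4 / (b * m) ^+ 2 * (y - x)) = C / b.
  by rewrite /C; field; rewrite !lt0r_neq0.
by rewrite ler_pdivrMr// mulrC -ler_pdivrMr.
Unshelve. all: end_near. Qed.

Lemma powRN_cvg0 (r : R) : 0 < r -> b `^ (- r) @[b --> +oo] --> (0 : R).
Proof.
move=> r0; apply/cvgrPdist_le => e e0; near=> b.
have b1 : e^-1 `^ (r^-1) <= b by near: b; apply: nbhs_pinfty_ge; rewrite num_real.
rewrite sub0r normrN ger0_norm ?powR_ge0// powRN.
have e1 : e^-1 <= b `^ r.
  have -> : e^-1 = (e^-1 `^ (r^-1)) `^ r.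
    by rewrite -powRrM mulVf ?gt_eqF// powRr1// invr_ge0 ltW.
  have b0 : 0 <= b by apply: le_trans b1; exact: powR_ge0.
  by apply: ge0_ler_powR => //; [exact: ltW|rewrite nnegrE powR_ge0].
have bp : 0 < b `^ r by rewrite (lt_le_trans _ e1)// invr_gt0.
by rewrite -[e]invrK lef_pV2// posrE invr_gt0.
Unshelve. all: end_near. Qed.

(** If the order l of z is below L, the convergent local quantity is multiplied by a negative power
    of b, with exponent 1/L - 1/l. *)
Lemma laplace_at z : z \in zs -> exists2 d0 : R, 0 < d0 & forall d, 0 < d -> d < d0 ->
  b `^ (L%:R^-1) * J b (z - d) (z + d) @[b --> +oo] --> laplace_mass z.
Proof.
move=> zz; have [l1 ol lL w0] := lsP zz.
have [d0 d00 Hd] := laplace_local cW w0 l1 ol (Wexp zz).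
exists d0 => // d d1 d2; have := Hd d d1 d2; rewrite /laplace_mass.
have [->//|lne] := eqVneq (ls z) L.
move=> H; pose r : R := (ls z)%:R^-1 - L%:R^-1.
have r0 : 0 < r.
  by rewrite subr_gt0 ltf_pV2 ?posrE ?ltr0n// ?ltr_nat; [rewrite ltn_neqAle lne|lia..].
have H2 : b `^ (- r) * (b `^ ((ls z)%:R^-1) * J b (z - d) (z + d)) @[b --> +oo] --> (0 : R).
  rewrite -(mul0r (ws z `^ (- (ls z)%:R^-1) * laplace_const (ls z))).
  by apply: cvgM => //; exact: powRN_cvg0.
apply: cvg_trans H2; apply: near_eq_cvg; near=> b.
have b0 : 0 < b by near: b; exact: nbhs_pinfty_gt.
rewrite mulrA -powRD; last by rewrite (gt_eqF b0) implybT.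
by rewrite /r opprB subrK.
Unshelve. all: end_near. Qed.

(** Induction on the number of zeros inside: a small interval around one of them is cut out, and
    each of the two remaining pieces contains fewer. The endpoints of every piece must avoid the
    zeros. *)
Lemma laplace_global_count n x y : A0 <= x -> x <= y -> y <= B0 -> x \notin zs -> y \notin zs ->
  (\sum_(z <- zs) (x < z < y)%R <= n)%N ->
  b `^ (L%:R^-1) * J b x y @[b --> +oo] -->
  \sum_(z <- zs) (if x < z < y then laplace_mass z else 0).
Proof.
elim: n x y => [|n IH] x y Ax xy yB xz yz.
  rewrite leqn0 sum_nat_seq_eq0 => /allP nz.
  have nz' z : z \in zs -> (x < z < y) = false.
    by move=> zz; have := nz z zz; rewrite /= eqb0 => /negbTE.
  rewrite big_seq big1 => [|z /nz' ->//].
  apply: laplace_nonmax => // z zz; apply/negP => /andP[xlez zley].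
  have := nz' z zz; rewrite !lt_neqAle xlez zley !andbT => /negP; apply.
  by apply/andP; split; apply/eqP => E; [move: xz; rewrite E zz|move: yz; rewrite -E zz].
move=> cn; have [[z0 /andP[zz0 /andP[xz0 zy0]]]|no] := pselect (exists z0, (z0 \in zs) && (x < z0 < y)); last first.
  apply: IH => //; rewrite big_seq big1// => z zz.
  by apply/eqP; rewrite eqb0; apply/negP => h; apply: no; exists z; rewrite zz h.
have [d0 d00 Hd0] := laplace_at zz0.
have [d1 d10 Hd1] : exists2 d1 : R, 0 < d1 & forall z, z \in zs -> z != z0 -> d1 < `|z - z0|.
  elim: (zs) => [|z s [d1 d10 Hs]]; first by exists 1.
  have [->|ne] := eqVneq z z0.
    by exists d1 => // z'; rewrite inE => /orP[/eqP ->|zs']; [rewrite eqxx|exact: Hs].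
  have p : 0 < `|z - z0| by rewrite normr_gt0 subr_eq0.
  exists (Num.min d1 (`|z - z0| / 2)); first by rewrite lt_min d10 divr_gt0.
  move=> z'; rewrite inE => /orP[/eqP -> _|zs' ne'].
    by rewrite gt_min; apply/orP; right; lra.
  by rewrite gt_min (Hs z' zs' ne').
(* Half of this bound is within the range of the local estimate, separates z0 from the other zeros,
   and stays inside (x, y). *)
pose m := Num.min (Num.min d0 d1) (Num.min (z0 - x) (y - z0)).
have m0 : 0 < m by rewrite !lt_min d00 d10 !subr_gt0 xz0 zy0.
pose d := m / 2; have dpos : 0 < d by rewrite divr_gt0.
have dm : d < m by rewrite /d; lra.
move: dm; rewrite !lt_min => /andP[/andP[dd0 dd1] /andP[dx dy]].
have notz z : z \in zs -> z != z0 -> (z < z0 - d) || (z0 + d < z).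
  move=> zz ne; have := Hd1 z zz ne; rewrite ltr_normr.
  by move=> /orP[h|h]; apply/orP; [right|left]; lra.
have e1 : z0 - d \notin zs.
  apply/negP => h; have ne : z0 - d != z0 by rewrite lt_eqF// gtrBl.
  by have := notz _ h ne; lra.
have e2 : z0 + d \notin zs.
  apply/negP => h; have ne : z0 + d != z0 by rewrite gt_eqF// ltrDl.
  by have := notz _ h ne; lra.
have dec z : z \in zs -> nat_of_bool (x < z < y) = ((x < z < z0 - d)%R + (z == z0) + (z0 + d < z < y)%R)%N.
  move=> zz; have [->|ne] := eqVneq z z0.
    have -> : (z0 < z0 - d) = false by apply/negbTE; rewrite -leNgt gerBl ltW.
    have -> : (z0 + d < z0) = false by apply/negbTE; rewrite -leNgt lerDl ltW.
    by rewrite xz0 zy0 andbF.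
  have /orP[h|h] := notz z zz ne.
    have -> : z < y by lra.
    have -> : (z0 + d < z) = false by apply/negbTE; rewrite -leNgt; lra.
    by rewrite h !andbT/= !addn0.
  have -> : x < z by lra.
  have -> : (z < z0 - d) = false by apply/negbTE; rewrite -leNgt; lra.
  by rewrite h andbF /= !add0n.
have mid : (\sum_(z <- zs) (z == z0) = 1)%N.
  rewrite (bigD1_seq z0)//= eqxx big1 ?addn0// => z /negbTE ->//.
have cnt : (\sum_(z <- zs) (x < z < y)%R = \sum_(z <- zs) (x < z < z0 - d)%R + 1 +
    \sum_(z <- zs) (z0 + d < z < y)%R)%N.
  by rewrite -mid -!big_split/= big_seq [RHS]big_seq; apply: eq_bigr => z zz; exact: dec.
have sumE : \sum_(z <- zs) (if x < z < y then laplace_mass z else 0) =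
   \sum_(z <- zs) (if x < z < z0 - d then laplace_mass z else 0) + laplace_mass z0 +
   \sum_(z <- zs) (if z0 + d < z < y then laplace_mass z else 0).
  have -> : laplace_mass z0 = \sum_(z <- zs) (if z == z0 then laplace_mass z else 0).
    by rewrite (bigD1_seq z0)//= eqxx big1 ?addr0// => z /negbTE ->//.
  rewrite -!big_split/= big_seq [RHS]big_seq; apply: eq_bigr => z zz.
  have := dec z zz; case: (x < z < y); case: (x < z < z0 - d); case: (z == z0); case: (z0 + d < z < y) => //= _;
    by rewrite ?addr0 ?add0r.
rewrite sumE.
have JE b : b `^ (L%:R^-1) * J b x y = b `^ (L%:R^-1) * J b x (z0 - d) +
    b `^ (L%:R^-1) * J b (z0 - d) (z0 + d) + b `^ (L%:R^-1) * J b (z0 + d) y.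
  rewrite -!mulrDr; congr (_ * _).
  rewrite (@laplace_intD b x (z0 - d) y); [|lra|lra].
  by rewrite (@laplace_intD b (z0 - d) (z0 + d) y) ?addrA; [|lra|lra].
under eq_fun do rewrite JE.
have [n1 n2] : ((\sum_(z <- zs) (x < z < z0 - d)%R <= n) /\
    (\sum_(z <- zs) (z0 + d < z < y)%R <= n))%N.
  by move: cn; rewrite cnt addn1 addSn ltnS => h; split; apply: leq_trans h; rewrite ?leq_addr ?leq_addl.
apply: cvgD; first apply: cvgD.
- apply: IH n1 => //; first lra.
  by lra.
- exact: Hd0.
- apply: IH n2 => //; first lra.
  by lra.
Unshelve. all: end_near. Qed.

Lemma laplace_global x y : A0 <= x -> x <= y -> y <= B0 -> x \notin zs -> y \notin zs ->
  b `^ (L%:R^-1) * J b x y @[b --> +oo] -->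
  \sum_(z <- zs) (if x < z < y then laplace_mass z else 0).
Proof. by move=> *; exact: laplace_global_count. Qed.

End laplace_global.
(** * Quantile coupling *)

Section circle_cdf.
Context {R : realType}.
Variable s0 : R.

Definition circle_cdf (m : set (circle R) -> \bar R) s : R :=
  fine (m [set c | csec s0 c <= s]).

Lemma measurable_csec_le s : measurable [set c : circle R | csec s0 c <= s].
Proof.
rewrite (_ : [set _ | _] = setT `&` csec s0 @^-1` `]-oo, s]); last first.
  by rewrite setTI; apply/seteqP; split=> c /=; rewrite in_itv.
exact: measurable_csec.
Qed.

Section cdf.
Variable nu : probability (circle R) R.
Local Notation G := (circle_cdf nu).

Lemma circle_cdfE s : nu [set c | csec s0 c <= s] = (G s)%:E.
Proof. by rewrite fineK// fin_num_measure//; exact: measurable_csec_le. Qed.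

Lemma circle_cdf_ge0 s : 0 <= G s.
Proof. by rewrite -lee_fin -circle_cdfE. Qed.

Lemma circle_cdf_le1 s : G s <= 1.
Proof. by rewrite -lee_fin -circle_cdfE probability_le1//; exact: measurable_csec_le. Qed.

Lemma circle_cdf_nondecreasing s t : s <= t -> G s <= G t.
Proof.
move=> st; rewrite -lee_fin -!circle_cdfE le_measure ?inE//; try exact: measurable_csec_le.
by move=> c /= /le_trans; apply.
Qed.

Lemma circle_cdf_lt s : s < s0 -> G s = 0.
Proof.
move=> ss; rewrite /circle_cdf (_ : [set _ | _] = set0) ?measure0//.
by apply/seteqP; split=> c //=; have := csec_itv s0 c; lra.
Qed.

Lemma circle_cdf_eq1 s : s0 + 1 <= s -> G s = 1.
Proof.
move=> ss; rewrite /circle_cdf (_ : [set _ | _] = setT) ?probability_setT//.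
by apply/seteqP; split=> c //= _; have := csec_itv s0 c; lra.
Qed.

(** Right continuity, from continuity of the measure from above along s + 1 / (n + 1). *)
Lemma circle_cdf_right s u : G s < u -> exists2 d : R, 0 < d & G (s + d) < u.
Proof.
move=> Gu; pose F n := [set c : circle R | csec s0 c <= s + n.+1%:R^-1].
have mF n : measurable (F n) by exact: measurable_csec_le.
have FI : \bigcap_n F n = [set c | csec s0 c <= s].
  apply/seteqP; split=> c /=; last first.
    by move=> cs n _; rewrite /F/= (le_trans cs)// lerDl invr_ge0.
  move=> h; rewrite leNgt; apply/negP => sc.
  have [n hn] := ltr_add_invr sc.
  by have := le_lt_trans (h n I) hn; rewrite ltxx.
have : (nu (F n) @[n --> \oo] --> nu (\bigcap_n F n))%E.
  apply: nonincreasing_cvg_mu => //.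
  - by rewrite -ge0_fin_numE// fin_num_measure.
  - by rewrite FI; exact: measurable_csec_le.
  - move=> m n mn; apply/subsetPset => c /= /le_trans; apply.
    by rewrite lerD2l lef_pV2 ?posrE// ler_nat.
rewrite FI circle_cdfE.
under eq_fun do rewrite circle_cdfE.
move=> /fine_cvgP[_] /cvgr_lt /(_ _ Gu)[N _ hN].
by exists (N.+1%:R^-1) => //; exact: (hN N (leqnn N)).
Qed.

(** Without the bound s0 <= s the set would be unbounded below at u = 0 for a distribution function,
    and its infimum meaningless. *)
Definition quantile (H : R -> R) u : R := inf [set s | s0 <= s /\ u <= H s].

(** Galois connection between quantile and distribution function; right continuity is what makes the
    infimum attained. *)
Lemma quantile_le u s : u <= 1 -> (quantile G u <= s) = (s0 <= s) && (u <= G s).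
Proof.
move=> u1; pose S := [set s | s0 <= s /\ u <= G s].
have hS : has_inf S.
  split; last by exists s0 => t [].
  by exists (s0 + 1); split; [rewrite lerDl|rewrite circle_cdf_eq1].
have qs0 : s0 <= quantile G u by apply: lb_le_inf; [exact: hS.1|move=> t []].
apply/idP/andP => [qs|[ss us]]; last by apply: ge_inf; [exact: hS.2|].
split; first exact: le_trans qs.
rewrite leNgt; apply/negP => /circle_cdf_right[d d0 hd].
have qd : quantile G u < s + d by rewrite (le_lt_trans qs)// ltrDl.
have [t [_ ut]] := inf_lt hS.1 qd.
by move=> /ltW /circle_cdf_nondecreasing tsd; have := le_trans ut tsd; lra.
Qed.

End cdf.

Section transport.
Variables (mu : probability (circle R) R) (K : R).
Local Notation F := (circle_cdf mu).
Hypothesis FK : forall s t, s <= t -> F t - F s <= K * (t - s).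

Definition uniformize (c : circle R) : R := F (csec s0 c).

Lemma uniformize_itv c : 0 <= uniformize c <= 1.
Proof. by rewrite circle_cdf_ge0 circle_cdf_le1. Qed.

Lemma continuous_cdf : continuous F.
Proof.
move=> s; apply/cvgrPdist_le => e e0; near=> t.
(* A Lipschitz constant that is certainly positive, so that one can divide by it. *)
have K1 : 0 < `|K| + 1 by rewrite ltr_wpDl.
have ts : `|s - t| <= e / (`|K| + 1).
  by near: t; apply: (@cvgr_dist_le _ _ _ _ _ id) => //; rewrite divr_gt0.
have hK a b : a <= b -> `|F a - F b| <= (`|K| + 1) * `|a - b|.
  move=> ab; rewrite distrC ger0_norm ?subr_ge0 ?circle_cdf_nondecreasing//.
  rewrite (le_trans (FK ab))// distrC (ger0_norm (_ : 0 <= b - a)) ?subr_ge0//.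
  by rewrite ler_wpM2r ?subr_ge0// (le_trans (ler_norm K))// lerDl.
apply: (@le_trans _ _ ((`|K| + 1) * `|s - t|)).
  have [st|/ltW ts'] := leP s t; first exact: hK.
  by rewrite distrC (distrC s); exact: hK.
by rewrite mulrC -ler_pdivlMr.
Unshelve. all: end_near. Qed.

Lemma cdf_attains u : 0 <= u <= 1 -> exists s, F s = u.
Proof.
move=> /andP[u0 u1].
have [|||s _ <-] := @IVT R F (s0 - 1) (s0 + 1) u.
- by lra.
- exact/continuous_subspaceT/continuous_cdf.
- rewrite circle_cdf_lt; last by lra.
  by rewrite circle_cdf_eq1// min_l ?max_r ?u0.
- by exists s.
Qed.

Lemma measurable_uniformize : measurable_fun setT (uniformize : circle R -> measurableTypeR R).
Proof.
have mF : measurable_fun setT (F : measurableTypeR R -> measurableTypeR R).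
  by apply: nondecreasing_measurable => // s t /circle_cdf_nondecreasing; exact.
apply: (@measurableT_comp _ _ _ _ (measurableTypeR R) _ _ _ _ mF).
exact: measurable_csec.
Qed.

Lemma measurable_uniformize_le u : measurable [set c | uniformize c <= u].
Proof.
rewrite (_ : [set _ | _] = setT `&` uniformize @^-1` `]-oo, u]); last first.
  by rewrite setTI; apply/seteqP; split=> c /=; rewrite in_itv.
exact: measurable_uniformize.
Qed.

(** F is continuous but may have plateaus, so two inequalities are proved. A point s with F s = u
    gives the lower bound; a point with F s = v for v slightly above u gives the upper one. *)
Lemma uniformize_uniform u : 0 <= u <= 1 -> mu [set c | uniformize c <= u] = u%:E.
Proof.
move=> u01; apply/eqP; rewrite eq_le; apply/andP; split; last first.
  have [s Fs] := cdf_attains u01.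
  rewrite -{1}Fs -circle_cdfE le_measure ?inE//; first exact: measurable_csec_le.
    exact: measurable_uniformize_le.
  by move=> c /= cs; rewrite /uniformize -Fs circle_cdf_nondecreasing.
have [->|u1] := eqVneq u 1; first by rewrite probability_le1//; exact: measurable_uniformize_le.
apply/lee_addgt0Pr => e e0.
pose v := Num.min (u + e) 1.
have uv : u < v by rewrite lt_min ltrDl e0/= lt_neqAle u1; case/andP: u01.
have [s Fs] : exists s, F s = v.
  by apply: cdf_attains; rewrite ge_min lexx orbT andbT; case/andP: u01 => u0 _; lra.
apply: (@le_trans _ _ (mu [set c | csec s0 c <= s])).
  rewrite le_measure ?inE//; [exact: measurable_uniformize_le|exact: measurable_csec_le|].
  move=> c /= cu; rewrite leNgt; apply/negP => /ltW sc.
  by have := circle_cdf_nondecreasing mu sc; rewrite Fs; rewrite /uniformize in cu; lra.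
by rewrite circle_cdfE Fs -EFinD lee_fin ge_min lexx.
Qed.

(** The level set lies between the sublevels at v and at u, with v at most e below u, and uniformity
    bounds the difference of their masses by e. At u = 0 the sublevel itself is null. *)
Lemma uniformize_atomless u : mu [set c | uniformize c = u] = 0%E.
Proof.
have m1 : measurable [set c | uniformize c = u].
  rewrite (_ : [set _ | _] = setT `&` uniformize @^-1` [set u]); last by rewrite setTI.
  exact: measurable_uniformize.
have [u01|nu01] := boolP (0 <= u <= 1); last first.
  rewrite (_ : [set _ | _] = set0) ?measure0//; apply/seteqP; split => c //= cu.
  by move/negP: nu01; apply; rewrite -cu; exact: uniformize_itv.
apply/eqP; rewrite eq_le measure_ge0 andbT.
apply/lee_addgt0Pr => e e0; rewrite add0e.
have [u0|u0] := eqVneq u 0.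
  have : (mu [set c | uniformize c = u] <= mu [set c | (uniformize c <= u)%R])%E.
    by rewrite le_measure ?inE//; [exact: measurable_uniformize_le|move=> c /= ->].
  by rewrite uniformize_uniform// u0 => /le_trans; apply; rewrite lee_fin ltW.
pose v := Num.max (u - e) 0.
have vu : v < u by rewrite gt_max gtrBl e0/= lt_neqAle eq_sym u0; case/andP: u01.
have v01 : 0 <= v <= 1 by rewrite le_max lexx orbT/=; case/andP: u01 => _ u1; lra.
have : (mu [set c | uniformize c = u] + mu [set c | (uniformize c <= v)%R] <= mu [set c | (uniformize c <= u)%R])%E.
  have mv := measurable_uniformize_le v.
  rewrite -measureU//; last by apply/seteqP; split=> c //= [->]; lra.
  rewrite le_measure ?inE//; [exact: measurableU|exact: measurable_uniformize_le|].
  by move=> c /= [->|h]//; lra.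
rewrite !uniformize_uniform//.
have f : mu [set c | uniformize c = u] \is a fin_num by exact: fin_num_measure.
rewrite -(fineK f) -EFinD !lee_fin => h.
have : u - e <= v by rewrite le_max lexx.
by lra.
Qed.

Section target.
Variable nu : probability (circle R) R.

Definition transport_lift (c : circle R) : R := quantile (circle_cdf nu) (uniformize c).

Definition transport (c : circle R) : circle R := circle_proj (transport_lift c).

Lemma transport_lift_le c s : transport_lift c <= s <-> s0 <= s /\ uniformize c <= circle_cdf nu s.
Proof.
rewrite /transport_lift quantile_le; first by split=> /andP.
by case/andP: (uniformize_itv c).
Qed.

Lemma transport_lift_le_set s : [set c | transport_lift c <= s] =
  if s0 <= s then [set c | uniformize c <= circle_cdf nu s] else set0.
Proof.
case: ifPn => ss; apply/seteqP; split=> c //=; rewrite transport_lift_le.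
- by case.
- by [].
- by case=> h; rewrite h in ss.
Qed.

Lemma measurable_transport_lift :
  measurable_fun setT (transport_lift : circle R -> measurableTypeR R).
Proof.
apply: (measurability _ (RGenOInfty.measurableE R)) => //= _ [_ [x ->] <-].
rewrite setTI (_ : _ @^-1` _ = ~` [set c | transport_lift c <= x]); last first.
  by apply/seteqP; split=> c /=; rewrite in_itv/= andbT ltNge => /negP.
apply: measurableC; rewrite transport_lift_le_set.
by case: ifPn => // _; exact: measurable_uniformize_le.
Qed.

Lemma measurable_transport : measurable_fun setT transport.
Proof.
apply: (@measurableT_comp _ _ _ _ (measurableTypeR R) _ _ _ _ (@measurable_circle_proj R)).
exact: measurable_transport_lift.
Qed.

(** Rays suffice. With G the distribution function of [nu] and x >= s0, the event that the lift is
    at most x is the event that the uniform variable is at most G x, of mass G x. *)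
Lemma transport_lift_law (A : set (measurableTypeR R)) : measurable A ->
  mu (transport_lift @^-1` A) = nu (csec s0 @^-1` A).
Proof.
have mf := measurable_transport_lift; have mg := @measurable_csec R s0.
pose f : {mfun circle R >-> measurableTypeR R} := HB.pack (transport_lift : circle R -> measurableTypeR R) (isMeasurableFun.Build _ _ _ _ _ mf).
pose g : {mfun circle R >-> measurableTypeR R} := HB.pack (csec s0 : circle R -> measurableTypeR R) (isMeasurableFun.Build _ _ _ _ _ mg).
pose m1 : {measure set (measurableTypeR R) -> \bar R} := distribution mu f.
pose m2 : {measure set (measurableTypeR R) -> \bar R} := distribution nu g.
move: A; change (forall A : set (measurableTypeR R), measurable A -> m1 A = m2 A).
refine (@measure_unique _ R (measurableTypeR R) (@RGenOInfty.G R) (fun n => `]-n%:R, +oo[%classic)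
  _ _ _ _ m1 m2 _ _).
- exact: RGenOInfty.measurableE.
- move=> _ _ [x ->] [y ->]; exists (Num.max x y); apply/seteqP; split=> z /=;
    by rewrite !in_itv/= !andbT gt_max => /andP.
- by move=> n; exists (- n%:R).
- apply/seteqP; split=> // x _; exists (Num.truncn `|x|).+1 => //=.
  rewrite in_itv/= andbT ltrNl (le_lt_trans (ler_norm _))// normrN.
  by have /andP[] := truncn_itv (normr_ge0 x).
- move=> _ [x ->].
  have h (F' : circle R -> R) : F' @^-1` `]x, +oo[ = ~` [set c | F' c <= x].
    by apply/seteqP; split=> c /=; rewrite in_itv/= andbT ltNge => /negP.
  change (mu (transport_lift @^-1` `]x, +oo[) = nu (csec s0 @^-1` `]x, +oo[)).
  rewrite [X in mu X](h transport_lift) [X in nu X](h (csec s0)) !probability_setC//; [|exact: measurable_csec_le|]; last first.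
    by rewrite transport_lift_le_set; case: ifPn => // _; exact: measurable_uniformize_le.
  congr (_ - _)%E; rewrite transport_lift_le_set circle_cdfE.
  case: ifPn => [_|]; first by rewrite uniformize_uniform// circle_cdf_ge0 circle_cdf_le1.
  by rewrite -ltNge => xs; rewrite measure0 circle_cdf_lt.
- by move=> n; rewrite (le_lt_trans (probability_le1 _ _)) ?ltry.
Qed.

Lemma transport_law (A : set (circle R)) : measurable A -> mu (transport @^-1` A) = nu A.
Proof.
move=> mA; rewrite (_ : transport @^-1` A = transport_lift @^-1` (circle_rv (R:=R) @^-1` A))//.
rewrite transport_lift_law; last by rewrite -[X in measurable X]setTI; exact: measurable_circle_proj.
by congr (nu _); apply/seteqP; split=> c /=; rewrite /circle_rv csecK.
Qed.

End target.
End transport.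
End circle_cdf.

(** * Convergence of quantiles and coordinatewise coupling *)

Section coupling.
Context {R : realType}.

Lemma rat_in_itv_avoiding (zs : seq R) (a b : R) : a < b ->
  exists2 r : rat, a < ratr r < b & ratr r \notin zs.
Proof.
elim: zs a b => [|z zs IH] a b ab.
  by have [r] := rat_in_itvoo ab; rewrite in_itv/= => h; exists r.
have [az|za] := ltP a z.
  have [|r /andP[ar rm] rz] := IH a (Num.min b z); first by rewrite lt_min ab.
  move: rm; rewrite lt_min => /andP[rb rz']; exists r; first by rewrite ar.
  by rewrite inE negb_or rz andbT lt_eqF.
have [r /andP[ar rb] rz] := IH a b ab; exists r; first by rewrite ar.
by rewrite inE negb_or rz andbT gt_eqF// (le_lt_trans za).
Qed.

(** The limit quantile is enclosed between rationals outside [zs], where the distribution functions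
    converge. Levels attained at a rational are excluded because only a strict inequality between u
    and the limit persists along the sequence; countably many levels are lost. *)
Lemma quantile_cvg s0 (zs : seq R) (nu_ : nat -> probability (circle R) R)
    (nu : probability (circle R) R) u :
  (forall s, s \notin zs -> circle_cdf s0 (nu_ n) s @[n --> \oo] --> circle_cdf s0 nu s) ->
  u <= 1 -> (forall r : rat, circle_cdf s0 nu (ratr r) <> u) ->
  quantile s0 (circle_cdf s0 (nu_ n)) u @[n --> \oo] --> quantile s0 (circle_cdf s0 nu) u.
Proof.
move=> Gcvg u1 ur; set q := quantile s0 (circle_cdf s0 nu) u.
have up r : q < r -> s0 <= r /\ u <= circle_cdf s0 nu r.
  by move=> /ltW; rewrite quantile_le// => /andP.
have dn r : r < q -> s0 <= r -> circle_cdf s0 nu r < u.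
  by rewrite ltNge quantile_le// negb_and => /orP[/negbTE ->//|]; rewrite -ltNge.
apply/cvgrPdist_le => e e0.
have [|r1 /andP[qr1 r1q] z1] := @rat_in_itv_avoiding zs (q - e) q; first by rewrite gtrBl.
have [|r2 /andP[qr2 r2q] z2] := @rat_in_itv_avoiding zs q (q + e); first by rewrite ltrDl.
have [sr2 ur2] := up _ qr2.
have ur2' : u < circle_cdf s0 nu (ratr r2) by rewrite lt_neqAle ur2 eq_sym andbT; apply/eqP.
have H2 := cvgr_gt _ (Gcvg _ z2) _ ur2'.
(* If the left test point lies below s0, every quantile exceeds it without any condition on u. *)
have H1 : \forall n \near \oo, ~~ (s0 <= ratr r1) || (circle_cdf s0 (nu_ n) (ratr r1) < u).
  have [sr1|] := boolP (s0 <= ratr r1); last by move=> _; exists 0%N.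
  by apply: filterS (cvgr_lt _ (Gcvg _ z1) _ (dn _ r1q sr1)) => n ->.
near=> n.
have h2 : quantile s0 (circle_cdf s0 (nu_ n)) u <= ratr r2.
  by rewrite quantile_le// sr2/= ltW//; near: n; exact: H2.
have h1 : ratr r1 < quantile s0 (circle_cdf s0 (nu_ n)) u.
  by rewrite ltNge quantile_le// negb_and -[~~ (u <= _)]ltNge; near: n; exact: H1.
by rewrite ler_norml; lra.
Unshelve. all: end_near. Qed.

Definition coord_map (T : circle R -> circle R) (d : config R) : config R := fun k => T (d k).

Lemma measurable_coord_map T : measurable_fun setT T -> measurable_fun setT (coord_map T).
Proof.
move=> mT; apply: measurable_config => k.
exact: (measurableT_comp mT (@measurable_coord R k)).
Qed.

Section increments.
Variable P : probability (config R) R.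
Variable mu : probability (circle R) R.
Hypothesis Pmu : is_product_measure P mu.

Lemma product_marginal k A : measurable A -> P [set d | A (d k)] = mu A.
Proof.
move=> mA; have := Pmu [fset k]%fset (fun=> mA); rewrite big_seq_fset1 => <-.
by congr (P _); apply/seteqP; split=> d /= h; [move=> j; rewrite inE => /eqP ->|apply: h; rewrite inE].
Qed.

(** The uniform spin at 0 is kept and each increment is moved by T. *)
Definition coupled (T : circle R -> circle R) (p : circle R * config R) : config R :=
  recon (p.1, coord_map T p.2).

Lemma measurable_coupled T : measurable_fun setT T -> measurable_fun setT (coupled T).
Proof.
move=> mT; apply: (measurableT_comp (@measurable_recon R)).
apply: measurable_fun_pair => /=; first exact: measurable_fst.
exact: (measurableT_comp (measurable_coord_map mT) measurable_snd).
Qed.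

Section law.
Variable T : circle R -> circle R.
Hypothesis mT : measurable_fun setT T.

HB.instance Definition _ := @isMeasurableFun.Build _ _ _ _ (coord_map T) (measurable_coord_map mT).
HB.instance Definition _ := @isMeasurableFun.Build _ _ _ _ (coupled T) (measurable_coupled mT).

Definition coupled_law : probability (config R) R := distribution (leb R \x P)%E (coupled T).

Lemma coord_map_product (nu : set (circle R) -> \bar R) :
  (forall A, measurable A -> mu (T @^-1` A) = nu A) ->
  is_product_measure (distribution P (coord_map T)) nu.
Proof.
move=> munu L A mA; rewrite /distribution/pushforward/=.
have mTA k : measurable (T @^-1` A k) by rewrite -[X in measurable X]setTI; exact: mT.
rewrite (eq_bigr (fun k => mu (T @^-1` A k))); last by move=> k _; rewrite munu.
by rewrite -(Pmu L mTA).
Qed.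

Lemma coupled_law_increments (nu : set (circle R) -> \bar R) :
  (forall A, measurable A -> mu (T @^-1` A) = nu A) ->
  symmetric_with_increments coupled_law nu.
Proof.
move=> /coord_map_product /recon_law_increments[sym inc].
by split=> [t A mA|L A mA]; [exact: sym|exact: inc].
Qed.

End law.
End increments.
End coupling.

(** * Weak convergence through the coupling *)

Section weak_convergence.
Context {R : realType}.

Lemma circle_proj_sum (I : Type) (s : seq I) (f : I -> R) :
  circle_proj (\sum_(i <- s) f i) = \sum_(i <- s) circle_proj (f i) :> circle R.
Proof.
have p0 : circle_proj 0 = 0 :> circle R by rewrite -[0 in LHS](subrr 0) circle_projB subrr.
exact: (big_morph _ (@circle_projD R) p0).
Qed.

(** Real-valued counterpart of [recon]: quantiles converge on the line, and continuity of finite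
    sums there is then projected to the circle. *)
Definition recon_lift (a : R) (e : int -> R) (k : int) : R :=
  match k with
  | Posz n => a - \sum_(j < n) e (Posz j)
  | Negz n => a + \sum_(j < n.+1) e (Negz j)
  end.

Lemma recon_proj a (e : int -> R) k :
  recon (circle_proj a, fun j => circle_proj (e j)) k = circle_proj (recon_lift a e k).
Proof.
by case: k => n; rewrite /recon/= ?circle_projB ?circle_projD circle_proj_sum.
Qed.

Lemma recon_cvg (e_ : nat -> int -> R) (e : int -> R) (a : R) :
  (forall k, e_ n k @[n --> \oo] --> e k) ->
  (recon (circle_proj a, fun j => circle_proj (e_ n j)) : config R) @[n --> \oo] -->
  (recon (circle_proj a, fun j => circle_proj (e j)) : config R).
Proof.
move=> ee; apply: config_cvg => k; rewrite recon_proj.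
suff : recon_lift a (e_ n) k @[n --> \oo] --> recon_lift a e k.
  move=> h; apply: (cvg_trans _ (continuous_cvg _ (@circle_proj_continuous R _) h)).
  apply: (@near_eq_cvg _ _ _ _ (fun n => circle_proj (recon_lift a (e_ n) k))
    (fun n => recon (circle_proj a, fun j => circle_proj (e_ n j)) k)).
  by apply: nearW => n; rewrite recon_proj.
case: k => n /=.
- by apply: cvgB; [exact: cvg_cst|apply: (@cvg_big _ _ _ _ _ add_continuous) => j _; exact: ee].
- by apply: cvgD; [exact: cvg_cst|apply: (@cvg_big _ _ _ _ _ add_continuous) => j _; exact: ee].
Qed.

Lemma continuous_config_measurable (f : config R -> R) : continuous f -> measurable_fun setT f.
Proof.
move=> cf; apply: (measurability _ (RGenOpens.measurableE R)).
move=> _ [_ [a [b ->] <-]]; rewrite setTI; apply: sub_sigma_algebra.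
by move/continuousP: cf; apply; exact: itv_open.
Qed.

Lemma continuous_config_bounded (f : config R -> R) : continuous f ->
  exists M : R, forall x, `|f x| <= M.
Proof.
move=> cf; have cr : compact (range f).
  by apply: continuous_compact; [exact: continuous_subspaceT|exact: config_compact].
have [M [_ HM]] := compact_bounded cr.
exists (M + 1) => c; apply: HM; last by exists c.
by rewrite ltrDl.
Qed.

(** A continuous function on the compact configuration space is bounded, so almost sure convergence
    of the realizations gives convergence of the integrals by domination. *)
Lemma pushforward_weak_cvg d (X : measurableType d) (Q : probability X R)
    (h_ : nat -> X -> config R) (h : X -> config R) (rho_ : nat -> probability (config R) R)
    (rho : probability (config R) R) (f : config R -> R) :
  (forall n, measurable_fun setT (h_ n)) -> measurable_fun setT h ->
  (forall n E, measurable E -> rho_ n E = Q (h_ n @^-1` E)) ->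
  (forall E, measurable E -> rho E = Q (h @^-1` E)) ->
  {ae Q, forall x, h_ n x @[n --> \oo] --> h x} ->
  continuous f ->
  \int[rho_ n]_x f x @[n --> \oo] --> \int[rho]_x f x.
Proof.
move=> mh_ mh rhoE_ rhoE hcvg cf.
have mf := continuous_config_measurable cf; have [M fM] := continuous_config_bounded cf.
have mfE : measurable_fun setT (EFin \o f) by exact/measurable_EFinP.
have pushE (g : X -> config R) (mg : measurable_fun setT g) (r : probability (config R) R) :
    (forall E, measurable E -> r E = Q (g @^-1` E)) ->
    (\int[r]_x (f x)%:E = \int[Q]_x (f (g x))%:E)%E.
  move=> rE.
  pose g' : {mfun X >-> config R} := HB.pack g (isMeasurableFun.Build _ _ _ _ _ mg).
  rewrite (@eq_measure_integral _ _ _ _ (distribution Q g')); last by move=> A mA _; exact: rE.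
  rewrite integral_distribution//.
  apply: measurable_bounded_integrable => //.
  - by rewrite (le_lt_trans (probability_le1 _ _)) ?ltry.
  - exact: (measurableT_comp mf mg).
  - by exists M; split; [exact: num_real|move=> y My x _ /=; rewrite (le_trans (fM _))// ltW].
rewrite /Rintegral (pushE h mh rho rhoE).
under eq_fun do rewrite (pushE _ (mh_ _) _ (rhoE_ _)).
have mfh g : measurable_fun setT g -> measurable_fun setT (fun x : X => (f (g x))%:E).
  by move=> mg; exact: (measurableT_comp mfE mg).
have [| | | | |iF _ H] := @dominated_convergence _ _ _ Q setT measurableT
  (fun n x => (f (h_ n x))%:E) (fun x => (f (h x))%:E) (cst M%:E).
- by move=> n; apply: mfh.
- exact: mfh.
- apply: filterS hcvg => x hx _; apply: cvg_EFin; first exact: nearW.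
  exact: (continuous_cvg _ (cf _) hx).
- by apply/integrableP; split => //; rewrite /= integral_cst// [X in (_ * X)%E]probability_setT mule1 ltry.
- by apply: aeW => x n _; rewrite lee_fin.
apply: fine_cvg; rewrite fineK//.
exact: integrable_fin_num.
Qed.

Section increments.
Variables (s0 K : R) (zs : seq R) (P : probability (config R) R) (mu : probability (circle R) R).
Hypothesis Pmu : is_product_measure P mu.
Hypothesis muK : forall s t, s <= t -> circle_cdf s0 mu t - circle_cdf s0 mu s <= K * (t - s).

Local Notation T := (transport s0 mu).

(** P already is an infinite product, and transporting its coordinates produces one with marginal
    [nu]. *)
Lemma increments_limit (nu : probability (circle R) R) :
  exists rho : probability (config R) R, symmetric_with_increments rho nu.
Proof.
exists (coupled_law P (measurable_transport s0 mu nu)).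
by apply: (coupled_law_increments Pmu) => A mA; rewrite (transport_law muK).
Qed.

Lemma increments_weak_cvg (nu_ : nat -> probability (circle R) R) (nu : probability (circle R) R)
    (rho_ : nat -> probability (config R) R) (rho : probability (config R) R) (f : config R -> R) :
  (forall n, symmetric_with_increments (rho_ n) (nu_ n)) -> symmetric_with_increments rho nu ->
  (forall s, s \notin zs -> circle_cdf s0 (nu_ n) s @[n --> \oo] --> circle_cdf s0 nu s) ->
  continuous f ->
  \int[rho_ n]_x f x @[n --> \oo] --> \int[rho]_x f x.
Proof.
move=> inc_ inc Gcvg cf.
have mT m : measurable_fun setT (T m) := measurable_transport s0 mu m.
(* By uniqueness of the symmetric law with given increments, all the measures in play are images of
   one probability space. *)
have lawE (r : probability (config R) R) (m : probability (circle R) R) :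
    symmetric_with_increments r m ->
    forall E, measurable E -> r E = (leb R \x P)%E (coupled (T m) @^-1` E).
  move=> rm E mE.
  have cm : symmetric_with_increments (coupled_law P (mT m)) m.
    by apply: (coupled_law_increments Pmu) => A mA; rewrite (transport_law muK).
  by rewrite (symmetric_with_increments_unique cm rm mE).
apply: (@pushforward_weak_cvg _ _ (leb R \x P)%E (fun n => coupled (T (nu_ n))) (coupled (T nu))) => //.
- by move=> n; apply: measurable_coupled.
- exact: measurable_coupled.
- by move=> n; apply: lawE.
- exact: lawE.
(* The bad event for site p.1 and rational p.2: the uniform variable hits a level excluded by
   [quantile_cvg]. It is null because that variable has no atoms. *)
pose S (p : int * rat) := [set d : config R | uniformize s0 mu (d p.1) = circle_cdf s0 nu (ratr p.2)].
have mSs u : measurable [set c | uniformize s0 mu c = u].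
  rewrite (_ : [set _ | _] = setT `&` uniformize s0 mu @^-1` [set u]); last by rewrite setTI.
  exact: measurable_uniformize.
have S0 p : P (S p) = 0%E.
  have := product_marginal Pmu p.1 (mSs (circle_cdf s0 nu (ratr p.2))).
  by rewrite (uniformize_atomless muK).
have mS p : measurable (S p).
  rewrite (_ : S p = setT `&` (fun d : config R => d p.1) @^-1` [set c | uniformize s0 mu c = circle_cdf s0 nu (ratr p.2)]); last by rewrite setTI.
  exact: measurable_coord.
(* Enumeration of the bad events; indices that code no pair contribute the empty set. *)
pose F n : set (config R) := if (choice.unpickle n : option (int * rat)) is Some p then S p else set0.
have mF n : measurable (F n) by rewrite /F; case: choice.unpickle.
pose N := \bigcup_n F n.
have N0 : P.-negligible N.
  apply: negligible_bigcup => n; apply/negligibleP => //.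
  by rewrite /F; case: choice.unpickle => [p|]; rewrite ?measure0//; exact: S0.
have {}N0 : P N = 0%E by apply/negligibleP => //; exact: bigcup_measurable.
have mN : measurable N by exact: bigcup_measurable.
exists (setT `*` N); split.
- exact: measurableX.
- apply: etrans (@product_measure1E _ _ _ _ _ (leb R) P _ _ measurableT mN) _.
  by rewrite [X in (_ * X)%E](_ : _ = 0%E) ?mule0.
- move=> [t d] /= nc; split=> //; apply: contrapT => Nd; apply: nc.
  rewrite /coupled/= -(csecK 0 t).
  apply: (@recon_cvg (fun n k => transport_lift s0 mu (nu_ n) (d k)) (fun k => transport_lift s0 mu nu (d k))) => k.
  apply: (quantile_cvg Gcvg) => [|r E].
    by case/andP: (uniformize_itv s0 mu (d k)).
  by apply: Nd; exists (choice.pickle (k, r)) => //; rewrite /F choice.pickleK /S/= -E.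
Qed.

End increments.
End weak_convergence.
(** * Zero-temperature limit *)

Section limit_cdf.
Context {R : realType}.

Lemma bigmaxn_attained (I : eqType) (s : seq I) (f : I -> nat) : s != [::] ->
  exists2 i, i \in s & f i = \big[maxn/0%N]_(j <- s) f j.
Proof.
elim: s => //= i [|j s] IH _; first by exists i; rewrite ?mem_head// big_seq1.
have [//|k ks fk] := IH; rewrite big_cons -fk.
have [_|_] := leqP (f i) (f k); first by exists k => //; rewrite inE ks orbT.
by exists i => //; rewrite mem_head.
Qed.

Variable U : circle R -> R.
Hypotheses (anU : real_analytic U) (ncU : ~ (exists a : R, forall t, U t = a)).

Local Notation maxU := (sup (range U)).
Local Notation L := (max_flatness U).
Local Notation maxs := (fset_set (maximizers U)).
Let W (s : R) : R := U (circle_proj s) - maxU.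

Lemma mem_maximizers c : (c \in maxs) = (c \in maximizers U).
Proof. by rewrite in_fset_set//; exact: finite_maximizers. Qed.

Lemma max_flatnessE : L = \big[maxn/0%N]_(c <- maxs) flatness U c.
Proof. by rewrite /max_flatness fsbig_finite//; exact: finite_maximizers. Qed.

Lemma flatness_gt1 c : maximizers U c -> (1 < flatness U c)%N.
Proof.
move=> /(maximizer_expansion anU ncU)[[f1 _ _] odd_f _ _].
by case: (flatness U c) f1 odd_f => [|[|]].
Qed.

Lemma le_max_flatness c : maximizers U c -> (flatness U c <= L)%N.
Proof.
move=> mc; rewrite max_flatnessE.
by apply: leq_bigmax_seq => //; rewrite mem_maximizers inE.
Qed.

Lemma flattest_exists : exists c, flattest U c.
Proof.
have [c0 mc0] := maximizer_exists anU.
have [|c cm fc] := @bigmaxn_attained _ maxs (flatness U).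
  have h : c0 \in enum_fset maxs by have := mem_maximizers c0; rewrite (mem_set mc0).
  by apply/eqP => E; rewrite E in h.
exists c; split; last by rewrite fc max_flatnessE.
by rewrite mem_maximizers inE in cm.
Qed.

Lemma finite_flattest : finite_set (flattest U).
Proof. by apply: sub_finite_set (finite_maximizers anU ncU) => c []. Qed.

Lemma weight_gt0 c : maximizers U c -> 0 < weight U c.
Proof. by move=> /(maximizer_expansion anU ncU)[_ _ o _]; rewrite powR_gt0. Qed.

Lemma weight_ge0 c : 0 <= weight U c.
Proof. exact: powR_ge0. Qed.

Lemma flattest_sumE (V : nmodType) (f : circle R -> V) :
  \sum_(c \in flattest U) f c = \sum_(c <- maxs) (if flatness U c == L then f c else 0).
Proof.
rewrite -big_mkcond fsbig_finite; last exact: finite_flattest.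
rewrite -[RHS]big_filter; apply: perm_big; apply: uniq_perm; rewrite ?filter_uniq ?fset_uniq//.
move=> c; rewrite in_fset_set; last exact: finite_flattest.
rewrite mem_filter mem_maximizers; apply/idP/andP; rewrite !inE.
  by move=> [mc fc]; split; [apply/eqP|].
by move=> [/eqP fc mc]; split.
Qed.

Lemma sum_weight_gt0 : 0 < \sum_(c \in flattest U) weight U c.
Proof.
have [c [mc fc]] := flattest_exists.
rewrite flattest_sumE (bigD1_seq c)/= ?fset_uniq ?mem_maximizers ?inE//.
rewrite fc eqxx ltr_wpDr ?weight_gt0// sumr_ge0// => c' _.
by case: ifP => // _; exact: weight_ge0.
Qed.

Lemma limit_marginal_probability :
  exists nu : probability (circle R) R, forall A, nu A = limit_marginal U A.
Proof.
pose s := fset_set (flattest U).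
pose w i : {nonneg R} := NngNum (weight_ge0 (nth point s i)).
pose m : {measure set (circle R) -> \bar R} :=
  msum (fun i => mscale (w i) (@dirac _ _ (nth point s i) R)) (size s).
have mE A : m A = (\sum_(c \in flattest U) (weight U c)%:E * \d_c A)%E.
  rewrite fsbig_finite; last exact: finite_flattest.
  by rewrite (big_nth point) big_mkord.
have mT : m setT = (\sum_(c \in flattest U) weight U c)%:E.
  rewrite mE !fsbig_finite; [|exact: finite_flattest..].
  by rewrite -sumEFin; apply: eq_bigr => c _; rewrite diracT mule1.
exists (mnormalize m (leb R)) => A.
transitivity (m A * ((\sum_(c \in flattest U) weight U c)^-1)%:E)%E; last by rewrite mE.
(* The fallback measure of the normalization is not reached, since the total weight is positive and
   finite. *)
have e : mnormalize m (leb R) A = (if (m setT == 0) || (m setT == +oo) then leb R A else m A * (fine (m setT))^-1%:E)%E.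
  by rewrite /mnormalize; case: ifP.
by apply: etrans e _; rewrite mT eqe (gt_eqF sum_weight_gt0).
Qed.

Lemma nonmaximal_point : exists s0 : R, U (circle_proj s0) < maxU.
Proof.
apply: contrapT => no; apply: ncU; exists maxU => t.
apply/eqP; rewrite eq_le (le_max_potential anU)/= leNgt; apply/negP => tm.
by have [s st] := circle_proj_surj t; apply: no; exists s; rewrite st.
Qed.

Lemma continuous_gap : continuous W.
Proof. by move=> s; apply: cvgB; [exact: (continuous_lift anU)|exact: cvg_cst]. Qed.

Lemma gap_le0 s : W s <= 0.
Proof. by rewrite subr_le0 (le_max_potential anU). Qed.

Lemma gap_laplace_int_le b x y : 0 <= b -> x <= y -> laplace_int W b x y <= y - x.
Proof.
move=> b0 xy; have := laplace_int_le continuous_gap b0 xy (fun s _ => gap_le0 s).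
by rewrite mulr0 expR0 mul1r.
Qed.

Section cdf.
Variable s0 : R.
Hypothesis s0P : U (circle_proj s0) < maxU.

Local Notation zs := [seq csec s0 c | c <- maxs].

Lemma increment_prob_cdf b p s : s0 <= s <= s0 + 1 ->
  increment_prob (fun c => b * U c - p) [set c | csec s0 c <= s] =
  (expR (b * maxU - p) * laplace_int W b s0 s)%:E.
Proof.
move=> /andP[ss ss1]; rewrite /increment_prob.
have mB := measurable_csec_le s0 s.
have mU := measurable_potential anU.
have mE : measurable_fun setT (fun c => expR (b * U c - p)).
  by apply: measurableT_comp => //; apply: measurable_funB => //; exact: measurable_funM.
rewrite (integral_leb s0); last first.
- by move=> c; rewrite lee_fin mulr_ge0 ?expR_ge0.
- by apply/measurable_EFinP; apply: measurable_funM => //; exact: measurable_indic.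
pose g (x : R) := ((expR (b * maxU - p))%:E * (expR (b * W x))%:E)%E.
have mg : measurable_fun setT (g : measurableTypeR R -> _).
  apply: emeasurable_funM => //.
  by apply/measurable_EFinP; exact: (measurable_expW continuous_gap).
transitivity (\int[lebesgue_measure]_(x in `[s0, (s0 + 1)%R[) (g \_ [set x | (x <= s)%R]) x)%E.
  apply: eq_integral => x; rewrite inE/= in_itv/= => xs.
  rewrite patchE /g indicE (_ : (_ \in _) = (x \in [set y | (y <= s)%R])); last first.
    by apply/idP/idP; rewrite !inE/= csec_proj.
  case: ifP => _; rewrite ?mul1r ?mul0r// -EFinM -expRD; congr (expR _)%:E.
  by rewrite /W; ring.
have -> : (\int[lebesgue_measure]_(x in `[s0, (s0 + 1)%R[) (g \_ [set x | (x <= s)%R]) x =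
  \int[lebesgue_measure]_(x in `[s0, (s0 + 1)%R]) (g \_ [set x | (x <= s)%R]) x)%E.
  apply: integral_itv_bndo_bndc; apply: measurable_funTS.
  apply/(measurable_restrictT _ _).1 => //.
    by have := @measurable_itv R `]-oo, s]; rewrite set_itvNyc.
  exact: measurable_funTS.
rewrite -integral_mkcondr (_ : _ `&` _ = `[s0, s]%classic); last first.
  by apply/seteqP; split=> x /=; rewrite !in_itv/=; lra.
rewrite ge0_integralZl//; first by rewrite (laplace_intE continuous_gap).
by apply/measurable_EFinP/measurable_funTS; exact: (measurable_expW continuous_gap).
Qed.

Local Notation J := (laplace_int W).

Section increment_law.
Variables (m : probability (circle R) R) (b p : R).
Hypothesis b0 : 0 < b.
Hypothesis mE : forall A, measurable A -> m A = increment_prob (fun c => b * U c - p) A.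

Local Notation F := (circle_cdf s0 m).

Lemma increment_cdfE s : s0 <= s <= s0 + 1 -> F s = expR (b * maxU - p) * J b s0 s.
Proof.
by move=> ss; apply: EFin_inj; rewrite -circle_cdfE mE ?increment_prob_cdf//; exact: measurable_csec_le.
Qed.

Lemma laplace_int_total : expR (b * maxU - p) * J b s0 (s0 + 1) = 1.
Proof. by rewrite -increment_cdfE ?circle_cdf_eq1// lexx lerDl ler01. Qed.

Lemma increment_cdf_ratio s : s0 <= s <= s0 + 1 -> F s = J b s0 s / J b s0 (s0 + 1).
Proof.
move=> /increment_cdfE ->; have J0 : J b s0 (s0 + 1) != 0.
  by apply: contra_eqN laplace_int_total => /eqP ->; rewrite mulr0 eq_sym oner_neq0.
by apply: (mulIf J0); rewrite divfK// mulrAC laplace_int_total mul1r.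
Qed.

(** The density of the increment is at most exp (b max U - p) because W <= 0. Outside [s0, s0 + 1]
    the distribution function is constant, whence the case distinction. *)
Lemma increment_cdf_lipschitz s t : s <= t ->
  F t - F s <= expR (b * maxU - p) * (t - s).
Proof.
move=> st; set C := expR _; have C0 : 0 < C := expR_gt0 _.
have step x y : s0 <= x -> x <= y -> y <= s0 + 1 -> F y - F x <= C * (y - x).
  move=> sx xy ys; rewrite !increment_cdfE; [|lra|lra].
  rewrite -mulrBr (laplace_intD continuous_gap _ sx xy) addrAC subrr add0r.
  by rewrite ler_pM2l// gap_laplace_int_le// ltW.
have zero x : x < s0 -> F x = 0 := @circle_cdf_lt _ s0 m x.
have one x : s0 + 1 <= x -> F x = 1 := @circle_cdf_eq1 _ s0 m x.
have J00 : F s0 <= 0.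
  rewrite increment_cdfE; last by lra.
  rewrite pmulr_rle0 ?expR_gt0//.
  by rewrite (le_trans (gap_laplace_int_le _ _))// ?subrr// ltW.
have Cm x y : x <= y -> C * x <= C * y by rewrite ler_pM2l.
have Cst : 0 <= C * (t - s) by rewrite mulr_ge0 ?subr_ge0// ltW.
have [ts0|s0t] := ltP t s0; first by rewrite !zero ?subrr// (le_lt_trans st).
have [s1s|ss1] := leP (s0 + 1) s; first by rewrite !one ?subrr// (le_trans s1s).
have [t1|t1] := leP t (s0 + 1).
  have [ss0|s0s] := ltP s s0; last exact: step.
  rewrite (zero s)// subr0; have := step s0 t (lexx _) s0t t1.
  have : C * (t - s0) <= C * (t - s) by apply: Cm; lra.
  lra.
have -> : F t = F (s0 + 1) by rewrite !one// ltW.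
have [ss0|s0s] := ltP s s0.
  rewrite (zero s)// subr0; have := step s0 (s0 + 1) (lexx _).
  rewrite lerDl ler01 lexx => /(_ isT isT).
  have : C * (s0 + 1 - s0) <= C * (t - s) by apply: Cm; lra.
  lra.
have := step s (s0 + 1) s0s (ltW ss1) (lexx _).
have : C * (s0 + 1 - s) <= C * (t - s) by apply: Cm; lra.
lra.
Qed.

End increment_law.

Lemma csec_zero z : z \in zs -> exists2 c, maximizers U c & z = csec s0 c.
Proof. by case/mapP => c; rewrite mem_maximizers inE => mc ->; exists c. Qed.

(** The cut is not a maximizer, so no lift of a maximizer sits on the boundary of the interval. *)
Lemma zero_itv z : z \in zs -> s0 < z < s0 + 1.
Proof.
move=> /csec_zero[c mc ->]; have /andP[sc ->] := csec_itv s0 c.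
rewrite andbT lt_neqAle sc andbT; apply/eqP => E.
by move: s0P; rewrite E csecK mc ltxx.
Qed.

Lemma gap_zero x : s0 <= x <= s0 + 1 -> W x = 0 -> x \in zs.
Proof.
move=> /andP[sx xs] /eqP; rewrite subr_eq0 => /eqP Wx.
have xs1 : x != s0 + 1.
  by apply: contra_eqN Wx => /eqP ->; rewrite -(mulr1z 1) circle_proj_int lt_eqF.
apply/mapP; exists (circle_proj x); first by rewrite mem_maximizers inE.
by rewrite csec_proj// sx lt_neqAle xs1.
Qed.

(** Unnormalized distribution function of the limit marginal. The strict inequality fits the open
    intervals of [laplace_global] and matters only at points of [zs], where convergence is not
    claimed. *)
Definition cdf_mass (s : R) : R :=
  \sum_(c \in flattest U) (if csec s0 c < s then weight U c else 0).

Lemma gap_laplace s : s0 <= s <= s0 + 1 -> s \notin zs ->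
  b `^ (L%:R^-1) * J b s0 s @[b --> +oo] --> cdf_mass s * laplace_const L.
Proof.
move=> /andP[ss ss1] sz.
pose ls z := flatness U (circle_proj z); pose ws z := omega U (circle_proj z).
have uz : uniq zs by rewrite map_inj_uniq ?fset_uniq//; exact: can_inj (@csecK R s0).
have lsP z : z \in zs -> [/\ (1 < ls z)%N, ~~ odd (ls z), (ls z <= L)%N & 0 < ws z].
  move=> /csec_zero[c mc ->]; rewrite /ls /ws csecK.
  have [_ od om _] := maximizer_expansion anU ncU mc.
  by split => //; [exact: flatness_gt1|exact: le_max_flatness].
have ex z : z \in zs -> forall eta, 0 < eta -> exists2 d : R, 0 < d &
    forall x, `|x| < d -> `|W (z + x) + ws z * x ^+ ls z| <= eta * x ^+ ls z.
  move=> /csec_zero[c mc ->]; rewrite /ls /ws csecK => eta eta0.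
  have [_ _ _ /(_ _ (csecK s0 c) _ eta0)] := maximizer_expansion anU ncU mc.
  by [].
have L1 : (1 < L)%N.
  by have [c [mc <-]] := flattest_exists; exact: flatness_gt1.
have s0z : s0 \notin zs by apply/negP => /zero_itv; rewrite ltxx.
have := laplace_global continuous_gap gap_le0 uz gap_zero lsP ex L1 (lexx _) ss ss1 s0z sz.
congr (_ --> _); rewrite big_map /cdf_mass flattest_sumE mulr_suml big_seq [RHS]big_seq.
apply: eq_bigr => c cm; have zc : csec s0 c \in zs by apply: map_f.
have /andP[-> _] := zero_itv zc; rewrite /laplace_mass /ls /ws csecK /=.
by case: ifP => _; case: ifP => _; rewrite ?mul0r.
Qed.

Lemma laplace_const_flat_gt0 : 0 < laplace_const L :> R.
Proof.
have [c [mc <-]] := flattest_exists; apply: laplace_const_gt0; first exact: flatness_gt1.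
by have [] := maximizer_expansion anU ncU mc.
Qed.

(** Numerator and denominator share the scale b^(1/L) and the factor [laplace_const L], which
    cancel; the limit of the denominator is nonzero because some maximizer is flattest. *)
Lemma gap_laplace_ratio s : s0 <= s <= s0 + 1 -> s \notin zs ->
  J b s0 s / J b s0 (s0 + 1) @[b --> +oo] --> cdf_mass s / cdf_mass (s0 + 1).
Proof.
move=> ss sz; have s1 : s0 <= s0 + 1 <= s0 + 1 by rewrite lexx lerDl ler01.
have s1z : s0 + 1 \notin zs by apply/negP => /zero_itv; rewrite ltxx andbF.
have m1 : cdf_mass (s0 + 1) = \sum_(c \in flattest U) weight U c.
  by apply: eq_fsbigr => c _; have /andP[_ ->] := csec_itv s0 c.
have m0 : cdf_mass (s0 + 1) != 0 by rewrite m1 gt_eqF// sum_weight_gt0.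
have c0 := laplace_const_flat_gt0.
have -> : cdf_mass s / cdf_mass (s0 + 1) =
    (cdf_mass s * laplace_const L) / (cdf_mass (s0 + 1) * laplace_const L).
  by field; rewrite m0 gt_eqF.
apply: (cvg_trans _ (cvgM (gap_laplace ss sz)
  (cvgV (mulf_neq0 m0 (lt0r_neq0 c0)) (gap_laplace s1 s1z)))).
apply: near_eq_cvg; near=> b.
have b0 : 0 < b by near: b; exact: nbhs_pinfty_gt.
by rewrite /= invfM mulrACA divff ?mul1r// gt_eqF// powR_gt0.
Unshelve. all: end_near. Qed.

Lemma limit_cdfE (nu : probability (circle R) R) s : (forall A, nu A = limit_marginal U A) ->
  s \notin zs -> circle_cdf s0 nu s = cdf_mass s / cdf_mass (s0 + 1).
Proof.
move=> nuE sz; apply: EFin_inj; rewrite -circle_cdfE nuE /limit_marginal.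
have -> : cdf_mass (s0 + 1) = \sum_(c \in flattest U) weight U c.
  by apply: eq_fsbigr => c _; have /andP[_ ->] := csec_itv s0 c.
rewrite EFinM; congr (_ * _)%E; rewrite /cdf_mass !fsbig_finite; [|exact: finite_flattest..].
rewrite -sumEFin big_seq [RHS]big_seq; apply: eq_bigr => c cf.
rewrite diracE; have [cs|cs] := ltP (csec s0 c) s.
  by rewrite mem_set ?mule1//= ltW.
rewrite memNset ?mule0//= => cs'; move/negP: sz; apply.
have -> : s = csec s0 c by apply/eqP; rewrite eq_le cs cs'.
apply: map_f; rewrite mem_maximizers inE.
by move: cf; rewrite in_fset_set; [rewrite inE => -[]|exact: finite_flattest].
Qed.

Lemma increment_cdf_cvg (m : R -> probability (circle R) R) (p : R -> R)
    (nu : probability (circle R) R) :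
  (forall b, 0 < b -> forall A, measurable A ->
    m b A = increment_prob (fun c => b * U c - p b) A) ->
  (forall A, nu A = limit_marginal U A) ->
  forall s, s \notin zs -> circle_cdf s0 (m b) s @[b --> +oo] --> circle_cdf s0 nu s.
Proof.
move=> mE nuE s sz; have [ss|s0s] := ltP s s0.
  by under eq_fun do rewrite circle_cdf_lt//; rewrite circle_cdf_lt//; exact: cvg_cst.
have [s1|/ltW s1] := leP (s0 + 1) s.
  by under eq_fun do rewrite circle_cdf_eq1//; rewrite circle_cdf_eq1//; exact: cvg_cst.
rewrite (limit_cdfE nuE)//; have ss : s0 <= s <= s0 + 1 by rewrite s0s.
apply: (cvg_trans _ (gap_laplace_ratio ss sz)).
apply: near_eq_cvg; near=> b; have b0 : 0 < b by near: b; exact: nbhs_pinfty_gt.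
by rewrite (increment_cdf_ratio (mE b b0)).
Unshelve. all: end_near. Qed.

End cdf.
End limit_cdf.

(** * Constant and nonconstant potentials, and the conclusion *)

Section main.
Context {R : realType}.

HB.instance Definition _ := @isMeasurableFun.Build _ _ _ _
  (@difference01 R) (@measurable_difference01 R).

Definition increment_law (rho : probability (config R) R) : probability (circle R) R :=
  distribution rho (@difference01 R).

Lemma symmetric_with_increment_law (rho : probability (config R) R) m :
  symmetric_with_increments rho m ->
  symmetric_with_increments rho (pushforward rho (@difference01 R)).
Proof.
move=> rm; have [sym inc] := rm; split=> // S A mA; rewrite inc//.
by apply: eq_bigr => k _; rewrite (increments_difference01 rm (mA k)).
Qed.

(** For beta > 0 all the Gibbs measures are the same product measure, so the family is eventually
    constant. *)
Lemma gibbs_constant_case (U : circle R -> R) (rho : R -> probability (config R) R) :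
  (forall beta : R, 0 < beta ->
     is_gibbs_measure (nn_interaction (fun t => beta * U t)) (rho beta)) ->
  (exists a : R, forall t, U t = a) ->
  weak_star_cvg rho (rho 1) /\ is_product_measure (rho 1) (leb R).
Proof.
move=> gibbs [a Ua].
have prod b : 0 < b -> is_product_measure (rho b) (leb R).
  move=> b0; apply: (@gibbs_constant R (rho b) (b * a)).
  have <- : (fun t => b * U t) = (fun=> b * a) by apply/funext => t; rewrite Ua.
  exact: gibbs.
split; last exact: prod.
move=> f cf; apply: cvg_near_cst; near=> b.
have b0 : 0 < b by near: b; exact: nbhs_pinfty_gt.
rewrite /Rintegral; congr fine; apply: eq_measure_integral => A mA _.
exact: (product_measure_ext (prod b b0) (prod 1 ltr01)).
Unshelve. all: end_near. Qed.

Lemma gibbs_nonconstant_case (U : circle R -> R) (rho : R -> probability (config R) R) :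
  real_analytic U -> ~ (exists a : R, forall t, U t = a) ->
  (forall beta : R, 0 < beta ->
     is_gibbs_measure (nn_interaction (fun t => beta * U t)) (rho beta)) ->
  exists rho_oo : probability (config R) R,
    weak_star_cvg rho rho_oo /\ symmetric_with_increments rho_oo (limit_marginal U).
Proof.
move=> anU ncU gibbs; have [M UM] := bounded_potential anU.
have mU := measurable_potential anU.
pose p b := pressure (fun c => b * U c).
have inc b : 0 < b -> symmetric_with_increments (rho b) (increment_prob (fun c => b * U c - p b)).
  move=> b0; apply: (@gibbs_symmetric_increments R (rho b) (fun c => b * U c) (b * M)).
  - exact: measurable_funM.
  - by move=> c; rewrite normrM gtr0_norm// ler_pM2l.
  - exact: gibbs.
pose m b := increment_law (rho b).
have mE b : 0 < b -> forall A, measurable A -> m b A = increment_prob (fun c => b * U c - p b) A.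
  by move=> b0 A mA; exact: increments_difference01 (inc b b0) mA.
have incm b : 0 < b -> symmetric_with_increments (rho b) (m b).
  by move=> b0; exact: symmetric_with_increment_law (inc b b0).
have [s0 s0P] := nonmaximal_point anU ncU.
have [nu nuE] := limit_marginal_probability anU ncU.
(* The increments at beta = 1 serve as the reference product measure; their law has a bounded
   density, which gives the Lipschitz bound needed for the transport. *)
have Pm : is_product_measure (difference_law (rho 1)) (m 1) by case: (incm 1 ltr01).
have lip := @increment_cdf_lipschitz R U anU s0 (m 1) 1 (p 1) ltr01 (mE 1 ltr01).
have [rho_oo rinc] := increments_limit Pm lip nu.
exists rho_oo; split; last first.
  by have [sym pr] := rinc; split=> // S A mA; rewrite pr//; apply: eq_bigr => k _; rewrite nuE.
move=> f cf; apply: cvg_pinfty_seq_ge1 => u u1 uoo.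
have u0 n : 0 < u n by rewrite (lt_le_trans ltr01).
apply: (increments_weak_cvg Pm lip (fun n => incm (u n) (u0 n)) rinc _ cf) => s sz.
have := increment_cdf_cvg anU ncU s0P mE nuE sz.
by move=> /(cvg_comp _ _ uoo).
Qed.

End main.

Theorem mainTheorem8 (R : realType) (U : circle R -> R)
    (rho : R -> probability (config R) R) :
  real_analytic U ->
  (forall beta : R, 0 < beta ->
     is_gibbs_measure (nn_interaction (fun t => beta * U t)) (rho beta)) ->
  exists rho_oo : probability (config R) R,
    [/\ weak_star_cvg rho rho_oo,
        (exists a : R, forall t, U t = a) ->
          is_product_measure rho_oo (leb R)
      & ~ (exists a : R, forall t, U t = a) ->
          [/\ finite_set (maximizers U),
              (forall c, maximizers U c ->
                 [/\ is_flatness U c (flatness U c),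
                     ~~ odd (flatness U c) & 0 < omega U c]),
              (forall A : set (circle R), measurable A ->
                 pushforward rho_oo difference01 A = limit_marginal U A),
              symmetric_with_increments rho_oo
                (pushforward rho_oo difference01)
            & forall nu : {measure set (config R) -> \bar R},
                symmetric_with_increments nu
                  (pushforward rho_oo difference01) ->
                forall A : set (config R), measurable A -> nu A = rho_oo A]].
Proof.
move=> anU gibbs; have [cU|ncU] := pselect (exists a : R, forall t, U t = a).
  by have [wc pr] := gibbs_constant_case gibbs cU; exists (rho 1); split.
have [rho_oo [wc inc]] := gibbs_nonconstant_case anU ncU gibbs.
exists rho_oo; split=> // _; split.
- exact: finite_maximizers.
- by move=> c /(maximizer_expansion anU ncU)[].
- by move=> A mA; exact: increments_difference01 inc mA.
- exact: symmetric_with_increment_law inc.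
- move=> nu nui A mA.
  exact: symmetric_with_increments_unique (symmetric_with_increment_law inc) nui A mA.
Qed.
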